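(* Let $S=\mathbb{R}^p$ with Borel $\sigma$-field $\mathcal{B}$, let $X=(X_1,X_2,\ldots)\in\mathcal{L}$ with $\nu$, $\theta$, $K$ as in the definition of $\mathcal{L}$, and let $\mu$ be a random probability measure on $(S,\mathcal{B})$ such that, for each fixed $A\in\mathcal{B}$, $$\mu(A)\overset{a.s.}=\lim_n\frac1n\sum_{i=1}^n1_A(X_i)\overset{a.s.}=\lim_nP\bigl(X_{n+1}\in A\mid\mathcal{F}_n\bigr).$$ Suppose $\int\|x\|^2\,\nu(dx)<\infty$, where $\|\cdot\|$ is the Euclidean norm, and $$\int y_i\,K(x)(dy)=0\quad\text{for all }x\in\mathbb{R}^p\text{ and }i=1,\ldots,p,$$ where $y_i$ is the $i$-th coordinate of $y\in\mathbb{R}^p$. Then $$\frac{\sum_{i=1}^nX_i}{\sqrt n}\longrightarrow\mathcal{N}_p(0,\Sigma)\quad\text{stably as }n\to\infty,$$ where $\Sigma$ is the random covariance matrix $\Sigma=\bigl(\int y_i\,y_j\,\mu(dy):1\le i,j\le p\bigr)$.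
   Context: All random elements are defined on a probability space $(\Omega,\mathcal{A},P)$, and $\mathcal{F}_n=\sigma(X_1,\ldots,X_n)$. $\mathcal{P}$ is the set of all probability measures on $\mathcal{B}$, and $\mathcal{C}$ is the $\sigma$-field on $\mathcal{P}$ generated by the maps $p\mapsto p(A)$, $A\in\mathcal{B}$. A kernel on $(S,\mathcal{B})$ is a measurable map $K:(S,\mathcal{B})\to(\mathcal{P},\mathcal{C})$; $K(x)(A)$ is the value of $K(x)$ at $A$. A random probability measure on $(S,\mathcal{B})$ is a measurable map $(\Omega,\mathcal{A})\to(\mathcal{P},\mathcal{C})$. $K$ is a regular conditional distribution for $\nu\in\mathcal{P}$ given a sub-$\sigma$-field $\mathcal{G}\subset\mathcal{B}$ if $K(x)\in\mathcal{P}$ for each $x\in S$, $x\mapsto K(x)(A)$ is $\mathcal{G}$-measurable for each $A\in\mathcal{B}$, and $\nu(A\cap G)=\int_GK(x)(A)\,\nu(dx)$ for all $A\in\mathcal{B}$, $G\in\mathcal{G}$. $\mathcal{L}$ is the class of all sequences $X=(X_1,X_2,\ldots)$ of $S$-valued random variables for which there are $\nu\in\mathcal{P}$, a constant $\theta>0$ and a kernel $K$ which is a regular conditional distribution for $\nu$ given some sub-$\sigma$-field $\mathcal{G}\subset\mathcal{B}$, such that $X_1\sim\nu$ and $P(X_{n+1}\in\cdot\mid\mathcal{F}_n)=\frac{\theta\nu(\cdot)+\sum_{i=1}^nK(X_i)(\cdot)}{n+\theta}$ a.s. for all $n\ge1$. Each $X\in\mathcal{L}$ is exchangeable, so a random probability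 measure $\mu$ as in the claim exists. $\mathcal{N}_p(0,\Sigma)$ is the (possibly degenerate) $p$-dimensional Gaussian law with mean $0$ and covariance matrix $\Sigma$; since $\Sigma$ is random, it is a random probability measure. Stable convergence: if $N$ is a random probability measure on $(S,\mathcal{B})$ and $(Y_n)$ are $S$-valued random variables, $Y_n\to N$ stably if $E[N(f)\mid H]=\lim_nE[f(Y_n)\mid H]$ for all bounded continuous $f:S\to\mathbb{R}$ and all events $H\in\mathcal{A}$ with $P(H)>0$, where $N(f)=\int f\,dN$. *)

(* Defs.v *)
From HB Require Import structures.
From mathcomp Require Import all_boot all_order all_algebra.
From mathcomp Require Import all_classical all_reals all_analysis.
From mathcomp Require Import measurable_realfun.
Set Implicit Arguments.
Unset Strict Implicit.
Unset Printing Implicit Defensive.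
Import Order.TTheory GRing.Theory Num.Theory.
Import numFieldNormedType.Exports.

Local Open Scope classical_set_scope.
Local Open Scope ring_scope.

(* The Borel sigma-field. The library's topology on matrices is the one of
   entrywise convergence, i.e. the Euclidean topology. *)
HB.instance Definition _ (R : realType) (m n : nat) :=
  @isMeasurable.Build (sigma_display (@open 'M[R]_(m, n))) 'M[R]_(m, n)
    <<s @open 'M[R]_(m, n) >>
    (@sigma_algebra0 _ setT _) (@sigma_algebraC _ _)
    (@sigma_algebra_bigcup _ setT _).

Section Euclidean.
Context {R : realType} {p : nat}.

Definition euclidean_norm (x : 'rV[R]_p) : R := Num.sqrt (\sum_i x 0 i ^+ 2).

(* [normal_prob m 0] is not the point mass at [m] but a junk value. *)
Definition normal_law (m s : R) : set R -> \bar R :=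
  if s == 0 then \d_m else normal_prob m s.

Definition is_gaussian (Q : probability 'rV[R]_p R) : Prop :=
  forall t : 'rV[R]_p, exists m s : R, forall B : set R, measurable B ->
    Q ((fun x : 'rV[R]_p => \sum_i t 0 i * x 0 i) @^-1` B) = normal_law m s B.

(* [Q] is the possibly degenerate Gaussian law N_p(m, Sigma). *)
Definition is_gaussian_law (m : 'rV[R]_p) (Sigma : 'M[R]_p)
    (Q : probability 'rV[R]_p R) : Prop :=
  [/\ is_gaussian Q,
      forall i, ('E_Q[fun x : 'rV[R]_p => x 0%R i] = (m 0%R i)%:E)%E &
      forall i j, covariance Q (fun x : 'rV[R]_p => x 0 i)
                               (fun x : 'rV[R]_p => x 0 j) = (Sigma i j)%:E].

(* Real-valued integrals: an entry that is not integrable gets a junk value. *)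
Definition second_moment_mx (Q : probability 'rV[R]_p R) : 'M[R]_p :=
  \matrix_(i, j) \int[Q]_y (y 0 i * y 0 j).

End Euclidean.

Section Conditioning.
Context {d : measure_display} {Omega : measurableType d} {R : realType}.
Variable P : probability Omega R.

(* [Y] is a version of P(E | G), for a sub-sigma-field [G]. *)
Definition is_cond_prob (G : set (set Omega)) (E : set Omega)
    (Y : Omega -> \bar R) : Prop :=
  [/\ measurable_fun [set: g_sigma_algebraType G] Y,
      P.-integrable setT Y &
      forall H, G H -> (\int[P]_(w in H) Y w = P (E `&` H))%E].

(* E[Z | H] for an event [H] of positive probability. *)
Definition expectation_given (H : set Omega) (Z : Omega -> R) : R :=
  (\int[P]_(w in H) Z w) / fine (P H).

Definition stable_cvg (p : nat) (Y : nat -> Omega -> 'rV[R]_p)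
    (N : {mfun Omega >-> pprobability 'rV[R]_p R}) : Prop :=
  forall f : 'rV[R]_p -> R, continuous f -> bounded_fun f ->
  forall H : set Omega, measurable H -> (0 < P H)%E ->
    expectation_given H (fun w => f (Y n w)) @[n --> \oo] -->
    expectation_given H (fun w => \int[N w]_x f x).

End Conditioning.

Section ClassL.
Context {d d' : measure_display} {Omega : measurableType d}
  {S : measurableType d'} {R : realType}.

Definition is_rcd (nu : probability S R) (G : set (set S))
    (K : {mfun S >-> pprobability S R}) : Prop :=
  [/\ sigma_algebra setT G /\ G `<=` measurable,
      forall A, measurable A ->
        measurable_fun [set: g_sigma_algebraType G] (K ^~ A) &
      forall A B, measurable A -> G B ->
        (nu (A `&` B) = \int[nu]_(x in B) K x A)%E].

(* Sequences are indexed from 0: [X i] is the variable X_(i+1), so that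
   [past X n] is the sigma-field generated by the first [n] variables and
   [X n] is the next one. *)
Definition past (X : nat -> {mfun Omega >-> S}) (n : nat) : set (set Omega) :=
  g_sigma_preimage (fun i : 'I_n => X i : Omega -> S).

Definition in_classL (P : probability Omega R) (X : nat -> {mfun Omega >-> S})
    (nu : probability S R) (theta : R) (K : {mfun S >-> pprobability S R}) :
    Prop :=
  [/\ 0 < theta,
      exists G, is_rcd nu G K,
      forall A, measurable A -> distribution P (X 0%N) A = nu A &
      forall n, (1 <= n)%N -> forall A, measurable A ->
        is_cond_prob P (past X n) (X n @^-1` A)
          (fun w => (((n%:R + theta)^-1)%:E *
                     (theta%:E * nu A + \sum_(i < n) K (X i w) A))%E)].

(* [mu] is the a.s. limit of the empirical and of the predictive measures. *)
Definition is_limit_measure (P : probability Omega R)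
    (X : nat -> {mfun Omega >-> S}) (mu : {mfun Omega >-> pprobability S R}) :
    Prop :=
  forall A, measurable A ->
    {ae P, forall w,
       (n%:R^-1 * \sum_(i < n) \1_A (X i w))%:E @[n --> \oo] --> mu w A} /\
    forall q : nat -> Omega -> \bar R,
      (forall n, is_cond_prob P (past X n) (X n @^-1` A) (q n)) ->
      {ae P, forall w, q n w @[n --> \oo] --> mu w A}.

End ClassL.

(* Main.v *)
Require Import Defs.
From HB Require Import structures.
From mathcomp Require Import all_boot all_order all_algebra.
From mathcomp Require Import all_classical all_reals all_analysis.
From mathcomp Require Import measurable_realfun.
From mathcomp Require Import ring lra.
Set Implicit Arguments.
Unset Strict Implicit.
Unset Printing Implicit Defensive.
Import Order.TTheory GRing.Theory Num.Theory.
Import numFieldNormedType.Exports.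
Local Open Scope classical_set_scope.
Local Open Scope ring_scope.

(* Given the past, the next variable has the predictive law. The kernels K(x), and nu as a mixture of
   them, have mean 0, so for each direction t the variables t.X_n are martingale differences; their
   conditional variances v_n (the predictive integrals of (t.y)^2) converge in L^1 to
   v = int (t.y)^2 dmu. With S_j the partial sums of t.X, Lindeberg telescoping of
   E[Z cos(S_j / sqrt n + c) exp(-(1 - j/n) v_m / 2)] over m <= j <= n, for Z measurable with
   respect to the first m variables, gives E[1_H cos(S_n / sqrt n + c)] -> E[1_H cos(c) exp(-v / 2)]
   first for H in the past and then for every event H, by projecting 1_H in L^2.
   Cosines give trigonometric polynomials, and these approximate a bounded Lipschitz function up to an
   error controlled by second moments, which are bounded uniformly in n, so that no tightness argument
   is needed. A bounded continuous function is the increasing limit of its Lipschitz inf-convolutions.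
   The limit kernel maps a standard normal vector by a Cholesky factor of Sigma, which depends
   measurably on Sigma even where Sigma is singular. *)

(** The limit variance [v] is not measurable with respect to any finite past. A compensating
    exponential containing [v] would destroy the martingale property of the product, so the variance
    is frozen at [v_m]: every factor is then known at time [m], and the price is [E|v_j - v_m|],
    small uniformly in [j >= m]. All [X_n] have law [nu], because [nu] is the mixture of the [K(x)]
    under itself; one Taylor remainder therefore serves all summands. What is given about the
    predictive laws and about [mu] concerns one event at a time, with null sets depending on the
    event. Statements about integrals of unbounded functions are obtained by passing from indicators
    to integrable functions, with contractions of [L^1] in place of pointwise arguments. A free
    phase [c] in the cosines covers sines as well and keeps all computations real. *)

Section RealBounds.
Context {R : realType}.
Implicit Types (a b h x y : R) (n : nat).

(** Monotonicity of [y - sin y] gives [sin y <= y]; the half-angle formula turns this into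
    [1 - y^2/2 <= cos y]; hence [sin y - (y - y^3/6)] has a nonnegative derivative. *)
Lemma sin_bounds x : 0 <= x -> x - x ^+ 3 / 6 <= sin x <= x.
Proof.
move=> x0.
have nd (f f' : R -> R) (z : R) : (forall y : R, is_derive y (1 : R) f (f' y)) ->
    (forall y, 0 <= y -> 0 <= f' y) -> 0 <= z -> f 0 <= f z.
  move=> df f'0 z0; apply: (@ger0_derive1_ndecry R f 0) => //.
  - by move=> y; rewrite in_itv/= andbT => y0; rewrite derive1E derive_val f'0// ltW.
  - apply: continuous_subspaceT => y; apply/differentiable_continuous/derivable1_diffP.
    have ? := df y; exact: ex_derive.
have sinle (z : R) : 0 <= z -> sin z <= z.
  move=> z0.
  have df (y : R) : is_derive y (1 : R) (fun x : R => x - sin x) (1 - cos y).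
    exact: is_deriveB.
  have f'0 (y : R) : 0 <= y -> 0 <= 1 - cos y by move=> _; rewrite subr_ge0 cos_le1.
  by have := nd _ _ z df f'0 z0; rewrite sin0 !subr0 subr_ge0.
have cosge (y : R) : 0 <= y -> 1 - y ^+ 2 / 2 <= cos y.
  move=> y0; have -> : cos y = 1 - 2 * sin (y / 2) ^+ 2.
    rewrite {1}(_ : y = (y / 2) *+ 2); last by rewrite mulr2n -splitr.
    by rewrite cos_mulr2n cos2sin2 !mulr2n; ring.
  have s0 : sin (y / 2) <= y / 2 by apply: sinle; rewrite divr_ge0.
  have s1 : - (y / 2) <= sin (y / 2).
    have [y1|y1] := leP (y / 2) 1.
      rewrite (le_trans (y := 0)) ?oppr_le0 ?divr_ge0//.
      apply: sin_ge0_pi; rewrite divr_ge0//= (le_trans y1)//.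
      by rewrite (le_trans _ (pi_ge2 R))// ler1n.
    by rewrite (le_trans _ (sin_geN1 _))// lerN2 ltW.
  by move: (sin _) s0 s1 => s s0 s1; nra.
rewrite sinle// andbT.
have df (y : R) : is_derive y (1 : R) (fun x : R => sin x - (x - x ^+ 3 / 6)) (cos y - (1 - y ^+ 2 / 2)).
  apply: is_derive_eq; rewrite -![_ *: _]/(_ * _); by field.
have f'0 (y : R) : 0 <= y -> 0 <= cos y - (1 - y ^+ 2 / 2).
  by move=> y0; rewrite subr_ge0 cosge.
by have := nd _ _ x df f'0 x0; rewrite sin0 expr0n/= mul0r !subr0 subr_ge0.
Qed.

Lemma normr_sin_le x : `|sin x| <= `|x|.
Proof.
wlog x0 : x / 0 <= x => [H|].
  have [|x0] := leP 0 x; first exact: H.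
  by rewrite -normrN -sinN -(normrN x) H// oppr_ge0 ltW.
rewrite (ger0_norm x0) ler_norml; have /andP[_ ->] := sin_bounds x0; rewrite andbT.
have [y1|y1] := leP x 1.
  rewrite (le_trans (y := 0)) ?oppr_le0//.
  apply: sin_ge0_pi; rewrite x0//= (le_trans y1)//.
  by rewrite (le_trans _ (pi_ge2 R))// ler1n.
by rewrite (le_trans _ (sin_geN1 _))// lerN2 ltW.
Qed.

(** Lindeberg's form of the Taylor remainder. The cube makes [n] remainders at [x / sqrt n] vanish
    in the limit; the square bounds their sum by [x^2], which is integrable when only second moments
    exist. *)
Definition cubic_rem h : R := Num.min (h ^+ 2) (`|h| ^+ 3).

Lemma cubic_rem_ge0 h : 0 <= cubic_rem h.
Proof. by rewrite le_min sqr_ge0 exprn_ge0. Qed.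

Lemma sin_sub_le h : `|sin h - h| <= cubic_rem h.
Proof.
have norm x : `|sin x - x| <= Num.min (2 * `|x|) (`|x| ^+ 3 / 6).
  wlog x0 : x / 0 <= x => [H|].
    have [|x0] := leP 0 x; first exact: H.
    have := H (- x); rewrite sinN opprK addrC distrC normrN; apply; rewrite oppr_ge0; exact: ltW.
  rewrite le_min; apply/andP; split.
    rewrite (le_trans (ler_normB _ _))// mulr_natl mulr2n lerD// normr_sin_le//.
  rewrite (ger0_norm x0) distrC ger0_norm; have := sin_bounds x0; lra.
rewrite (le_trans (norm h))// le_min -(real_normK (num_real h)).
have := normr_ge0 h; move: `|h| => {}h h0; rewrite !ge_min; apply/andP; split.
  by have [h2|h2] := leP 2 h; apply/orP; [left|right]; nra.
by apply/orP; right; nra.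
Qed.

(** With [s = sin (|h|/2)] the error equals [2 (|h|/2 - s) (|h|/2 + s)]. The first factor is at most
    [(|h|/2)^3 / 6] and the second at most [|h|]: this is of order four, which suffices for the cube
    when [|h| < 1]. *)
Lemma cos_sub_le h : `|cos h - (1 - h ^+ 2 / 2)| <= cubic_rem h.
Proof.
have := sin_bounds (x := `|h / 2|) (normr_ge0 _).
have -> : cos h = 1 - 2 * sin (`|h / 2|) ^+ 2.
  rewrite -[LHS]cos_norm {1}(_ : `|h| = (`|h / 2|) *+ 2); last first.
    by rewrite mulr2n normrM normfV (@ger0_norm _ 2)// -splitr.
  by rewrite cos_mulr2n cos2sin2 !mulr2n; ring.
rewrite /cubic_rem -(real_normK (num_real h)) normrM normfV (@ger0_norm _ 2)//.
set k : R := `|h|; have h0 : 0 <= k := normr_ge0 h; move: k h0 => {}h h0; set s := sin _ => /andP[s1 s2].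
have s3 : - (h / 2) <= s.
  have := normr_sin_le (h / 2); rewrite -/s ler_norml (ger0_norm (_ : 0 <= h / 2)) ?divr_ge0//.
  by case/andP.
have E : 1 - 2 * s ^+ 2 - (1 - h ^+ 2 / 2) = 2 * ((h / 2 - s) * (h / 2 + s)) by field.
rewrite E; have g0 : 0 <= (h / 2 - s) * (h / 2 + s) by rewrite mulr_ge0//; lra.
have g1 : 0 <= 2 * ((h / 2 - s) * (h / 2 + s)) by rewrite mulr_ge0.
rewrite (ger0_norm g1) le_min; apply/andP; split; first by rewrite -E; nra.
have [h2|h2] := leP 1 h.
  apply: (@le_trans _ _ (h ^+ 2)); first by rewrite -E; nra.
  by rewrite (exprSr h 2) ler_peMr// sqr_ge0.
apply: (@le_trans _ _ (2 * ((h / 2) ^+ 3 / 6 * h))).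
  by rewrite ler_pM2l// ler_pM//; lra.
have : 0 <= h ^+ 3 by rewrite exprn_ge0.
have -> : (h / 2) ^+ 3 / 6 = h ^+ 3 / 48 by field.
by nra.
Qed.

Lemma cos_taylor a h :
  `|cos (a + h) - (cos a - h * sin a - h ^+ 2 / 2 * cos a)| <= 2 * cubic_rem h.
Proof.
rewrite cosD.
have -> : cos a * cos h - sin a * sin h - (cos a - h * sin a - h ^+ 2 / 2 * cos a) =
  cos a * (cos h - (1 - h ^+ 2 / 2)) - sin a * (sin h - h) by ring.
rewrite (le_trans (ler_normB _ _))// !normrM mulr_natl mulr2n lerD//.
  by rewrite (le_trans _ (cos_sub_le h))// ler_piMl// cos_max.
by rewrite (le_trans _ (sin_sub_le h))// ler_piMl// sin_max.
Qed.

(** The counterpart of [cubic_rem] for [expR (- y)] at [y = v / (2 n)]: the linear bound dominates,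
    the quadratic one gives the limit 0. *)
Definition quad_rem y : R := Num.min y (y ^+ 2).

Lemma expRN_taylor y : 0 <= y -> `|expR (- y) - (1 - y)| <= quad_rem y.
Proof.
move=> y0; have e1 := expR_ge1Dx (- y); have e2 := expR_ge1Dx y.
have e3 : expR (- y) <= 1 by rewrite -expR0 ler_expR oppr_le0.
have e4 := expRxMexpNx_1 y; have e5 := expR_gt0 (- y).
rewrite ger0_norm; last by lra.
rewrite le_min; apply/andP; split; first by lra.
have : (1 + y) * expR (- y) <= 1 by rewrite -[X in _ <= X]e4 ler_pM2r.
move: (expR (- y)) e1 e3 e5 => e e1 e3 e5 H.
(* [(1 + y) e <= 1 <= 1 + y^3 = (1 + y) (1 - y + y^2)], and the factor [1 + y] is cancelled. *)
have H1 : (1 + y) * e <= (1 + y) * (1 - y + y ^+ 2).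
  rewrite (le_trans H)// (_ : _ * _ = 1 + y ^+ 3); last by ring.
  by rewrite lerDl exprn_ge0.
by rewrite ler_pM2l in H1; lra.
Qed.

Lemma quad_rem_ge0 y : 0 <= y -> 0 <= quad_rem y.
Proof. by move=> y0; rewrite le_min y0 sqr_ge0. Qed.

Lemma expRN_lipschitz a b : 0 <= a -> 0 <= b -> `|expR (- a) - expR (- b)| <= `|a - b|.
Proof.
wlog ab : a b / a <= b => [H a0 b0|a0 b0].
  have [ab|ab] := leP a b; first exact: H.
  by rewrite distrC (distrC a) H// ltW.
have -> : expR (- a) - expR (- b) = expR (- a) * (1 - expR (- (b - a))).
  by rewrite mulrBr mulr1 -expRD; congr (_ - expR _); ring.
rewrite (distrC a) (ger0_norm (_ : 0 <= b - a)) ?subr_ge0// normrM.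
have e1 := expR_ge1Dx (- (b - a)).
have e2 : expR (- (b - a)) <= 1 by rewrite -expR0 ler_expR; lra.
have e3 : expR (- a) <= 1 by rewrite -expR0 ler_expR; lra.
have e4 := expR_gt0 (- a).
rewrite (ger0_norm (ltW e4)) ger0_norm ?subr_ge0//.
by nra.
Qed.

Lemma exprB_le n a b : `|a| <= 1 -> `|b| <= 1 -> `|a ^+ n - b ^+ n| <= n%:R * `|a - b|.
Proof.
move=> a1 b1; elim: n => [|n ih]; first by rewrite !expr0 subrr normr0 mul0r.
have -> : a ^+ n.+1 - b ^+ n.+1 = a * (a ^+ n - b ^+ n) + (a - b) * b ^+ n.
  by rewrite !exprS; ring.
rewrite (le_trans (ler_normD _ _))// !normrM -natr1 mulrDl mul1r lerD//.
  by rewrite (le_trans _ ih)// ler_piMl.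
by rewrite ler_piMr// normrX exprn_ile1.
Qed.

Lemma cubic_rem_scale_le x n : n%:R * cubic_rem (x / Num.sqrt n%:R) <= x ^+ 2.
Proof.
case: n => [|n]; first by rewrite mul0r sqr_ge0.
rewrite (le_trans (y := n.+1%:R * (x / Num.sqrt n.+1%:R) ^+ 2))//.
  by rewrite ler_pM2l ?ltr0n// ge_min lexx.
by rewrite expr_div_n sqr_sqrtr// mulrC divfK// pnatr_eq0.
Qed.

Lemma sqrtn_inv_cvg0 : (fun n => (Num.sqrt n%:R : R)^-1) @ \oo --> 0.
Proof.
apply/gtr0_cvgV0; last first.
  apply/cvgryPge => A; near=> n.
  rewrite (le_trans (ler_norm A))// -sqrtr_sqr ler_wsqrtr//.
  by near: n; exact: nbhs_infty_ger.
by near=> n; rewrite sqrtr_gt0 ltr0n; near: n; exact: nbhs_infty_gt.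
Unshelve. all: by end_near. Qed.

Lemma n_inv_cvg0 : (fun n => (n%:R : R)^-1) @ \oo --> 0.
Proof.
apply/gtr0_cvgV0; last exact: cvgr_idn.
by near=> n; rewrite ltr0n; near: n; exact: nbhs_infty_gt.
Unshelve. all: by end_near. Qed.

Lemma cubic_rem_scale_cvg0 x : (fun n => n%:R * cubic_rem (x / Num.sqrt n%:R)) @ \oo --> 0.
Proof.
have sq := sqrtn_inv_cvg0.
apply: (@squeeze_cvgr _ _ _ _ (cst 0) (fun n => `|x| ^+ 3 * (Num.sqrt n%:R)^-1)).
- near=> n; rewrite mulr_ge0 ?cubic_rem_ge0//=.
  have n0 : 0 < n%:R :> R by rewrite ltr0n; near: n; exact: nbhs_infty_gt.
  rewrite (le_trans (y := n%:R * `|x / Num.sqrt n%:R| ^+ 3))//.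
    by rewrite ler_pM2l// ge_min lexx orbT.
  rewrite normrM normfV (ger0_norm (sqrtr_ge0 _)).
  have s0 : 0 < Num.sqrt n%:R :> R by rewrite sqrtr_gt0.
  rewrite -{1}(sqr_sqrtr (ltW n0)) le_eqVlt; apply/orP; left; apply/eqP; field.
  by rewrite gt_eqF.
- exact: cvg_cst.
- by rewrite -[X in _ --> X](mulr0 (`|x| ^+ 3)); exact: cvgMr.
Unshelve. all: by end_near. Qed.

Lemma quad_rem_scale_le x n : 0 <= x -> n%:R * quad_rem (x / (2 * n%:R)) <= x.
Proof.
move=> x0; case: n => [|n]; first by rewrite mul0r.
rewrite (le_trans (y := n.+1%:R * (x / (2 * n.+1%:R))))//.
  by rewrite ler_pM2l ?ltr0n// ge_min lexx.
by rewrite invfM mulrA mulrCA mulrAC mulfV ?pnatr_eq0// mul1r; lra.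
Qed.

Lemma quad_rem_scale_cvg0 x : 0 <= x ->
  (fun n => n%:R * quad_rem (x / (2 * n%:R))) @ \oo --> 0.
Proof.
move=> x0.
have sq := n_inv_cvg0.
apply: (@squeeze_cvgr _ _ _ _ (cst 0) (fun n => x ^+ 2 * (n%:R)^-1)).
- near=> n; rewrite mulr_ge0 ?quad_rem_ge0 ?divr_ge0 ?mulr_ge0//=.
  have n0 : 0 < n%:R :> R by rewrite ltr0n; near: n; exact: nbhs_infty_gt.
  rewrite (le_trans (y := n%:R * (x / (2 * n%:R)) ^+ 2))//.
    by rewrite ler_pM2l// ge_min lexx orbT.
  have -> : n%:R * (x / (2 * n%:R)) ^+ 2 = (x ^+ 2 / n%:R) / 4.
    by field; rewrite gt_eqF.
  by have : 0 <= x ^+ 2 / n%:R; [rewrite divr_ge0 ?sqr_ge0|lra].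
- exact: cvg_cst.
- by rewrite -[X in _ --> X](mulr0 (x ^+ 2)); exact: cvgMr.
Unshelve. all: by end_near. Qed.

End RealBounds.

(** * Borel measurability and linear forms on row vectors *)

Section BorelRow.
Context {R : realType} {p : nat}.
Implicit Types (t x y : 'rV[R]_p).

Definition dot t x : R := \sum_i t 0 i * x 0 i.

Let box (q : 'rV[rat]_p) (k : nat) : set 'rV[R]_p :=
  [set x | forall i, x 0 i \in `](ratr (q 0 i) - k.+1%:R^-1), (ratr (q 0 i) + k.+1%:R^-1)[].

Let open_box (U : set 'rV[R]_p) x : open U -> U x ->
  exists q k, box q k x /\ box q k `<=` U.
Proof.
move=> oU Ux; have : nbhs x U by exact: open_nbhs_nbhs.
move=> /nbhs_ballP[e /= e0 eU].
(* A box has width [2 / k.+1], so a box containing [x] stays within distance [e] of it. *)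
have [k ke] : exists k : nat, k.+1%:R^-1 < e / 2.
  have /cvgrPdist_lt /(_ (e / 2)) := @cvg_harmonic R.
  rewrite divr_gt0// => /(_ isT) [k _ /(_ k (leqnn _))].
  by rewrite /= sub0r normrN ger0_norm// => ?; exists k.
have k0 : 0 < k.+1%:R^-1 :> R by rewrite invr_gt0.
have qex (i : 'I_p) : exists q : rat, x 0 i \in `](ratr q - k.+1%:R^-1), (ratr q + k.+1%:R^-1)[.
  move: k0; set r := _^-1 => r0.
  have /rat_in_itvoo[q] : x 0 i - r < x 0 i + r by lra.
  by rewrite in_itv/= => /andP[h1 h2]; exists q; rewrite in_itv/=; lra.
have [q qx] := choice qex.
exists (\row_i q i), k; split=> [i|y By]; first by rewrite mxE.
apply: eU; split=> // i j; rewrite (ord1 i) /ball/=.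
have := qx j; have := By j; rewrite mxE !in_itv/= => /andP[a b] /andP[a' b'].
by move: k0 ke a b a' b'; set r := _^-1 => *; rewrite ltr_norml; lra.
Qed.

(** Every open set is a countable union of boxes with rational centres and radii [1 / k.+1],
    enumerated by [unpickle]; the preimage of a box is a finite intersection of preimages of
    intervals under the coordinates. *)
Lemma measurable_fun_row d (T : measurableType d) (f : T -> 'rV[R]_p) :
  (forall i, measurable_fun setT (fun w => f w 0 i)) -> measurable_fun setT f.
Proof.
move=> mf; apply: (measurability (@open 'rV[R]_p)) => // _ [U oU <-]; rewrite setTI.
pose A n := if unpickle n is Some (q, k) then
   if pselect (box q k `<=` U) then box q k else set0 else set0.
have -> : U = \bigcup_n A n.
  rewrite eqEsubset; split => [x Ux|x [n _]]; last first.
    rewrite /A; case: unpickle => [[q k]|//]; by case: (pselect (box q k `<=` U)) => [BU|nBU]; [exact: BU|].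
  have [q [k [Bx BU]]] := open_box oU Ux.
  by exists (pickle (q, k)) => //; rewrite /A pickleK; case: pselect.
rewrite preimage_bigcup; apply: bigcupT_measurable => n; rewrite /A.
case: unpickle => [[q k]|]; last by rewrite preimage_set0.
case: (pselect (box q k `<=` U)) => [BU|nBU] /=; last by rewrite preimage_set0.
rewrite (_ : _ @^-1` _ = \bigcap_(i in [set: 'I_p])
   ((fun w => f w 0 i) @^-1` `](ratr (q 0 i) - k.+1%:R^-1), (ratr (q 0 i) + k.+1%:R^-1)[)).
  by apply: fin_bigcap_measurable => // i _; rewrite -[X in measurable X]setTI; exact: mf.
by rewrite eqEsubset; split => [w Bw i _|w Bw i]; [exact: Bw|exact: Bw].
Qed.

Lemma continuous_measurable_row (f : 'rV[R]_p -> R) : continuous f -> measurable_fun setT f.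
Proof.
move=> cf; apply: (measurability (RGenOpens.G (R := R))).
  exact: RGenOpens.measurableE.
move=> _ [_ [a [b ->]] <-]; rewrite setTI; apply: sub_sigma_algebra.
by move/continuousP: cf; apply; exact: itv_open.
Qed.

Lemma measurable_coord i : measurable_fun setT (fun x : 'rV[R]_p => x 0 i).
Proof. by apply: continuous_measurable_row => x; exact: coord_continuous. Qed.

Lemma measurable_row_coord d (T : measurableType d) (f : T -> 'rV[R]_p) i :
  measurable_fun setT f -> measurable_fun setT (fun w => f w 0 i).
Proof. by move=> mf; exact: (measurableT_comp (measurable_coord i) mf). Qed.

Lemma measurable_dot t : measurable_fun setT (dot t).
Proof.
apply: measurable_sum => i; apply: measurable_funM => //.
exact: measurable_coord.
Qed.

Lemma dotD t x y : dot t (x + y) = dot t x + dot t y.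
Proof. by rewrite /dot -big_split; apply: eq_bigr => i _; rewrite !mxE mulrDr. Qed.

Lemma dotZ t (a : R) x : dot t (a *: x) = a * dot t x.
Proof. by rewrite /dot big_distrr; apply: eq_bigr => i _; rewrite !mxE mulrCA. Qed.

Lemma dot0 t : dot t 0 = 0.
Proof. by rewrite -(scale0r (0 : 'rV_p)) dotZ mul0r. Qed.

Lemma dot_sum t I (r : seq I) (F : I -> 'rV[R]_p) :
  dot t (\sum_(i <- r) F i) = \sum_(i <- r) dot t (F i).
Proof.
by elim: r => [|a r ih]; rewrite ?big_nil ?dot0// !big_cons dotD ih.
Qed.

Lemma dot_delta i x : dot (delta_mx 0 i) x = x 0 i.
Proof.
rewrite /dot (bigD1 i)//= mxE !eqxx mul1r big1 ?addr0// => j ji.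
by rewrite mxE (negbTE ji) andbF mul0r.
Qed.

Lemma dotDl t t' x : dot (t + t') x = dot t x + dot t' x.
Proof. by rewrite /dot -big_split; apply: eq_bigr => i _; rewrite !mxE mulrDl. Qed.

End BorelRow.

(** * Integrable functions and mixtures *)

Section L1.
Context {d : measure_display} {T : measurableType d} {R : realType}.
Variable mu : {measure set T -> \bar R}.
Implicit Types (f g : T -> R) (a : R).

Definition L1 f := mu.-integrable setT (EFin \o f).

Lemma L1_measurable f : L1 f -> measurable_fun setT f.
Proof. by move/measurable_int/measurable_EFinP. Qed.

Lemma L1_dom f g : measurable_fun setT f -> L1 g -> (forall w, `|f w| <= g w) -> L1 f.
Proof.
move=> mf Lg fg; apply: (@le_integrable _ _ _ mu setT measurableT _ (EFin \o g)) => //.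
  exact/measurable_EFinP.
by move=> w _ /=; rewrite lee_fin (le_trans (fg w))// ler_norm.
Qed.

Lemma L1D f g : L1 f -> L1 g -> L1 (fun w => f w + g w).
Proof. by move=> Lf Lg; have := integrableD measurableT Lf Lg. Qed.

Lemma L1B f g : L1 f -> L1 g -> L1 (fun w => f w - g w).
Proof. by move=> Lf Lg; have := integrableB measurableT Lf Lg. Qed.

Lemma L1Z a f : L1 f -> L1 (fun w => a * f w).
Proof. by move=> Lf; have := integrableZl measurableT a Lf. Qed.

Lemma L1_norm f : L1 f -> L1 (fun w => `|f w|).
Proof. exact: integrable_norm. Qed.

Lemma L1_0 : L1 (fun=> 0).
Proof. exact: integrable0. Qed.

Lemma L1_sum I (s : seq I) (F : I -> T -> R) :
  (forall i, L1 (F i)) -> L1 (fun w => \sum_(i <- s) F i w).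
Proof.
move=> LF; elim: s => [|i s ih].
  by under eq_fun do rewrite big_nil; exact: L1_0.
by under eq_fun do rewrite big_cons; exact: L1D.
Qed.

Lemma L1_mulb f g a : measurable_fun setT f -> (forall w, `|f w| <= a) -> L1 g ->
  L1 (fun w => f w * g w).
Proof.
move=> mf fa Lg; apply: (@L1_dom _ (fun w => a * `|g w|)).
- by apply: measurable_funM => //; exact: L1_measurable.
- by apply: L1Z; exact: L1_norm.
- by move=> w; rewrite normrM ler_wpM2r.
Qed.

Lemma L1_ge0 f : measurable_fun setT f -> (forall w, 0 <= f w) ->
  (\int[mu]_w (f w)%:E < +oo)%E -> L1 f.
Proof.
move=> mf f0 foo; apply/integrableP; split; first exact/measurable_EFinP.
by under eq_integral do rewrite gee0_abs ?lee_fin//.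
Qed.

Lemma EFin_Rintegral f : L1 f -> (\int[mu]_w (f w)%:E = (\int[mu]_w f w)%:E)%E.
Proof. by move=> Lf; rewrite fineK//; exact: integrable_fin_num. Qed.

Lemma Rintegral_sumL I (s : seq I) (F : I -> T -> R) : (forall i, L1 (F i)) ->
  \int[mu]_w (\sum_(i <- s) F i w) = \sum_(i <- s) \int[mu]_w F i w.
Proof.
move=> LF; elim: s => [|i s ih].
  by under eq_Rintegral do rewrite big_nil; rewrite big_nil /Rintegral integral0.
under eq_Rintegral do rewrite big_cons.
by rewrite RintegralD ?ih ?big_cons//; [exact: LF|exact: L1_sum].
Qed.

Lemma Rintegral_norm_le f g : measurable_fun setT f -> L1 g -> (forall w, `|f w| <= g w) ->
  `|\int[mu]_w f w| <= \int[mu]_w g w.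
Proof.
move=> mf Lg fg; have Lf := L1_dom mf Lg fg.
rewrite (le_trans (le_normr_Rintegral measurableT Lf))//.
by apply: le_Rintegral => //; exact: L1_norm.
Qed.

Lemma Rintegral_ae_eq f g : L1 f -> L1 g -> {ae mu, forall w, f w = g w} ->
  \int[mu]_w f w = \int[mu]_w g w.
Proof.
move=> Lf Lg fg; congr fine; apply: ae_eq_integral => //.
- exact: measurable_int Lf.
- exact: measurable_int Lg.
- by apply: filterS fg => w fg _ /=; rewrite fg.
Qed.

Lemma cvg_Rintegral_dom (F : nat -> T -> R) f g :
  (forall n, measurable_fun setT (F n)) -> measurable_fun setT f -> L1 g ->
  (forall n w, `|F n w| <= g w) -> {ae mu, forall w, F n w @[n --> \oo] --> f w} ->
  \int[mu]_w F n w @[n --> \oo] --> \int[mu]_w f w.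
Proof.
move=> mF mf Lg Fg Ff.
have [|||||Lf _ cv] := @dominated_convergence _ T R mu setT measurableT
  (fun n => EFin \o F n) (EFin \o f) (EFin \o g).
- by move=> n; exact/measurable_EFinP.
- exact/measurable_EFinP.
- by apply: filterS Ff => w Ff _; apply: cvg_EFin => //; exact: nearW.
- exact: Lg.
- by apply: aeW => w n _ /=; rewrite lee_fin.
by apply: fine_cvg; rewrite fineK//; exact: integrable_fin_num.
Qed.

Lemma L1_ae_lim (F : nat -> T -> R) f g :
  (forall n, measurable_fun setT (F n)) -> measurable_fun setT f -> L1 g ->
  (forall n w, `|F n w| <= g w) -> {ae mu, forall w, F n w @[n --> \oo] --> f w} ->
  L1 f.
Proof.
move=> mF mf Lg Fg Ff.
have [|||||Lf _ cv//] := @dominated_convergence _ T R mu setT measurableT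
  (fun n => EFin \o F n) (EFin \o f) (EFin \o g).
- by move=> n; exact/measurable_EFinP.
- exact/measurable_EFinP.
- by apply: filterS Ff => w Ff _; apply: cvg_EFin => //; exact: nearW.
- exact: Lg.
- by apply: aeW => w n _ /=; rewrite lee_fin.
Qed.

Lemma Rintegral_indic A : measurable A -> \int[mu]_w (\1_A w : R) = fine (mu A).
Proof. by move=> mA; rewrite /Rintegral integral_indic// setIT. Qed.

Lemma Rintegral_setE A f : measurable A ->
  \int[mu]_(w in A) f w = \int[mu]_w (\1_A w * f w).
Proof.
move=> mA; rewrite Rintegral_mkcond; apply: eq_Rintegral => w _.
by rewrite patchE indicE; case: (w \in A); rewrite ?mul1r ?mul0r.
Qed.

End L1.

Section L1_probability.
Context {d : measure_display} {T : measurableType d} {R : realType}.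
Variable P : probability T R.
Implicit Types (f g : T -> R) (a : R).

Lemma L1_cst a : L1 P (fun=> a).
Proof. exact: finite_measure_integrable_cst. Qed.

Lemma L1_bounded f a : measurable_fun setT f -> (forall w, `|f w| <= a) -> L1 P f.
Proof. by move=> mf fa; exact: (L1_dom mf (L1_cst a)). Qed.

Lemma L1_indic A : measurable A -> L1 P \1_A.
Proof.
move=> mA; apply: (@L1_bounded _ 1); first exact: measurable_indic.
by move=> w; rewrite indicE; case: (_ \in _); rewrite ?normr1 ?normr0.
Qed.

Lemma Rintegral_prob_cst a : \int[P]_w a = a.
Proof. have -> : \int[P]_w a = a * fine (P setT) by exact: Rintegral_cst.
by rewrite probability_setT/= mulr1. Qed.

Lemma Rintegral_bounded f a : measurable_fun setT f -> (forall w, `|f w| <= a) ->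
  `|\int[P]_w f w| <= a.
Proof.
by move=> mf fa; have := Rintegral_norm_le mf (L1_cst a) fa; rewrite Rintegral_prob_cst.
Qed.

End L1_probability.

(** * Uniform approximation of bounded functions by simple functions *)

Section UniformSimple.
Context {d : measure_display} {T : measurableType d} {R : realType}.

(** The sum counts the integers in [[1, w]], so it is the integer part of [w]. *)
Let floor_sum (w : R) N : 0 <= w <= N%:R ->
  `|w - \sum_(j < N) ((j.+1%:R : R) <= w)%R%:R| <= 1.
Proof.
elim: N => [|N ih] /andP[w0].
  move=> w1; have -> : w = 0 by apply/eqP; rewrite eq_le w0 w1.
  by rewrite big_ord0 subr0 normr0.
rewrite -natr1 => wN; rewrite big_ord_recr/=.
have [wN'|wN'] := leP w N%:R.
  rewrite (_ : _ <= w = false) ?addr0 ?ih ?w0//.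
  by apply/negbTE; rewrite -ltNge (le_lt_trans wN')// ltr_nat.
rewrite (eq_bigr (fun=> 1)) => [|i _]; last first.
  by rewrite (le_trans _ (ltW wN'))// ler_nat.
rewrite sumr_const card_ord.
by case: (N.+1%:R <= w)%R => /=; rewrite ?mulr1n ?mulr0n ler_norml; lra.
Qed.

(* [M + Z] is approximated by [1/k] times the number of levels [j/k] below it. *)
Lemma uniform_simple_approx (Z : T -> R) (M : R) : measurable_fun setT Z ->
  (forall w, `|Z w| <= M) -> forall e : R, 0 < e ->
  exists (n : nat) (a : nat -> R) (A : nat -> set T), (forall j, measurable (A j)) /\
    forall w, `|Z w - \sum_(j < n) a j * \1_(A j) w| <= e.
Proof.
move=> mZ ZM e e0.
pose k := (Num.truncn (e^-1)).+1; have k0 : 0 < k%:R :> R by rewrite ltr0n.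
have ke : k%:R^-1 <= e.
  rewrite -[leRHS]invrK lef_pV2 ?posrE ?invr_gt0//.
  by rewrite ltW// truncnS_gt.
(* [N] levels suffice because [0 <= M + Z <= 2 M]. Index 0 of [A] and [a] carries the constant
   [- M], the later indices carry the levels. *)
pose N := (Num.truncn (k%:R * (M + M))).+1.
pose A j := if j is j'.+1 then [set w | j'.+1%:R <= k%:R * (M + Z w)] else setT.
pose a j := if j is j'.+1 then k%:R^-1 else - M.
exists N.+1, a, A; split=> [[|j]|w].
- exact: measurableT.
- rewrite /A -[X in measurable X]setTI.
  apply: (measurable_fun_le (f := cst _)) => //.
  by apply: measurable_funM => //; exact: measurable_funD.
rewrite big_ord_recl/= indicT mulr1.
have /floor_sum : 0 <= k%:R * (M + Z w) <= N%:R.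
  have := ZM w; rewrite ler_norml => /andP[z1 z2]; apply/andP; split.
    by apply: mulr_ge0; [exact: ltW|lra].
  rewrite ltW// (le_lt_trans _ (truncnS_gt _))// ler_pM2l//; lra.
move=> H; rewrite -(ler_pM2l k0); apply: le_trans (_ : 1 <= _); last first.
  by rewrite mulrC -ler_pdivrMr// mul1r.
rewrite -{1}(ger0_norm (ltW k0)) -normrM (le_trans _ H)// le_eqVlt.
apply/orP; left; apply/eqP; congr `| _ |.
rewrite mulrBr mulrDr mulrDr mulrN; rewrite big_distrr/=.
rewrite [in RHS](eq_bigr (fun i : 'I_N => k%:R * (k%:R^-1 * \1_(A i.+1) w))).
  by ring.
move=> i _; rewrite mulrA mulfV ?gt_eqF// mul1r indicE; congr (_ %:R).
congr nat_of_bool; by apply/idP/idP => h; [rewrite mem_set//= mulrDr|move: h; rewrite inE/= mulrDr].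
Qed.

End UniformSimple.

(** * Integration against a mixture of probability measures *)

Section Mixture.
Context {d d' : measure_display} {T : measurableType d} {S : measurableType d'}
  {R : realType}.
Variables (P : probability T R) (k : {mfun T >-> pprobability S R}) (Q : probability S R).
Hypothesis mixture : forall A, measurable A -> (Q A = \int[P]_w k w A)%E.

Import HBNNSimple.

Lemma measurable_ker_ev A : measurable A -> measurable_fun setT (fun w => k w A).
Proof. move=> mA; exact: (measurable_kernel (kprobability (measurable_funPT k)) A mA). Qed.

Lemma measurable_ker_integral (h : S -> \bar R) : measurable_fun setT h ->
  (forall x, 0 <= h x)%E -> measurable_fun setT (fun w => \int[k w]_x h x)%E.
Proof.
move=> mh h0; apply: (measurable_fun_integral_kernel (l := fun w => (k w : {measure set S -> \bar R}))) => //.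
exact: measurable_ker_ev.
Qed.

Lemma ge0_integral_mixture (h : S -> \bar R) : measurable_fun setT h ->
  (forall x, 0 <= h x)%E -> (\int[Q]_x h x = \int[P]_w \int[k w]_x h x)%E.
Proof.
move=> mh h0.
pose g := nnsfun_approx measurableT mh.
pose gE := fun n => EFin \o g n.
have mgE n : measurable_fun [set: S] (gE n) by exact/measurable_EFinP.
have gE_ge0 n x : (0 <= gE n x)%E by rewrite lee_fin.
have nd_gE x : {homo gE ^~ x : n m / (n <= m)%O >-> (n <= m)%E}.
  by move=> *; exact/lefP/nd_nnsfun_approx.
have simple n : (\int[Q]_x gE n x = \int[P]_w \int[k w]_x gE n x)%E.
  rewrite integralT_nnsfun.
  under [RHS]eq_integral do rewrite integralT_nnsfun sintegralE.
  rewrite ge0_integral_fsum//; last 2 first.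
    by move=> r; apply: measurable_funeM; exact: measurable_ker_ev.
    by move=> r x _; exact: nnsfun_mulemu_ge0.
  rewrite sintegralE; apply: eq_fsbigr => // r rh.
  have mr : measurable (g n @^-1` [set r]) by exact: measurable_sfunP.
  have -> := congr1 (fun z => r%:E * z)%E (mixture mr : _ = _).
  rewrite integralZl//.
  have := finite_measure_integrable_cst P 1 measurableT.
  apply: le_integrable => //; first exact: measurable_ker_ev.
  by move=> w _ /=; rewrite normr1 gee0_abs//; exact: probability_le1.
transitivity (limn (fun n => \int[Q]_x gE n x)%E).
  rewrite -monotone_convergence//; apply: eq_integral => t _.
  by apply/esym/cvg_lim => //; exact: cvg_nnsfun_approx.
transitivity (limn (fun n => \int[P]_w \int[k w]_x gE n x)%E).
  by apply: congr_lim; apply/funext.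
rewrite -[LHS]monotone_convergence//; last 3 first.
  by move=> n; exact: measurable_ker_integral.
  by move=> n x _; exact: integral_ge0.
  by move=> x _ m n mn; apply: ge0_le_integral => // t _; exact: nd_gE.
apply: eq_integral => mu _.
rewrite -monotone_convergence//.
apply: eq_integral => t _.
by apply/cvg_lim => //; exact: cvg_nnsfun_approx.
Qed.

(** An infinite integral becomes 0 under [fine]. Linearity in [f] thus needs [f] to be integrable
    under [k w], which holds for almost every [w] when [f] is integrable under the mixture [Q];
    hence the almost everywhere statements below. *)
Definition kerint (f : S -> R) (w : T) : R := \int[k w]_x f x.

Lemma measurable_kerint f : measurable_fun setT f -> measurable_fun setT (kerint f).
Proof.
move=> mf; apply: (measurableT_comp (f := fine)); first exact: fine_measurable.
have mE : measurable_fun setT (EFin \o f) by exact/measurable_EFinP.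
rewrite (_ : (fun w => _) = (fun w => \int[k w]_x (EFin \o f)^\+ x - \int[k w]_x (EFin \o f)^\- x)%E); last first.
  by apply/funext => w; rewrite integralE.
apply: emeasurable_funB; apply: measurable_ker_integral => //.
- exact: measurable_funepos.
- exact: measurable_funeneg.
Qed.

Let integrable_ker (h : S -> \bar R) : measurable_fun setT h -> (forall x, 0 <= h x)%E ->
  (\int[Q]_x h x < +oo)%E -> P.-integrable setT (fun w => \int[k w]_x h x)%E.
Proof.
move=> mh h0 hoo; apply/integrableP; split; first exact: measurable_ker_integral.
under eq_integral do rewrite gee0_abs ?integral_ge0//.
by rewrite -ge0_integral_mixture.
Qed.

Lemma ae_ker_L1 f : L1 Q f -> {ae P, forall w, L1 (k w) f}.
Proof.
move=> Lf; have mf := L1_measurable Lf.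
have mE : measurable_fun setT (EFin \o f) by exact/measurable_EFinP.
have mA : measurable_fun setT (abse \o (EFin \o f)).
  by apply: measurableT_comp => //; exact: abse_measurable.
have I := @integrable_ker (abse \o (EFin \o f)) mA (fun=> abse_ge0 _).
have /integrableP[_ foo] := Lf.
apply: filterS (integrable_ae measurableT (I foo)) => w /(_ Logic.I) fin.
by apply/integrableP; split => //; rewrite ltey_eq fin.
Qed.

Lemma L1_kerint f : L1 Q f -> L1 P (kerint f).
Proof.
move=> Lf; have mf := L1_measurable Lf.
have mE : measurable_fun setT (EFin \o f) by exact/measurable_EFinP.
have mA : measurable_fun setT (abse \o (EFin \o f)).
  by apply: measurableT_comp => //; exact: abse_measurable.
have I := @integrable_ker (abse \o (EFin \o f)) mA (fun=> abse_ge0 _).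
have /integrableP[_ foo] := Lf.
apply: (@le_integrable _ _ _ P setT measurableT _ _ _ _ (I foo)).
  by apply/measurable_EFinP; exact: measurable_kerint.
move=> w _ /=; rewrite (@gee0_abs _ (\int[k w]_x _)%E) ?integral_ge0//.
apply: le_trans (le_abse_integral _ measurableT mE).
by rewrite /kerint /Rintegral; case: (\int[k w]_x _)%E => [r||]//=; rewrite normr0 leey.
Qed.

Lemma Rintegral_kerint f : L1 Q f -> \int[P]_w kerint f w = \int[Q]_x f x.
Proof.
move=> Lf; have mf := L1_measurable Lf.
have mE : measurable_fun setT (EFin \o f) by exact/measurable_EFinP.
have fp := integral_funepos_lt_pinfty measurableT Lf; have fn := integral_funeneg_lt_pinfty measurableT Lf.
have Ip := integrable_ker (measurable_funepos mE) (fun=> funepos_ge0 _ _) fp.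
have In := integrable_ker (measurable_funeneg mE) (fun=> funeneg_ge0 _ _) fn.
congr fine; transitivity (\int[P]_w (\int[k w]_x (EFin \o f)^\+ x - \int[k w]_x (EFin \o f)^\- x))%E.
  apply: ae_eq_integral => //.
  - by apply/measurable_EFinP; exact: measurable_kerint.
  - exact: measurable_int (integrableB measurableT Ip In).
  apply: filterS2 (integrable_ae measurableT Ip) (integrable_ae measurableT In) => w hp hn _.
  rewrite /kerint /Rintegral integralE fineK// fin_numB.
  by rewrite (hp Logic.I) (hn Logic.I).
rewrite integralB// -!ge0_integral_mixture//.
- by rewrite integralE.
- exact: measurable_funeneg.
- exact: measurable_funepos.
Qed.

Lemma kerintB_ae f g : L1 Q f -> L1 Q g ->
  {ae P, forall w, kerint (fun x => f x - g x) w = kerint f w - kerint g w}.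
Proof.
move=> Lf Lg; apply: filterS2 (ae_ker_L1 Lf) (ae_ker_L1 Lg) => w kf kg.
by rewrite /kerint RintegralB.
Qed.

Lemma kerintD_ae f g : L1 Q f -> L1 Q g ->
  {ae P, forall w, kerint (fun x => f x + g x) w = kerint f w + kerint g w}.
Proof.
move=> Lf Lg; apply: filterS2 (ae_ker_L1 Lf) (ae_ker_L1 Lg) => w kf kg.
by rewrite /kerint RintegralD.
Qed.

Lemma kerintZ_ae a f : L1 Q f ->
  {ae P, forall w, kerint (fun x => a * f x) w = a * kerint f w}.
Proof.
by move=> Lf; apply: filterS (ae_ker_L1 Lf) => w kf; rewrite /kerint RintegralZl.
Qed.

(** This contraction makes properties of [kerint] stable under [L^1] limits, as the induction on
    integrable functions requires. *)
Lemma kerint_dist_le f g : L1 Q f -> L1 Q g ->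
  \int[P]_w `|kerint f w - kerint g w| <= \int[Q]_x `|f x - g x|.
Proof.
move=> Lf Lg; have Lfg := L1B Lf Lg.
rewrite -(Rintegral_kerint (L1_norm Lfg)).
have Lk := L1_norm (L1B (L1_kerint Lf) (L1_kerint Lg)).
have Lk' := L1_norm (L1_kerint Lfg).
rewrite -(Rintegral_ae_eq Lk' Lk); last first.
  by apply: filterS (kerintB_ae Lf Lg) => w ->.
have aeL := ae_ker_L1 Lfg.
(* The triangle inequality for the inner integral holds only almost everywhere. The minimum equals
   its left side almost everywhere and lies below its right side everywhere. *)
pose m w := Num.min `|kerint (fun x => f x - g x) w| (kerint (fun x => `|f x - g x|) w).
have Lm : L1 P m.
  apply: (@L1_dom _ _ _ _ m _ _ Lk').
    by apply: measurable_minr; [exact: L1_measurable Lk'|exact: L1_measurable (L1_kerint (L1_norm Lfg))].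
  move=> w; rewrite ger0_norm ?ge_min ?lexx// le_min normr_ge0/=.
  exact: Rintegral_ge0.
rewrite (Rintegral_ae_eq Lk' Lm); last first.
  apply: filterS aeL => w kL; rewrite /m min_l//.
  exact: le_normr_Rintegral.
apply: le_Rintegral => //; first exact: L1_kerint (L1_norm Lfg).
by move=> w _; rewrite /m ge_min lexx orbT.
Qed.

Lemma kerint_indic A w : measurable A -> kerint \1_A w = fine (k w A).
Proof. by move=> mA; rewrite /kerint Rintegral_indic. Qed.

End Mixture.

(** * From indicators to integrable functions *)

Section L1Induction.
Context {d : measure_display} {S : measurableType d} {R : realType}.
Variables (Q : probability S R) (Phi : (S -> R) -> Prop).
Hypothesis Phi_indic : forall A, measurable A -> Phi \1_A.
Hypothesis PhiD : forall f g, L1 Q f -> L1 Q g -> Phi f -> Phi g -> Phi (fun x => f x + g x).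
Hypothesis PhiZ : forall a f, L1 Q f -> Phi f -> Phi (fun x => a * f x).
Hypothesis Phi_closed : forall f, L1 Q f ->
  (forall e : R, 0 < e -> exists g, [/\ L1 Q g, Phi g & \int[Q]_x `|f x - g x| <= e]) -> Phi f.

(** Sums and multiples lead from indicators to simple functions, these approximate bounded functions
    uniformly, and truncation at level [n] approximates an integrable function in [L^1].
    [Phi_closed] asks for one approximation per [e], so each of the last two errors is given
    [e / 2]. *)
Lemma L1_indic_ind f : L1 Q f -> Phi f.
Proof.
have simple (n : nat) (a : nat -> R) (A : nat -> set S) : (forall j, measurable (A j)) ->
  L1 Q (fun x => \sum_(j < n) a j * \1_(A j) x) /\ Phi (fun x => \sum_(j < n) a j * \1_(A j) x).
  move=> mA; elim: n => [|n [Ln Pn]].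
    have -> : (fun x => \sum_(j < 0) a j * \1_(A j) x) = (fun x => 0 * \1_(@setT S) x).
      by apply/funext => x; rewrite big_ord0 mul0r.
    split; first by apply: L1Z; exact: L1_indic.
    by apply: PhiZ; [exact: L1_indic|exact: Phi_indic].
  under eq_fun do rewrite big_ord_recr/=.
  have Ll := L1_indic Q (mA n).
  split; first by apply: L1D => //; exact: L1Z.
  by apply: PhiD => //; [exact: L1Z|apply: PhiZ => //; exact: Phi_indic].
move=> Lf; have mf := L1_measurable Lf; apply: Phi_closed => // e e0.
pose tr (n : nat) x := f x * \1_[set x | `|f x| <= n%:R] x.
have mtr n : measurable_fun setT (tr n).
  apply: measurable_funM => //; apply: measurable_indic.
  rewrite -[X in measurable X]setTI; apply: measurable_fun_le => //.
  exact: measurableT_comp.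
have trb n x : `|tr n x| <= n%:R.
  rewrite /tr indicE; case: (boolP (x \in _)) => [|_]; last by rewrite mulr0 normr0.
  by rewrite inE/= mulr1.
have cv : \int[Q]_x `|f x - tr n x| @[n --> \oo] --> \int[Q]_x (0 : R).
  apply: (@cvg_Rintegral_dom _ _ _ _ _ _ (fun x => `|f x|)) => //.
  - by move=> n; apply: measurableT_comp => //; exact: measurable_funB.
  - exact: L1_norm.
  - move=> n x; rewrite normr_id /tr indicE.
    by case: (x \in _); rewrite ?mulr1 ?mulr0 ?subrr ?normr0 ?subr0.
  - apply: aeW => x; apply: cvg_near_cst; near=> n.
    rewrite /tr indicE mem_set ?mulr1 ?subrr ?normr0//=.
    by near: n; exact: nbhs_infty_ger.
rewrite Rintegral_prob_cst in cv.
move/cvgrPdist_le : cv => /(_ (e / 2)); rewrite divr_gt0// => /(_ isT) [n _ /(_ n (leqnn _))].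
rewrite /= sub0r normrN ger0_norm ?Rintegral_ge0// => ne.
have e2 : 0 < e / 2 by rewrite divr_gt0.
have [N [a [A [mA H]]]] := uniform_simple_approx (mtr n) (trb n) e2.
have [Ls Ps] := simple N a A mA.
have Lt := L1_bounded Q (mtr n) (trb n).
eexists; split; [exact: Ls|exact: Ps|].
apply: (@le_trans _ _ (\int[Q]_x (`|f x - tr n x| + e / 2))).
  apply: le_Rintegral => //.
  - by apply: L1_norm; exact: L1B.
  - by apply: L1D; [apply: L1_norm; exact: L1B|exact: L1_cst].
  - move=> x _; apply: le_trans (lerD (lexx _) (H x)).
    by rewrite (le_trans _ (ler_normD _ _))// addrA subrK.
rewrite RintegralD//; last 2 first.
- by apply: L1_norm; exact: L1B.
- exact: L1_cst.
by rewrite Rintegral_prob_cst [leRHS](splitr e) lerD2r.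
Unshelve. all: by end_near. Qed.

End L1Induction.

(** * The stable martingale central limit theorem *)

Section MartingaleCLT.
Context {d : measure_display} {T : measurableType d} {R : realType}.
Variables (P : probability T R) (F : nat -> set (set T)).
Hypothesis F_measurable : forall n, F n `<=` measurable.
Hypothesis F_mono : forall n m, (n <= m)%N -> F n `<=` F m.

Definition adapted n (f : T -> R) := measurable_fun [set: g_sigma_algebraType (F n)] f.

Definition adapted_bounded n f := adapted n f /\ exists M : R, forall w, `|f w| <= M.

Lemma adapted_measurable n f : adapted n f -> measurable_fun setT f.
Proof.
move=> mf _ A mA; have := mf measurableT A mA; rewrite !setTI.
apply: smallest_sub; last exact: F_measurable.
exact: sigma_algebra_measurable.
Qed.

Lemma adapted_mono n m f : (n <= m)%N -> adapted n f -> adapted m f.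
Proof.
move=> nm mf _ A mA; have := mf measurableT A mA; rewrite !setTI.
apply: smallest_sub; first exact: smallest_sigma_algebra.
by move=> B FB; apply: sub_sigma_algebra; exact: F_mono FB.
Qed.

(** Conditional means and variances enter only through integrals against bounded adapted [Z], so
    that no conditional expectation has to be constructed. [xi_rem] is the consequence of identical
    distribution that Lindeberg's condition needs. *)
Variables (xi v : nat -> T -> R) (vlim : T -> R).
Hypothesis xi_adapted : forall n, adapted n.+1 (xi n).
Hypothesis v_adapted : forall n, adapted n (v n).
Hypothesis v_ge0 : forall n w, 0 <= v n w.
Hypothesis v_L1 : forall n, L1 P (v n).
Hypothesis vlim_ge0 : forall w, 0 <= vlim w.
Hypothesis vlim_L1 : L1 P vlim.
Hypothesis xi_L2 : forall n, L1 P (fun w => xi n w ^+ 2).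
Hypothesis xi_mean : forall n Z, adapted_bounded n Z -> \int[P]_w (Z w * xi n w) = 0.
Hypothesis xi_var : forall n Z, adapted_bounded n Z ->
  \int[P]_w (Z w * xi n w ^+ 2) = \int[P]_w (Z w * v n w).
Hypothesis xi_rem : forall j n : nat,
  \int[P]_w cubic_rem (xi j w / Num.sqrt n%:R) =
  \int[P]_w cubic_rem (xi 0 w / Num.sqrt n%:R).
Hypothesis v_cvg : \int[P]_w `|v n w - vlim w| @[n --> \oo] --> 0.

Definition psum n w : R := \sum_(i < n) xi i w.

Lemma psum_adapted n m : (n <= m)%N -> adapted m (psum n).
Proof.
elim: n => [|n ih] nm.
  by rewrite /psum /adapted; under eq_fun do rewrite big_ord0; exact: measurable_cst.
rewrite /psum /adapted; under eq_fun do rewrite big_ord_recr/=.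
apply: measurable_funD; first exact: ih (ltnW nm).
exact: adapted_mono (@xi_adapted n).
Qed.

Let mxi n : measurable_fun setT (xi n) := adapted_measurable (@xi_adapted n).

Let xi_L1 n : L1 P (xi n).
Proof.
apply: (@L1_dom _ _ _ _ _ (fun w => 1 + xi n w ^+ 2) (mxi n)).
  by apply: L1D; [exact: L1_cst|exact: xi_L2].
by move=> w; rewrite -(real_normK (num_real (xi n w))); nra.
Qed.

Let mcubic (a : R) n : measurable_fun setT (fun w => cubic_rem (xi n w / a)).
Proof.
have m1 : measurable_fun setT (fun w => xi n w / a).
  by apply: measurable_funM => //; exact: mxi.
apply: measurable_minr; apply: measurable_funX => //.
exact: measurableT_comp.
Qed.

(** Lindeberg's condition under a second moment alone: [xi 0 w ^+ 2] dominates. *)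
Lemma xi_rem_cvg0 : n%:R * \int[P]_w cubic_rem (xi 0 w / Num.sqrt n%:R) @[n --> \oo] --> 0.
Proof.
have Lc n : L1 P (fun w => cubic_rem (xi 0 w / Num.sqrt n%:R)).
  apply: (@L1_dom _ _ _ _ _ (fun w => (Num.sqrt n%:R)^-1 ^+ 2 * xi 0 w ^+ 2)) => //.
    by apply: L1Z; exact: xi_L2.
  move=> w; rewrite ger0_norm ?cubic_rem_ge0// ge_min; apply/orP; left.
  by rewrite exprMn mulrC.
rewrite (_ : (fun n => _) = fun n => \int[P]_w (n%:R * cubic_rem (xi 0 w / Num.sqrt n%:R))); last first.
  by apply/funext => n; rewrite RintegralZl//; exact: Lc.
have -> : 0 = \int[P]_w (0 : R) by rewrite Rintegral_prob_cst.
apply: (@cvg_Rintegral_dom _ _ _ _ _ _ (fun w => xi 0 w ^+ 2)) => //.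
- by move=> n; apply: measurable_funM => //.
- by move=> n w; rewrite ger0_norm ?mulr_ge0 ?cubic_rem_ge0//; exact: cubic_rem_scale_le.
- by apply: aeW => w; exact: cubic_rem_scale_cvg0.
Qed.

Let mquad (a : R) n : measurable_fun setT (fun w => quad_rem (v n w / a)).
Proof.
have m1 : measurable_fun setT (fun w => v n w / a).
  by apply: measurable_funM => //; exact: adapted_measurable (@v_adapted n).
by apply: measurable_minr => //; exact: measurable_funX.
Qed.

Let Lquad (n m : nat) : L1 P (fun w => quad_rem (v m w / (2 * n%:R))).
Proof.
apply: (@L1_dom _ _ _ _ _ (fun w => (2 * n%:R)^-1 * v m w)) => //.
  exact: L1Z.
move=> w; rewrite ger0_norm ?quad_rem_ge0 ?divr_ge0 ?mulr_ge0//.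
by rewrite ge_min mulrC lexx.
Qed.

Lemma v_rem_cvg0 m : n%:R * \int[P]_w quad_rem (v m w / (2 * n%:R)) @[n --> \oo] --> 0.
Proof.
rewrite (_ : (fun n => _) = fun n => \int[P]_w (n%:R * quad_rem (v m w / (2 * n%:R)))); last first.
  by apply/funext => n; rewrite RintegralZl//; exact: Lquad.
have -> : 0 = \int[P]_w (0 : R) by rewrite Rintegral_prob_cst.
apply: (@cvg_Rintegral_dom _ _ _ _ _ _ (v m)) => //.
- by move=> n; apply: measurable_funM => //.
- move=> n w; rewrite ger0_norm ?mulr_ge0 ?quad_rem_ge0 ?divr_ge0 ?mulr_ge0//.
  exact: quad_rem_scale_le.
- by apply: aeW => w; exact: quad_rem_scale_cvg0.
Qed.

Section Telescope.
Variables (c C : R) (m : nat) (Z : T -> R).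
Hypothesis Z_adapted : adapted m Z.
Hypothesis ZC : forall w, `|Z w| <= C.

Let C0 : 0 <= C. Proof. exact: le_trans (normr_ge0 _) (ZC point). Qed.

(* At [j = n] this is the quantity of interest; the exponential stands for the [n - j] summands
   that are still missing, with conditional variances replaced by [v m]. *)
Definition interp n j w : R :=
  Z w * cos (psum j w / Num.sqrt n%:R + c) * expR (- ((1 - j%:R / n%:R) * v m w / 2)).

Lemma interp_adapted n j : (m <= j)%N -> adapted j (interp n j).
Proof.
move=> mj; apply: measurable_funM; [apply: measurable_funM|].
- exact: adapted_mono Z_adapted.
- apply: measurableT_comp; first exact: (continuous_measurable_fun (@continuous_cos R)).
  apply: measurable_funD => //; apply: measurable_funM => //; exact: psum_adapted.
- apply: measurableT_comp => //; apply: measurableT_comp => //.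
  apply: measurable_funM => //; apply: measurable_funM => //.
  exact: adapted_mono (@v_adapted m).
Qed.

Lemma interp_bound n j w : (j <= n)%N -> `|interp n j w| <= C.
Proof.
move=> jn; rewrite !normrM (ger0_norm (expR_ge0 _)).
have e1 : expR (- ((1 - j%:R / n%:R) * v m w / 2)) <= 1.
  rewrite -[leRHS]expR0 ler_expR oppr_le0 divr_ge0// mulr_ge0//.
  case: n jn => [|n] jn; first by rewrite invr0 mulr0 subr0.
  by rewrite subr_ge0 ler_pdivrMr ?ltr0n// mul1r ler_nat.
rewrite -[leRHS]mulr1 ler_pM ?mulr_ge0 ?expR_ge0//.
by rewrite -[leRHS]mulr1 ler_pM ?cos_max.
Qed.

(** With the common factor [ZD], known at time [j], the two integrands are [cos (a + h)] and
    [cos a * expR (- y)], where [h = xi j / sqrt n] and [y = v m / (2 n)]. Expand to second order in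
    [h] and first order in [y]: the term linear in [h] integrates to 0, and [h^2 / 2] may be
    replaced by [v j / (2 n)], which cancels [y] up to a multiple of [v j - v m]. *)
Lemma interp_step n j : (m <= j < n)%N ->
  `|\int[P]_w interp n j.+1 w - \int[P]_w interp n j w| <=
  C * ((2 * n%:R)^-1 * \int[P]_w `|v j w - v m w| +
       2 * \int[P]_w cubic_rem (xi j w / Num.sqrt n%:R) +
       \int[P]_w quad_rem (v m w / (2 * n%:R))).
Proof.
move=> /andP[mj jn].
have n0 : 0 < n%:R :> R by rewrite ltr0n; exact: leq_ltn_trans jn.
pose s : R := Num.sqrt n%:R; have s0 : 0 < s by rewrite sqrtr_gt0.
have ss : s ^+ 2 = n%:R by rewrite sqr_sqrtr// ltW.
pose a w := psum j w / s + c.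
pose y w := v m w / (2 * n%:R).
have y0 w : 0 <= y w by rewrite divr_ge0// mulr_ge0// ltW.
pose D w := expR (- ((1 - j.+1%:R / n%:R) * v m w / 2)).
pose ZD w := Z w * D w.
have aD : adapted j D.
  apply: measurableT_comp => //; apply: measurableT_comp => //.
  apply: measurable_funM => //; apply: measurable_funM => //.
  exact: adapted_mono (@v_adapted m).
have aa : adapted j a.
  by apply: measurable_funD => //; apply: measurable_funM => //; exact: psum_adapted.
have D1 w : `|D w| <= 1.
  rewrite (ger0_norm (expR_ge0 _)) -[leRHS]expR0 ler_expR oppr_le0 divr_ge0// mulr_ge0//.
  by rewrite subr_ge0 ler_pdivrMr// mul1r ler_nat.
have ZDC w : `|ZD w| <= C by rewrite normrM -[leRHS]mulr1 ler_pM.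
have aZD : adapted j ZD.
  by apply: measurable_funM => //; exact: adapted_mono Z_adapted.
pose Zc w := ZD w * cos (a w); pose Zs w := ZD w * sin (a w).
have ZcC w : `|Zc w| <= C by rewrite normrM -[leRHS]mulr1 ler_pM ?cos_max.
have ZsC w : `|Zs w| <= C by rewrite normrM -[leRHS]mulr1 ler_pM ?sin_max.
have aZc : adapted j Zc.
  by apply: measurable_funM => //; apply: measurableT_comp => //; exact: (continuous_measurable_fun (@continuous_cos R)).
have aZs : adapted j Zs.
  by apply: measurable_funM => //; apply: measurableT_comp => //; exact: (continuous_measurable_fun (@continuous_sin R)).
have mZc := adapted_measurable aZc; have mZs := adapted_measurable aZs.
have Lj : L1 P (interp n j).
  apply: (@L1_bounded _ _ _ _ _ C); first exact: adapted_measurable (interp_adapted n mj).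
  by move=> w; rewrite interp_bound// ltnW.
have Lj1 : L1 P (interp n j.+1).
  apply: (@L1_bounded _ _ _ _ _ C).
    by apply: adapted_measurable (interp_adapted n _); rewrite (leq_trans mj).
  by move=> w; rewrite interp_bound.
have L1x : L1 P (fun w => s^-1 * (Zs w * xi j w)).
  by apply: L1Z; exact: (L1_mulb mZs ZsC).
have L2x : L1 P (fun w => (2 * n%:R)^-1 * (Zc w * xi j w ^+ 2 - Zc w * v j w)).
  by apply: L1Z; apply: L1B; exact: (L1_mulb mZc ZcC).
(* Both added terms have integral 0, by [xi_mean] and [xi_var]. They remove the first and second
   order of the expansion, and what is left is bounded pointwise. *)
pose rest w := interp n j.+1 w - interp n j w + s^-1 * (Zs w * xi j w) +
  (2 * n%:R)^-1 * (Zc w * xi j w ^+ 2 - Zc w * v j w).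
have -> : \int[P]_w interp n j.+1 w - \int[P]_w interp n j w = \int[P]_w rest w.
  rewrite RintegralD//; last by apply: L1D => //; exact: L1B.
  rewrite RintegralD//; last exact: L1B.
  rewrite RintegralB// RintegralZl//; last exact: (L1_mulb mZs ZsC).
  rewrite xi_mean ?mulr0 ?addr0; last by split => //; exists C.
  rewrite RintegralZl; last 2 first.
  - exact: measurableT.
  - by apply: L1B; exact: (L1_mulb mZc ZcC).
  rewrite RintegralB; last 3 first.
  - exact: measurableT.
  - exact: (L1_mulb mZc ZcC).
  - exact: (L1_mulb mZc ZcC).
  by rewrite xi_var ?subrr ?mulr0 ?addr0//; split => //; exists C.
pose bd w := C * ((2 * n%:R)^-1 * `|v j w - v m w| +
  2 * cubic_rem (xi j w / s) + quad_rem (y w)).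
have Lcub : L1 P (fun w => cubic_rem (xi j w / s)).
  apply: (@L1_dom _ _ _ _ _ (fun w => s^-1 ^+ 2 * xi j w ^+ 2)) => //.
    by apply: L1Z; exact: xi_L2.
  move=> w; rewrite ger0_norm ?cubic_rem_ge0// ge_min; apply/orP; left.
  by rewrite exprMn mulrC.
have Lv : L1 P (fun w => `|v j w - v m w|) by apply: L1_norm; exact: L1B.
have La : L1 P (fun w => (2 * n%:R)^-1 * `|v j w - v m w|) by exact: L1Z.
have Lb : L1 P (fun w => 2 * cubic_rem (xi j w / s)) by exact: L1Z.
have Lc : L1 P (fun w => quad_rem (y w)) by exact: Lquad.
have Lbd : L1 P bd by apply: L1Z; apply: L1D => //; exact: L1D.
have -> : C * ((2 * n%:R)^-1 * \int[P]_w `|v j w - v m w| +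
    2 * \int[P]_w cubic_rem (xi j w / s) + \int[P]_w quad_rem (y w)) = \int[P]_w bd w.
  rewrite RintegralZl//; last by apply: L1D => //; exact: L1D.
  rewrite RintegralD//; last exact: L1D.
  by rewrite RintegralD// !RintegralZl.
apply: Rintegral_norm_le => //.
  exact: (L1_measurable (L1D (L1D (L1B Lj1 Lj) L1x) L2x)).
move=> w.
pose h := xi j w / s.
have i1 : interp n j.+1 w = ZD w * cos (a w + h).
  rewrite /interp /ZD /D /a /h mulrAC; congr (_ * _ * cos _).
  by rewrite /psum big_ord_recr/= -/s; ring.
(* Going from [j] to [j.+1] removes exactly the factor [expR (- y w)] from the exponential. *)
have i0 : interp n j w = ZD w * (cos (a w) * expR (- y w)).
  rewrite /interp /ZD /D mulrAC -!mulrA; congr (_ * _).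
  rewrite mulrCA [RHS]mulrC -mulrA mulrC; congr (_ * _); rewrite -/(a w).
  rewrite -expRD; congr expR; rewrite /y -natr1; field; exact: lt0r_neq0.
have E : rest w = ZD w * ((cos (a w + h) - (cos (a w) - h * sin (a w) - h ^+ 2 / 2 * cos (a w)))
  - cos (a w) * (expR (- y w) - (1 - y w)) - cos (a w) * ((2 * n%:R)^-1 * (v j w - v m w))).
  rewrite /rest i1 i0 /Zs /Zc /h /y -ss; field; exact: lt0r_neq0.
rewrite E normrM /bd ler_pM//.
have b1 := cos_taylor (a w) h.
have b2 : `|cos (a w) * (expR (- y w) - (1 - y w))| <= quad_rem (y w).
  by rewrite normrM -[leRHS]mul1r ler_pM ?cos_max ?expRN_taylor.
have b3 : `|cos (a w) * ((2 * n%:R)^-1 * (v j w - v m w))| <= (2 * n%:R)^-1 * `|v j w - v m w|.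
  rewrite normrM -[leRHS]mul1r ler_pM ?cos_max// normrM (@ger0_norm _ (_^-1))//.
apply: le_trans (ler_normB _ _) _.
apply: le_trans (lerD (le_trans (ler_normB _ _) (lerD b1 b2)) b3) _.
by rewrite addrC addrA.
Qed.

(** There are at most [n] steps; the factor [1 / (2 n)] in [interp_step] turns [n] times [e] into
    [e / 2], and [xi_rem] makes the Taylor term the same in all steps. *)
Lemma interp_telescope e n : (m <= n)%N -> (0 < n)%N ->
  (forall j, (m <= j)%N -> \int[P]_w `|v j w - v m w| <= e) ->
  `|\int[P]_w interp n n w - \int[P]_w interp n m w| <=
  C * (e / 2 + 2 * (n%:R * \int[P]_w cubic_rem (xi 0 w / Num.sqrt n%:R)) +
       n%:R * \int[P]_w quad_rem (v m w / (2 * n%:R))).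
Proof.
move=> mn n0 ve.
have e0 : 0 <= e by apply: le_trans (ve m (leqnn _)); exact: Rintegral_ge0.
have nR : 0 < n%:R :> R by rewrite ltr0n.
rewrite -(telescope_sumr (fun j => \int[P]_w interp n j w) mn).
apply: le_trans (ler_norm_sum _ _ _) _.
pose b := C * ((2 * n%:R)^-1 * e + 2 * \int[P]_w cubic_rem (xi 0 w / Num.sqrt n%:R) +
       \int[P]_w quad_rem (v m w / (2 * n%:R))).
have b0 : 0 <= b.
  rewrite mulr_ge0// !addr_ge0 ?mulr_ge0 ?invr_ge0 ?mulr_ge0//; last first.
    by apply: Rintegral_ge0 => w _; rewrite quad_rem_ge0// divr_ge0// mulr_ge0.
  by apply: Rintegral_ge0 => w _; exact: cubic_rem_ge0.
apply: (@le_trans _ _ (\sum_(m <= j < n) b)).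
  rewrite !big_seq; apply: ler_sum => j; rewrite mem_index_iota => mjn.
  apply: le_trans (interp_step mjn) _; rewrite ler_wpM2l// xi_rem lerD2r lerD2r.
  rewrite ler_wpM2l ?invr_ge0 ?mulr_ge0// ve//; by case/andP: mjn.
rewrite sumr_const_nat; apply: (@le_trans _ _ (b *+ n)).
  by rewrite ler_wpMn2l// leq_subr.
rewrite -mulr_natl /b le_eqVlt; apply/orP; left; apply/eqP; field; exact: lt0r_neq0.
Qed.

End Telescope.

(** For fixed [m] the sum [psum m] disappears after division by [sqrt n], and [1 - m / n] tends to
    1. *)
Lemma cvg_interp_init (c : R) m (Z : T -> R) (C : R) : adapted m Z -> (forall w, `|Z w| <= C) ->
  \int[P]_w interp c m Z n m w @[n --> \oo] -->
  \int[P]_w (Z w * (cos c * expR (- (v m w / 2)))).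
Proof.
move=> aZ ZC.
(* After the shift [m <= n] always holds, as [interp_bound] requires. *)
rewrite -(cvg_shiftn m).
have mZ := adapted_measurable aZ.
apply: (@cvg_Rintegral_dom _ _ _ _ _ _ (fun=> C)).
- by move=> n; exact: adapted_measurable (@interp_adapted c m Z aZ (n + m) m (leqnn m)).
- apply: measurable_funM => //; apply: measurable_funM => //.
  apply: measurableT_comp => //; apply: measurableT_comp => //.
  by apply: measurable_funM => //; exact: adapted_measurable (@v_adapted m).
- exact: L1_cst.
- by move=> n w; apply: interp_bound => //; rewrite leq_addl.
apply: aeW => w; rewrite (cvg_shiftn m (fun n => interp c m Z n m w)).
rewrite /interp; under eq_cvg do rewrite -mulrA; apply: cvgMr; apply: cvgM.
  apply: (@cvg_comp _ _ _ (fun n : nat => psum m w / Num.sqrt n%:R + c) (@cos R) _ (nbhs c));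
    last exact: continuous_cos.
  have lim1 : psum m w / Num.sqrt n%:R + c @[n --> \oo] --> c.
    rewrite -[X in _ --> X]add0r; apply: cvgD; last exact: cvg_cst.
    by rewrite -[X in _ --> X](mulr0 (psum m w)); apply: cvgMr; exact: sqrtn_inv_cvg0.
  exact: lim1.
apply: (@cvg_comp _ _ _ (fun n : nat => - ((1 - m%:R / n%:R) * v m w / 2)) (@expR R) _
  (nbhs (- (v m w / 2)))); last exact: continuous_expR.
have lim2 : - ((1 - m%:R / n%:R) * v m w / 2) @[n --> \oo] --> - (v m w / 2).
  apply: cvgN; apply: cvgMl; rewrite -[X in _ --> X]mul1r; apply: cvgMl.
  rewrite -[X in _ --> X]subr0; apply: cvgB; first exact: cvg_cst.
  by rewrite -[X in _ --> X](mulr0 m%:R); apply: cvgMr; exact: n_inv_cvg0.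
exact: lim2.
Qed.

Let exp_half_dist (Z : T -> R) (C : R) (f g : T -> R) : measurable_fun setT Z -> (forall w, `|Z w| <= C) ->
  L1 P f -> L1 P g -> (forall w, 0 <= f w) -> (forall w, 0 <= g w) -> forall c : R,
  `|\int[P]_w (Z w * (cos c * expR (- (f w / 2)))) - \int[P]_w (Z w * (cos c * expR (- (g w / 2))))|
  <= C * \int[P]_w `|f w - g w|.
Proof.
move=> mZ ZC Lf Lg f0 g0 c.
have C0 : 0 <= C by exact: le_trans (normr_ge0 _) (ZC point).
have L h : L1 P h -> (forall w, 0 <= h w) ->
    L1 P (fun w => Z w * (cos c * expR (- (h w / 2)))).
  move=> Lh h0; apply: (@L1_bounded _ _ _ _ _ C).
    apply: measurable_funM => //; apply: measurable_funM => //.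
    apply: measurableT_comp => //; apply: measurableT_comp => //.
    by apply: measurable_funM => //; exact: L1_measurable Lh.
  move=> w; rewrite normrM -[leRHS]mulr1 ler_pM// normrM -[leRHS]mulr1 ler_pM ?cos_max//.
  by rewrite (ger0_norm (expR_ge0 _)) -[leRHS]expR0 ler_expR oppr_le0 divr_ge0.
have Ld := L1_norm (L1B Lf Lg).
rewrite -RintegralB//; [|exact: L|exact: L].
rewrite -RintegralZl//; apply: Rintegral_norm_le.
- exact: L1_measurable (L1B (L _ Lf f0) (L _ Lg g0)).
- exact: L1Z.
move=> w; rewrite -!mulrBr normrM ler_pM// normrM -[leRHS]mul1r ler_pM ?cos_max//.
rewrite (le_trans (expRN_lipschitz _ _)) ?divr_ge0//.
rewrite -mulrBl normrM (@ger0_norm _ 2^-1) ?invr_ge0//.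
by have := normr_ge0 (f w - g w); lra.
Qed.

(** The order of the limits matters: [m] is fixed so large that [v m] is close to [vlim] and [Z] is
    known at time [m], and [n] tends to infinity afterwards. *)
Lemma cvg_cos_adapted (c : R) k (Z : T -> R) : adapted_bounded k Z ->
  \int[P]_w (Z w * cos (psum n w / Num.sqrt n%:R + c)) @[n --> \oo] -->
  \int[P]_w (Z w * (cos c * expR (- (vlim w / 2)))).
Proof.
move=> [aZ [C0 ZC0]].
pose C := C0 + 1.
have ZC w : `|Z w| <= C by rewrite (le_trans (ZC0 w))// lerDl.
have C_gt0 : 0 < C by have := le_trans (normr_ge0 _) (ZC0 point); rewrite /C; lra.
apply/cvgrPdist_le => e e0.
(* The errors are [C eta] for [vlim] against [v m], [C eta] for the start of the telescope, and
   [C (eta + 2 (eta / 4) + eta / 2)] for the telescope itself; the fifth [C eta] is slack. The [+ 1]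
   in [C] makes this division legitimate. *)
pose eta := e / (5 * C).
have eta0 : 0 < eta by rewrite divr_gt0// mulr_gt0.
have [m0 _ vm0] : \forall j \near \oo, \int[P]_w `|v j w - vlim w| <= eta.
  move/cvgrPdist_le : v_cvg => /(_ eta eta0); apply: filterS => j.
  by rewrite sub0r normrN; apply: le_trans; exact: ler_norm.
pose m := maxn m0 k.
have vm j : (m <= j)%N -> \int[P]_w `|v j w - vlim w| <= eta.
  by move=> mj; apply: vm0; rewrite /= (leq_trans _ mj)// leq_maxl.
have aZm : adapted m Z by apply: adapted_mono aZ; rewrite leq_maxr.
have vv j : (m <= j)%N -> \int[P]_w `|v j w - v m w| <= eta + eta.
  move=> mj; apply: le_trans (lerD (vm j mj) (vm m (leqnn m))).
  have Ld i : L1 P (fun w => `|v i w - vlim w|) by apply: L1_norm; exact: L1B.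
  rewrite -RintegralD//; [|exact: Ld|exact: Ld].
  apply: le_Rintegral => //.
  - by apply: L1_norm; exact: L1B.
  - by apply: L1D; exact: Ld.
  move=> w _; rewrite (distrC (v m w)) (le_trans _ (ler_normD _ _))//.
  by rewrite addrA subrK.
have init := @cvg_interp_init c m Z C aZm ZC.
near=> n.
have mn : (m <= n)%N by near: n; exact: nbhs_infty_ge.
have n0 : (0 < n)%N by near: n; exact: nbhs_infty_gt.
have tel := interp_telescope c aZm ZC mn n0 vv.
have r1 : n%:R * \int[P]_w cubic_rem (xi 0 w / Num.sqrt n%:R) <= eta / 4.
  apply: le_trans (ler_norm _) _; rewrite -normrN -sub0r.
  near: n; move/cvgrPdist_le : xi_rem_cvg0; apply; exact: divr_gt0.
have r2 : n%:R * \int[P]_w quad_rem (v m w / (2 * n%:R)) <= eta / 2.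
  apply: le_trans (ler_norm _) _; rewrite -normrN -sub0r.
  near: n; move/cvgrPdist_le : (v_rem_cvg0 m); apply; exact: divr_gt0.
have r3 : `|\int[P]_w (Z w * (cos c * expR (- (v m w / 2)))) - \int[P]_w interp c m Z n m w| <= C * eta.
  by near: n; move/cvgrPdist_le : init; apply; exact: mulr_gt0.
have r4 := exp_half_dist (adapted_measurable aZ) ZC vlim_L1 (@v_L1 m) vlim_ge0 (v_ge0 m) c.
have r5 : \int[P]_w interp c m Z n n w = \int[P]_w (Z w * cos (psum n w / Num.sqrt n%:R + c)).
  apply: eq_Rintegral => w _; rewrite /interp divff ?pnatr_eq0 -?lt0n//.
  by rewrite subrr mul0r mul0r oppr0 expR0 mulr1.
rewrite -r5.
have r4' : `|\int[P]_w (Z w * (cos c * expR (- (vlim w / 2)))) -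
    \int[P]_w (Z w * (cos c * expR (- (v m w / 2))))| <= C * eta.
  apply: le_trans r4 _; rewrite ler_pM2l//; apply: le_trans (vm m (leqnn m)).
  by rewrite le_eqVlt; apply/orP; left; apply/eqP; apply: eq_Rintegral => w _; rewrite distrC.
have tel' : `|\int[P]_w interp c m Z n n w - \int[P]_w interp c m Z n m w| <= C * (2 * eta).
  apply: le_trans tel _; rewrite ler_pM2l//; lra.
have eE : e = C * eta + C * eta + C * (2 * eta) + C * eta.
  by rewrite /eta; field; exact: lt0r_neq0.
have Ceta : 0 < C * eta by exact: mulr_gt0.
rewrite eE; move: r3 r4' tel' Ceta.
move: (\int[P]_w interp c m Z n n w) (\int[P]_w interp c m Z n m w) => a1 a2.
move: (\int[P]_w _) (\int[P]_w _) => a3 a4.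
rewrite !ler_norml => /andP[h1 h2] /andP[h3 h4] /andP[h5 h6] h7.
apply/andP; split; lra.
Unshelve. all: by end_near. Qed.

(** A near-minimizer of the [L^2] distance to [U] among bounded adapted functions of all times
    replaces the conditional expectation given the union of the pasts. Its near-orthogonality holds
    for [Y] adapted at any time [l], which matters because the cosines to be tested are adapted at a
    growing time. *)
Lemma adapted_projection (U : T -> R) : measurable_fun setT U -> (forall w, `|U w| <= 1) ->
  forall e : R, 0 < e -> exists k Z, adapted_bounded k Z /\
    forall l Y, adapted_bounded l Y -> (forall w, `|Y w| <= 1) ->
      `|\int[P]_w ((U w - Z w) * Y w)| <= e.
Proof.
move=> mU U1 e e0.
pose A := [set r : R | exists k Z, adapted_bounded k Z /\ r = \int[P]_w (U w - Z w) ^+ 2].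
have A0 r : A r -> 0 <= r.
  by move=> [k [Z [_ ->]]]; apply: Rintegral_ge0 => w _; exact: sqr_ge0.
have hA : has_inf A.
  split; last by exists 0 => r; exact: A0.
  exists (\int[P]_w (U w - 0) ^+ 2), 0, (fun=> 0); split => //.
  by split; [exact: measurable_cst|exists 0 => w; rewrite normr0].
(* The tolerance is [e ^+ 2] because [key] at [s = e] and at [s = - e] bounds [2 e] times the
   absolute value of the integral by [2 e ^+ 2]. *)
have [_ [k [Z [BZ ->]]] Zinf] := inf_adherent (exprn_gt0 2 e0) hA.
exists k, Z; split=> // l Y BY Y1.
have [mZ [C ZC]] : measurable_fun setT Z /\ exists M : R, forall w, `|Z w| <= M.
  by case: BZ => aZ bZ; split => //; exact: adapted_measurable aZ.
have mY : measurable_fun setT Y by case: BY => aY _; exact: adapted_measurable aY.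
have mD : measurable_fun setT (fun w => U w - Z w) by exact: measurable_funB.
have DC w : `|U w - Z w| <= 1 + C by rewrite (le_trans (ler_normB _ _))// lerD.
have L1D2 : L1 P (fun w => (U w - Z w) ^+ 2).
  apply: (@L1_bounded _ _ _ _ _ ((1 + C) ^+ 2)); first exact: measurable_funX.
  by move=> w; rewrite normrX lerXn2r ?nnegrE// (le_trans (normr_ge0 _) (DC w)).
have L1DY : L1 P (fun w => (U w - Z w) * Y w).
  by apply: (L1_mulb mD DC); apply: (L1_bounded P mY Y1).
have L1YY : L1 P (fun w => Y w ^+ 2).
  apply: (@L1_bounded _ _ _ _ _ 1); first exact: measurable_funX.
  by move=> w; rewrite normrX exprn_ile1.
(* compare the near-minimizer Z with Z + s Y *)
have key s : 2 * s * \int[P]_w ((U w - Z w) * Y w) <= e ^+ 2 + s ^+ 2.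
  have : inf A <= \int[P]_w (U w - (Z w + s * Y w)) ^+ 2.
    apply: ge_inf; first by exists 0 => r; exact: A0.
    exists (maxn k l), (fun w => Z w + s * Y w); split => //; split.
      apply: measurable_funD.
        by apply: adapted_mono (BZ.1); rewrite leq_maxl.
      apply: measurable_funM => //.
      by apply: adapted_mono (BY.1); rewrite leq_maxr.
    exists (C + `|s| * 1) => w; rewrite (le_trans (ler_normD _ _))// lerD//.
    by rewrite normrM ler_wpM2l.
  have -> : \int[P]_w (U w - (Z w + s * Y w)) ^+ 2 = \int[P]_w ((U w - Z w) ^+ 2 +
      ((- (2 * s)) * ((U w - Z w) * Y w) + s ^+ 2 * Y w ^+ 2)).
    by apply: eq_Rintegral => w _; ring.
  have La := L1Z (- (2 * s)) L1DY; have Lb := L1Z (s ^+ 2) L1YY.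
  rewrite RintegralD//; last exact: L1D.
  rewrite RintegralD// RintegralZl// RintegralZl//.
  have : \int[P]_w Y w ^+ 2 <= 1.
    apply: le_trans (ler_norm _) _; apply: Rintegral_bounded; first exact: measurable_funX.
    by move=> w; rewrite normrX exprn_ile1.
  move: Zinf; have := sqr_ge0 s.
  move: (\int[P]_w _) (\int[P]_w _) (\int[P]_w _) => x y z s0 h1 h2 h3.
  have : s ^+ 2 * y <= s ^+ 2 by rewrite ler_piMr.
  lra.
have k1 := key e; have k2 := key (- e).
rewrite ler_norml; apply/andP; split.
  by rewrite -(ler_pM2l e0); move: k2; nra.
by rewrite -(ler_pM2l e0); nra.
Qed.

(** [U - Z] is nearly orthogonal to the cosines, which are adapted at time [n]. It is also nearly
    orthogonal to the limit, which is not adapted but is close in [L^1] to the same expression with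
    [v j]. *)
Lemma cvg_cos_stable (U : T -> R) (c : R) : measurable_fun setT U -> (forall w, `|U w| <= 1) ->
  \int[P]_w (U w * cos (psum n w / Num.sqrt n%:R + c)) @[n --> \oo] -->
  \int[P]_w (U w * (cos c * expR (- (vlim w / 2)))).
Proof.
move=> mU U1; apply/cvgrPdist_le => e e0.
have e4 : 0 < e / 4 by rewrite divr_gt0.
have [k [Z [BZ HZ]]] := adapted_projection mU U1 e4.
have [mZ [C ZC]] : measurable_fun setT Z /\ exists M : R, forall w, `|Z w| <= M.
  by case: BZ => aZ bZ; split => //; exact: adapted_measurable aZ.
have mD : measurable_fun setT (fun w => U w - Z w) by exact: measurable_funB.
have DC w : `|U w - Z w| <= 1 + C by rewrite (le_trans (ler_normB _ _))// lerD.
have split_int (Y : T -> R) : measurable_fun setT Y -> (forall w, `|Y w| <= 1) ->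
    \int[P]_w (U w * Y w) = \int[P]_w (Z w * Y w) + \int[P]_w ((U w - Z w) * Y w).
  move=> mY Y1; have LY := L1_bounded P mY Y1.
  rewrite -RintegralD//; [|exact: (L1_mulb mZ ZC)|exact: (L1_mulb mD DC)].
  by apply: eq_Rintegral => w _; ring.
have eb (f : T -> R) : (forall w, 0 <= f w) -> forall w, `|cos c * expR (- (f w / 2))| <= 1.
  move=> f0 w; rewrite normrM -[leRHS]mulr1 ler_pM ?cos_max//.
  by rewrite (ger0_norm (expR_ge0 _)) -[leRHS]expR0 ler_expR oppr_le0 divr_ge0.
have em (f : T -> R) : measurable_fun setT f -> measurable_fun setT (fun w => cos c * expR (- (f w / 2))).
  move=> mf; apply: measurable_funM => //.
  apply: measurableT_comp => //; apply: measurableT_comp => //.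
  exact: measurable_funM.
have cb n w : `|cos (psum n w / Num.sqrt n%:R + c)| <= 1 by exact: cos_max.
have ac n : adapted n (fun w => cos (psum n w / Num.sqrt n%:R + c)).
  apply: measurableT_comp; first exact: (continuous_measurable_fun (@continuous_cos R)).
  by apply: measurable_funD => //; apply: measurable_funM => //; exact: psum_adapted.
have lim_le : `|\int[P]_w ((U w - Z w) * (cos c * expR (- (vlim w / 2))))| <= e / 4 + e / 4.
  have C1 : 0 < 2 + C by have := le_trans (normr_ge0 _) (ZC point); lra.
  have [j _ /(_ j (leqnn j)) vj] : \forall j \near \oo, \int[P]_w `|v j w - vlim w| <= e / 4 / (2 + C).
    move/cvgrPdist_le : v_cvg => /(_ (e / 4 / (2 + C))); rewrite divr_gt0// => /(_ isT).
    apply: filterS => j; rewrite sub0r normrN; apply: le_trans; exact: ler_norm.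
  have D2 w : `|U w - Z w| <= 2 + C by apply: le_trans (DC w) _; lra.
  have h1 := exp_half_dist mD D2 (@v_L1 j) vlim_L1 (v_ge0 j) vlim_ge0 c.
  have h2 : `|\int[P]_w ((U w - Z w) * (cos c * expR (- (v j w / 2))))| <= e / 4.
    apply: (HZ j).
      split; last by exists 1 => w; exact: (eb (v j) (v_ge0 j) w).
      apply: measurable_funM => //.
      apply: measurableT_comp => //; apply: measurableT_comp => //.
      by apply: measurable_funM => //; exact: (@v_adapted j).
    by move=> w; exact: (eb (v j) (v_ge0 j) w).
  have h3 : (2 + C) * \int[P]_w `|v j w - vlim w| <= e / 4.
    by rewrite mulrC -ler_pdivlMr.
  rewrite -(subrK (\int[P]_w ((U w - Z w) * (cos c * expR (- (v j w / 2))))) (\int[P]_w _)).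
  apply: le_trans (ler_normD _ _) _; rewrite lerD//.
  by rewrite distrC; exact: le_trans h1 h3.
near=> n.
rewrite (split_int _ (em _ (L1_measurable vlim_L1)) (eb _ vlim_ge0)).
rewrite (split_int _ (adapted_measurable (@ac n)) (cb n)).
have h1 : `|\int[P]_w ((U w - Z w) * cos (psum n w / Num.sqrt n%:R + c))| <= e / 4.
  by apply: (HZ n) => //; split => //; exists 1.
have h2 : `|\int[P]_w (Z w * (cos c * expR (- (vlim w / 2)))) -
    \int[P]_w (Z w * cos (psum n w / Num.sqrt n%:R + c))| <= e / 4.
  by near: n; move/cvgrPdist_le : (@cvg_cos_adapted c k Z BZ); apply.
move: h1 h2 lim_le; move: (\int[P]_w _) (\int[P]_w _) (\int[P]_w _) (\int[P]_w _) => a b x y.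
rewrite !ler_norml => /andP[? ?] /andP[? ?] /andP[? ?]; apply/andP; split; lra.
Unshelve. all: by end_near. Qed.

End MartingaleCLT.

(** * Predictive distributions *)

Section Predictive.
Context {d d' : measure_display} {Omega : measurableType d}
  {S : measurableType d'} {R : realType}.
Variables (P : probability Omega R) (X : nat -> {mfun Omega >-> S})
  (nu : probability S R) (theta : R) (K : {mfun S >-> pprobability S R})
  (mu : {mfun Omega >-> pprobability S R}).
Hypothesis XL : in_classL P X nu theta K.
Hypothesis muX : is_limit_measure P X mu.

Let theta_gt0 : 0 < theta. Proof. by case: XL. Qed.

Lemma past_X n i A : (i < n)%N -> measurable A -> past X n (X i @^-1` A).
Proof.
move=> ni mA; apply: sub_sigma_algebra.
rewrite -(bigcup_mkord n (fun i => preimage_set_system setT (X i) measurable)).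
by exists i => //; exists A => //; rewrite setTI.
Qed.

Lemma past_measurable n : past X n `<=` measurable.
Proof.
apply: smallest_sub; first exact: sigma_algebra_measurable.
rewrite -(bigcup_mkord n (fun i => preimage_set_system setT (X i) measurable)).
move=> _ [i _ [A mA <-]]; rewrite setTI -[X in measurable X]setTI.
exact: measurable_funPT.
Qed.

Lemma past_mono n m : (n <= m)%N -> past X n `<=` past X m.
Proof.
move=> nm; apply: smallest_sub; first exact: smallest_sigma_algebra.
rewrite -(bigcup_mkord n (fun i => preimage_set_system setT (X i) measurable)).
by move=> _ [i ni [A mA <-]]; rewrite setTI; apply: past_X => //; exact: leq_trans nm.
Qed.

Lemma past_sigma n (A : set Omega) : <<s past X n >> A -> past X n A.
Proof.
apply: smallest_sub => //; exact: smallest_sigma_algebra.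
Qed.

Lemma adapted_X n i (f : S -> R) : (i < n)%N -> measurable_fun setT f ->
  adapted (past X) n (fun w => f (X i w)).
Proof.
move=> ni mf _ A mA; rewrite setTI; apply: sub_sigma_algebra.
apply: (past_X (A := f @^-1` A) ni).
by rewrite -[X in measurable X]setTI; exact: mf.
Qed.

(** The defining identity of a regular conditional distribution, taken on the whole space. *)
Lemma rcd_mixture A : measurable A -> (nu A = \int[nu]_x K x A)%E.
Proof.
move=> mA; have [_ [G [[[G0 GC _] _] _ H]] _ _] := XL.
by rewrite -H// ?setIT// -(setC0) -setTD; exact: GC.
Qed.

(** The integral of [f] under the predictive law of [X n] given the first [n] variables; at [n = 0]
    it reduces to the integral under [nu]. *)
Definition pred n (f : S -> R) (w : Omega) : R :=
  (n%:R + theta)^-1 * (theta * \int[nu]_x f x + \sum_(i < n) kerint K f (X i w)).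

Let sum_ord_const n (c : R) : \sum_(i < n) c = n%:R * c.
Proof. by rewrite sumr_const card_ord mulr_natl. Qed.

Let norm_tri (x y z a : R) : `|x - y| <= a -> `|z - y| <= a -> `|x - z| <= 2 * a.
Proof. by rewrite !ler_norml => /andP[? ?] /andP[? ?]; apply/andP; split; lra. Qed.

Let ntheta_gt0 n : 0 < n%:R + theta.
Proof. by rewrite ltr_wpDl. Qed.

Lemma pred_indicE n A w : measurable A ->
  (pred n \1_A w)%:E = (((n%:R + theta)^-1)%:E *
     (theta%:E * nu A + \sum_(i < n) K (X i w) A))%E.
Proof.
move=> mA; rewrite /pred EFinM EFinD EFinM Rintegral_indic// fineK ?fin_num_measure//.
congr (_ * (_ + _))%E; elim: n => [|n ih]; first by rewrite !big_ord0.
rewrite !big_ord_recr/= -ih EFinD; congr (_ + _)%E.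
by rewrite kerint_indic// fineK ?fin_num_measure.
Qed.

Lemma measurable_pred_adapted n f : measurable_fun setT f -> adapted (past X) n (pred n f).
Proof.
move=> mf; apply: measurable_funM => //; apply: measurable_funD => //.
apply: measurable_sum => i.
by apply: adapted_X => //; exact: measurable_kerint.
Qed.

(** The law of [X n] is a hypothesis here because this is used inside the induction that establishes
    it. *)
Let nintegral_marginal n (h : S -> \bar R) :
  (forall A, measurable A -> P (X n @^-1` A) = nu A) ->
  measurable_fun setT h -> (forall x, 0 <= h x)%E ->
  (\int[P]_w h (X n w) = \int[nu]_x h x)%E.
Proof.
move=> H mh h0; rewrite -(ge0_integral_distribution (X n))//.
by apply: eq_measure_integral => A mA _; exact: H.
Qed.

(** Strong induction. The predictive formula integrated over the whole space leaves [nu A] and the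
    integrals of [K (X i) A] for [i < n]; each of these is [nu A], since [X i] has law [nu] and [nu]
    is the mixture of the [K x]. *)
Lemma marginal n A : measurable A -> P (X n @^-1` A) = nu A.
Proof.
elim/ltn_ind: n A => n ih A mA.
have [-> {n ih}|n0] := posnP n; first by case: XL => _ _ /(_ A mA).
have [_ _ _ /(_ n n0 A mA) [_ _ /(_ setT)]] := XL.
rewrite setIT => <-; last first.
  by rewrite -(preimage_setT (X 0)); exact: past_X.
transitivity (\int[P]_w ((n%:R + theta)^-1 * (theta * fine (nu A) + \sum_(i < n) kerint K \1_A (X i w)))%:E)%E.
  apply: eq_integral => w _; rewrite -pred_indicE//.
  by rewrite /pred Rintegral_indic.
have LK : L1 nu (kerint K \1_A).
  by apply: (L1_kerint rcd_mixture); exact: L1_indic.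
have kA0 x : 0 <= kerint K \1_A x by rewrite kerint_indic// fine_ge0.
have mk : measurable_fun setT (kerint K \1_A) := L1_measurable LK.
have Ei i : (i < n)%N -> (\int[P]_w (kerint K \1_A (X i w))%:E = (fine (nu A))%:E)%E.
  move=> ni; rewrite (@nintegral_marginal i (EFin \o kerint K \1_A)) ?EFin_Rintegral//.
  - by rewrite (Rintegral_kerint rcd_mixture) ?Rintegral_indic//; exact: L1_indic.
  - by move=> B mB; exact: ih.
  - exact/measurable_EFinP.
have Lki i : (i < n)%N -> L1 P (fun w => kerint K \1_A (X i w)).
  move=> ni; apply: L1_ge0 => //; first exact: measurableT_comp.
  by rewrite Ei// ltry.
have -> : (fun w => ((n%:R + theta)^-1 * (theta * fine (nu A) + \sum_(i < n) kerint K \1_A (X i w)))%:E)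
   = EFin \o (fun w => (n%:R + theta)^-1 * (theta * fine (nu A) + \sum_(i < n) kerint K \1_A (X i w))).
  by [].
have Ls : L1 P (fun w => \sum_(i < n) kerint K \1_A (X i w)).
  by apply: L1_sum => i; exact: Lki.
rewrite EFin_Rintegral; last by apply: L1Z; apply: L1D => //; exact: L1_cst.
rewrite RintegralZl//; last by apply: L1D => //; exact: L1_cst.
rewrite RintegralD//; last exact: L1_cst.
rewrite Rintegral_prob_cst Rintegral_sumL; last by move=> i; exact: Lki.
rewrite (eq_bigr (fun=> fine (nu A))); last first.
  by move=> i _; rewrite /Rintegral Ei.
rewrite sum_ord_const -mulrDl addrC mulrA mulVf ?mul1r ?fineK ?fin_num_measure//.
by rewrite addrC lt0r_neq0.
Qed.

(** As a kernel on [Omega], [K (X i)] has mixture [nu], so the mixture lemmas apply to each summand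
    of [pred]. *)
Definition kerX i : {mfun Omega >-> pprobability S R} := K \o X i.

Lemma integral_marginal n (h : S -> \bar R) :
  measurable_fun setT h -> (forall x, 0 <= h x)%E ->
  (\int[P]_w h (X n w) = \int[nu]_x h x)%E.
Proof. by apply: nintegral_marginal => A mA; exact: marginal. Qed.

Lemma L1_X n f : L1 nu f -> L1 P (fun w => f (X n w)).
Proof.
move=> Lf; have mf := L1_measurable Lf.
apply/integrableP; split; first by apply/measurable_EFinP; exact: measurableT_comp.
rewrite (@integral_marginal n (fun x => `|(f x)%:E|)%E)//.
- by case/integrableP : Lf.
- by apply: measurableT_comp => //; exact/measurable_EFinP.
Qed.

Lemma Rintegral_X n f : L1 nu f -> \int[P]_w f (X n w) = \int[nu]_x f x.
Proof.
move=> Lf; have mf := L1_measurable Lf.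
congr fine; rewrite -(@integral_distribution _ _ _ _ _ P (X n) (EFin \o f)).
- by apply: eq_measure_integral => A mA _; exact: marginal.
- exact/measurable_EFinP.
- exact: L1_X.
Qed.

Lemma kerX_mixture i A : measurable A -> (nu A = \int[P]_w kerX i w A)%E.
Proof.
move=> mA; rewrite (@integral_marginal i (fun x => K x A)) -?rcd_mixture//.
exact: measurable_ker_ev.
Qed.

Lemma predE n f w : pred n f w =
  (n%:R + theta)^-1 * (theta * \int[nu]_x f x + \sum_(i < n) kerint (kerX i) f w).
Proof. by []. Qed.

Lemma L1_pred n f : L1 nu f -> L1 P (pred n f).
Proof.
move=> Lf; apply: L1Z; apply: L1D; first exact: L1_cst.
by apply: L1_sum => i; exact: (L1_kerint (kerX_mixture i)).
Qed.

Lemma Rintegral_pred n f : L1 nu f -> \int[P]_w pred n f w = \int[nu]_x f x.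
Proof.
move=> Lf; have Lk i := L1_kerint (kerX_mixture i) Lf.
have Ls : L1 P (fun w => \sum_(i < n) kerint (kerX i) f w) by exact: L1_sum.
rewrite /pred RintegralZl//; last by apply: L1D => //; exact: L1_cst.
rewrite RintegralD//; last exact: L1_cst.
rewrite Rintegral_prob_cst Rintegral_sumL; last by move=> i; exact: Lk.
rewrite (eq_bigr (fun=> \int[nu]_x f x)); last first.
  by move=> i _; exact: (Rintegral_kerint (kerX_mixture i)).
rewrite sum_ord_const -mulrDl addrC mulrA mulVf ?mul1r//.
by rewrite addrC lt0r_neq0.
Qed.

Let ae_sum n (f g : nat -> Omega -> R) :
  (forall i, {ae P, forall w, f i w = g i w}) ->
  {ae P, forall w, \sum_(i < n) f i w = \sum_(i < n) g i w}.
Proof.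
move=> H; elim: n => [|n ih]; first by apply: aeW => w; rewrite !big_ord0.
by apply: filterS2 ih (H n) => w h1 h2; rewrite !big_ord_recr/= h1 h2.
Qed.

Lemma predD_ae n f g : L1 nu f -> L1 nu g ->
  {ae P, forall w, pred n (fun x => f x + g x) w = pred n f w + pred n g w}.
Proof.
move=> Lf Lg; have := @ae_sum n (fun i => kerint (kerX i) (fun x => f x + g x))
  (fun i w => kerint (kerX i) f w + kerint (kerX i) g w)
  (fun i => kerintD_ae (kerX_mixture i) Lf Lg).
apply: filterS => w E; rewrite !predE E RintegralD// big_split/=; ring.
Qed.

Lemma predZ_ae n a f : L1 nu f ->
  {ae P, forall w, pred n (fun x => a * f x) w = a * pred n f w}.
Proof.
move=> Lf; have := @ae_sum n (fun i => kerint (kerX i) (fun x => a * f x))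
  (fun i w => a * kerint (kerX i) f w) (fun i => kerintZ_ae (kerX_mixture i) a Lf).
apply: filterS => w E; rewrite !predE E RintegralZl// -big_distrr/=; ring.
Qed.

(** [pred n] is a convex combination of [L^1] contractions, with weights [theta / (n + theta)] and
    [n] times [1 / (n + theta)]; the bound is therefore uniform in [n]. *)
Lemma pred_dist_le n f g : L1 nu f -> L1 nu g ->
  \int[P]_w `|pred n f w - pred n g w| <= \int[nu]_x `|f x - g x|.
Proof.
move=> Lf Lg; have Lfg := L1_norm (L1B Lf Lg).
have Lk i := L1_norm (L1B (L1_kerint (kerX_mixture i) Lf) (L1_kerint (kerX_mixture i) Lg)).
have Ls : L1 P (fun w => \sum_(i < n) `|kerint (kerX i) f w - kerint (kerX i) g w|).
  by apply: L1_sum => i; exact: Lk.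
pose b w := (n%:R + theta)^-1 * (theta * \int[nu]_x `|f x - g x| +
  \sum_(i < n) `|kerint (kerX i) f w - kerint (kerX i) g w|).
apply: (@le_trans _ _ (\int[P]_w b w)).
  apply: le_Rintegral => //.
  - by apply: L1_norm; apply: L1B; exact: L1_pred.
  - by apply: L1Z; apply: L1D => //; exact: L1_cst.
  have c0 : 0 <= (n%:R + theta)^-1 by rewrite invr_ge0 ltW.
  move=> w _; rewrite !predE -mulrBr normrM (ger0_norm c0) /b ler_wpM2l//.
  rewrite opprD addrACA -mulrBr -sumrB -RintegralB//.
  apply: le_trans (ler_normD _ _) _; rewrite lerD ?ler_norm_sum//.
  rewrite normrM (ger0_norm (ltW theta_gt0)) ler_pM2l//.
  by apply: le_normr_Rintegral => //; exact: L1B.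
rewrite /b RintegralZl//; last by apply: L1D => //; exact: L1_cst.
rewrite RintegralD//; last exact: L1_cst.
rewrite Rintegral_prob_cst Rintegral_sumL//.
rewrite mulrC ler_pdivrMr// mulrDr [X in _ <= X]addrC (mulrC _ theta) lerD2l.
apply: (@le_trans _ _ (\sum_(i < n) \int[nu]_x `|f x - g x|)).
  by apply: ler_sum => i _; exact: (kerint_dist_le (kerX_mixture i)).
by rewrite sum_ord_const mulrC.
Qed.

(** The class gives this for [1 <= n]. At [n = 0] the past consists of the empty set and the whole
    space, and the law of the first variable decides. That case is required because
    [is_limit_measure] takes versions for all [n]. *)
Lemma cond_prob_pred n A : measurable A ->
  is_cond_prob P (past X n) (X n @^-1` A) (fun w => (pred n \1_A w)%:E).
Proof.
move=> mA; have [->|n0] := posnP n; last first.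
  rewrite (_ : (fun w => _) = (fun w => (((n%:R + theta)^-1)%:E *
     (theta%:E * nu A + \sum_(i < n) K (X i w) A))%E)).
    by have [_ _ _] := XL; apply.
  by apply/funext => w; rewrite pred_indicE.
have pE : pred 0 \1_A = fun=> fine (nu A).
  apply/funext => w; rewrite /pred big_ord0 addr0 add0r mulKf ?Rintegral_indic//.
  exact: lt0r_neq0.
rewrite pE; split.
- exact: measurable_cst.
- exact: L1_cst.
move=> H pH; have : H = set0 \/ H = setT.
  move: pH; rewrite /past /g_sigma_preimage big_ord0 => pH.
  have : [set H | H = set0 \/ H = setT] H.
    apply: pH; split; last by []; split.
    - by left.
    - by move=> B /= [->|->]; [right; rewrite setD0|left; rewrite setDv].
    - move=> B HB /=; have [[i Bi]|nB] := pselect (exists i, B i = setT).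
        by right; rewrite -subTset => x _; exists i => //; rewrite Bi.
      left; rewrite -subset0 => x [i _ Bix]; have [Bi|Bi] := HB i.
        by rewrite Bi in Bix.
      by case: nB; exists i.
  by [].
move=> [->|->]; first by rewrite integral_set0 setI0 measure0.
rewrite setIT marginal// (EFin_Rintegral (L1_cst P (fine (nu A)))) Rintegral_prob_cst.
by rewrite fineK ?fin_num_measure.
Qed.

(** [is_cond_prob] concerns an event of the past and an indicator of [X n]. The event is replaced by
    [Z] through uniform approximation, the indicator by [f] through induction; in the closure step
    both sides move by at most [C] times the [L^1] distance under [nu]. *)
Lemma Rintegral_adapted_X n Z f : adapted_bounded (past X) n Z -> L1 nu f ->
  \int[P]_w (Z w * f (X n w)) = \int[P]_w (Z w * pred n f w).
Proof.
move=> [aZ [C ZC]] Lf.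
have C0 : 0 <= C by exact: le_trans (normr_ge0 _) (ZC point).
have mZ : measurable_fun setT Z := adapted_measurable past_measurable aZ.
have LZ g : L1 P g -> L1 P (fun w => Z w * g w) by exact: L1_mulb.
move: f Lf; apply: L1_indic_ind => [A mA|f g Lf Lg hf hg|a f Lf hf|f Lf H].
- have mXA : measurable (X n @^-1` A) by rewrite -[X in measurable X]setTI; exact: measurable_funPT.
  have LU : L1 P (fun w => \1_A (X n w) - pred n \1_A w).
    by apply: L1B; [apply: L1_X|apply: L1_pred]; exact: L1_indic.
  have LU1 := L1_norm LU.
  apply/eqP; rewrite -subr_eq0 -RintegralB//; last 2 first.
  + by apply: LZ; apply: L1_X; exact: L1_indic.
  + by apply: LZ; apply: L1_pred; exact: L1_indic.
  under eq_Rintegral do rewrite -mulrBr.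
  have zero (H : set Omega) : past X n H -> \int[P]_w (\1_H w * (\1_A (X n w) - pred n \1_A w)) = 0.
    move=> pH; have mH := past_measurable pH; rewrite -Rintegral_setE// RintegralB//; last 2 first.
    + by apply: (integrableS measurableT) => //; apply: L1_X; exact: L1_indic.
    + by apply: (integrableS measurableT) => //; apply: L1_pred; exact: L1_indic.
    have [_ _ /(_ _ pH) E] := cond_prob_pred n mA.
    rewrite {2}/Rintegral E Rintegral_setE//.
    have -> : \int[P]_w (\1_H w * \1_A (X n w)) = \int[P]_w \1_(X n @^-1` A `&` H) w.
      by apply: eq_Rintegral => w _; rewrite setIC indicI.
    by rewrite Rintegral_indic ?subrr//; exact: measurableI.
  rewrite -normr_le0; apply/ler_addgt0Pr => e e0; rewrite add0r.
  pose D := \int[P]_w `|\1_A (X n w) - pred n \1_A w|.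
  have D0 : 0 <= D by exact: Rintegral_ge0.
  have eD : 0 < e / (D + 1) by rewrite divr_gt0// ltr_wpDl.
  (* The approximation is carried out in the sigma-field of the past, since [aZ] is measurability
     with respect to it; so the sets [B j] are events of the past. *)
  have [N [a [B [mB HB]]]] := uniform_simple_approx aZ ZC eD.
  have pB j : past X n (B j) by apply: past_sigma; exact: mB.
  have mB' j : d.-measurable (B j : set Omega) by exact: (@past_measurable n _ (pB j)).
  have s0 : \int[P]_w ((\sum_(j < N) a j * \1_(B j) w) * (\1_A (X n w) - pred n \1_A w)) = 0.
    under eq_Rintegral do rewrite big_distrl/=.
    have LB j : L1 P (fun w => \1_(B j) w * (\1_A (X n w) - pred n \1_A w)).
      apply: (@L1_mulb _ _ _ _ _ _ 1 _ _ LU); first exact: measurable_indic.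
      by move=> w; rewrite indicE; case: (_ \in _); rewrite ?normr1 ?normr0.
    under eq_Rintegral do under eq_bigr do rewrite -mulrA.
    rewrite (Rintegral_sumL _ (F := fun (j : 'I_N) (w : Omega) => a j * (\1_(B j) w * (\1_A (X n w) - pred n \1_A w)))); last first.
      by move=> j; exact: L1Z.
    apply: big1 => j _; rewrite RintegralZl//; last exact: LB.
    apply/eqP; rewrite mulf_eq0; apply/orP; right.
    by apply/eqP; exact: (zero _ (pB j)).
  rewrite -[X in `|X|]subr0 -s0 -RintegralB//; last 2 first.
  + by exact: LZ.
  + apply: (@L1_mulb _ _ _ _ _ _ (C + e / (D + 1)) _ _ LU).
      apply: measurable_sum => j; apply: measurable_funM => //; exact: measurable_indic.
    move=> w; have := HB w; have := ZC w; move: (\sum_(j < N) _) => s.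
    by rewrite !ler_norml => /andP[? ?] /andP[? ?]; apply/andP; split; lra.
  apply: (@le_trans _ _ (\int[P]_w (e / (D + 1) * `|\1_A (X n w) - pred n \1_A w|))).
    apply: Rintegral_norm_le; last 2 first.
    + exact: L1Z.
    + by move=> w; rewrite -mulrBl normrM ler_wpM2r.
    apply: measurable_funB; apply: measurable_funM => //; try exact: L1_measurable LU.
    by apply: measurable_sum => j; apply: measurable_funM => //; exact: measurable_indic.
  rewrite RintegralZl// -/D mulrAC ler_pdivrMr ?ltr_wpDl// ler_pM2l//.
  by rewrite lerDl.
- have -> : \int[P]_w (Z w * (f (X n w) + g (X n w))) =
    \int[P]_w (Z w * f (X n w)) + \int[P]_w (Z w * g (X n w)).
    rewrite -RintegralD//; [|exact/LZ/L1_X|exact/LZ/L1_X].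
    by apply: eq_Rintegral => w _; rewrite mulrDr.
  have Lpf := LZ _ (L1_pred n Lf); have Lpg := LZ _ (L1_pred n Lg).
  rewrite hf hg -(RintegralD measurableT Lpf Lpg).
  apply: Rintegral_ae_eq.
  + exact: L1D.
  + by apply/LZ/L1_pred; exact: L1D.
  + by apply: filterS (predD_ae n Lf Lg) => w ->; rewrite mulrDr.
- have -> : \int[P]_w (Z w * (a * f (X n w))) = a * \int[P]_w (Z w * f (X n w)).
    rewrite -RintegralZl//; last exact/LZ/L1_X.
    by apply: eq_Rintegral => w _; rewrite mulrCA.
  have Lpf := LZ _ (L1_pred n Lf).
  rewrite hf -(RintegralZl _ measurableT Lpf).
  apply: Rintegral_ae_eq.
  + exact: L1Z.
  + by apply/LZ/L1_pred; exact: L1Z.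
  + by apply: filterS (predZ_ae n a Lf) => w ->; rewrite mulrCA.
- apply/eqP; rewrite -subr_eq0 -normr_le0; apply/ler_addgt0Pr => e e0; rewrite add0r.
  have eC : 0 < e / (2 * C + 1) by rewrite divr_gt0// ltr_wpDl// mulr_ge0.
  have [g [Lg hg fg]] := H _ eC.
  have b1 : `|\int[P]_w (Z w * f (X n w)) - \int[P]_w (Z w * g (X n w))| <= C * \int[nu]_x `|f x - g x|.
    rewrite -RintegralB//; [|exact/LZ/L1_X|exact/LZ/L1_X].
    have Ln := L1_norm (L1B Lf Lg).
    have LnX : L1 P (fun w => `|f (X n w) - g (X n w)|) := L1_X n Ln.
    rewrite -(Rintegral_X n Ln) -(RintegralZl _ measurableT LnX).
    apply: Rintegral_norm_le.
    + by apply: L1_measurable; apply: L1B; exact/LZ/L1_X.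
    + exact: L1Z.
    + by move=> w; rewrite -mulrBr normrM ler_wpM2r.
  have b2 : `|\int[P]_w (Z w * pred n f w) - \int[P]_w (Z w * pred n g w)| <= C * \int[nu]_x `|f x - g x|.
    rewrite -RintegralB//; [|exact/LZ/L1_pred|exact/LZ/L1_pred].
    apply: (@le_trans _ _ (C * \int[P]_w `|pred n f w - pred n g w|)); last first.
      by rewrite ler_wpM2l// pred_dist_le.
    have Ln := L1_norm (L1B (L1_pred n Lf) (L1_pred n Lg)).
    rewrite -RintegralZl//; apply: Rintegral_norm_le.
    + by apply: L1_measurable; apply: L1B; exact/LZ/L1_pred.
    + exact: L1Z.
    + by move=> w; rewrite -mulrBr normrM ler_wpM2r.
  rewrite hg in b1.
  have bC : C * \int[nu]_x `|f x - g x| <= C * (e / (2 * C + 1)) by rewrite ler_wpM2l.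
  apply: le_trans (norm_tri b1 b2) _.
  apply: (@le_trans _ _ (2 * (C * (e / (2 * C + 1))))); first by rewrite ler_pM2l.
  rewrite mulrA mulrA ler_pdivrMr ?ltr_wpDl ?mulr_ge0//.
  by rewrite mulrC ler_pM2l// lerDl.
Qed.

Let pred_indic_bound n A w : measurable A -> `|pred n \1_A w| <= 1.
Proof.
move=> mA; rewrite ger0_norm; last first.
  rewrite mulr_ge0 ?invr_ge0 ?(ltW (ntheta_gt0 _))// addr_ge0//.
    by rewrite mulr_ge0 ?(ltW theta_gt0)// Rintegral_ge0.
  by apply: sumr_ge0 => i _; rewrite kerint_indic// fine_ge0.
rewrite /pred mulrC ler_pdivrMr ?ntheta_gt0// mul1r addrC lerD//.
  rewrite -[leRHS]mulr1 -sum_ord_const ler_sum// => i _.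
  by rewrite kerint_indic// -lee_fin fineK ?fin_num_measure// probability_le1.
rewrite -[leRHS]mulr1 ler_pM2l// Rintegral_indic// -lee_fin fineK ?fin_num_measure//.
exact: probability_le1.
Qed.

Let pred_indic_cvg A : measurable A ->
  {ae P, forall w, pred n \1_A w @[n --> \oo] --> kerint mu \1_A w}.
Proof.
move=> mA; have [_ /(_ (fun n w => (pred n \1_A w)%:E) (fun n => cond_prob_pred n mA))] := muX mA.
apply: filterS => w cv; rewrite kerint_indic//.
apply: (@fine_cvg _ _ _ _ (fun n => (pred n \1_A w)%:E)).
by rewrite fineK ?fin_num_measure.
Qed.

(** The predictive probabilities of [A] all have mean [nu A], and by bounded convergence this mean
    passes to their almost sure limit. *)
Lemma limit_mixture A : measurable A -> (nu A = \int[P]_w mu w A)%E.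
Proof.
move=> mA.
have mk : measurable_fun setT (kerint mu \1_A) by apply: measurable_kerint; exact: measurable_indic.
have cv : \int[P]_w pred n \1_A w @[n --> \oo] --> \int[P]_w kerint mu \1_A w.
  apply: (@cvg_Rintegral_dom _ _ _ _ _ _ (fun=> 1)) => //.
  - by move=> n; apply: L1_measurable; apply: L1_pred; exact: L1_indic.
  - exact: L1_cst.
  - by move=> n w; exact: pred_indic_bound.
  - exact: pred_indic_cvg.
have : \int[P]_w pred n \1_A w @[n --> \oo] --> fine (nu A).
  rewrite (_ : (fun n => _) = fun=> fine (nu A)); first exact: cvg_cst.
  by apply/funext => n; rewrite Rintegral_pred ?Rintegral_indic//; exact: L1_indic.
move/(cvg_unique _ cv) => E.
have b w : `|kerint mu \1_A w| <= 1.
  rewrite kerint_indic// ger0_norm ?fine_ge0// -lee_fin fineK ?fin_num_measure//.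
  exact: probability_le1.
have := EFin_Rintegral (L1_bounded P mk b); rewrite E// fineK ?fin_num_measure// => <-.
by apply: eq_integral => w _; rewrite kerint_indic// fineK ?fin_num_measure.
Qed.

(** Bounded convergence settles indicators. The general case follows because [pred n], uniformly in
    [n], and [kerint mu] are both contractions of [L^1]. *)
Lemma cvg_pred f : L1 nu f ->
  \int[P]_w `|pred n f w - kerint mu f w| @[n --> \oo] --> 0.
Proof.
have LM g : L1 nu g -> L1 P (kerint mu g) by exact: (L1_kerint limit_mixture).
have LN n g : L1 nu g -> L1 P (fun w => `|pred n g w - kerint mu g w|).
  by move=> Lg; apply: L1_norm; apply: L1B; [exact: L1_pred|exact: LM].
move: f; apply: L1_indic_ind => [A mA|f g Lf Lg hf hg|a f Lf hf|f Lf H].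
- have -> : 0 = \int[P]_w (0 : R) by rewrite Rintegral_prob_cst.
  have LA := L1_indic nu mA.
  have b w : `|kerint mu \1_A w| <= 1.
    rewrite kerint_indic// ger0_norm ?fine_ge0// -lee_fin fineK ?fin_num_measure//.
    exact: probability_le1.
  apply: (@cvg_Rintegral_dom _ _ _ _ _ _ (fun=> 2)) => //.
  - by move=> n; exact: L1_measurable (LN n _ LA).
  - exact: L1_cst.
  - move=> n w; rewrite normr_id (le_trans (ler_normB _ _))//.
    by rewrite (_ : 2 = 1 + 1)// lerD// pred_indic_bound.
  - apply: filterS (pred_indic_cvg mA) => w cv.
    rewrite -(normr0 R) -(subrr (kerint mu \1_A w)).
    by apply: cvg_norm; apply: cvgB => //; exact: cvg_cst.
- apply: (@squeeze_cvgr _ _ _ _ (cst 0) (fun n => \int[P]_w `|pred n f w - kerint mu f w| +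
      \int[P]_w `|pred n g w - kerint mu g w|)).
  + near=> n; rewrite Rintegral_ge0//= -RintegralD//; [|exact: LN|exact: LN].
    rewrite (@Rintegral_ae_eq _ _ _ P _ (fun w => `|pred n f w - kerint mu f w + (pred n g w - kerint mu g w)|)).
    * apply: le_Rintegral => //.
      - by apply: L1_norm; apply: L1D; apply: L1B; try exact: L1_pred; exact: LM.
      - by apply: L1D; exact: LN.
      - by move=> w _; exact: ler_normD.
    * by apply: LN; exact: L1D.
    * by apply: L1_norm; apply: L1D; apply: L1B; try exact: L1_pred; exact: LM.
    * apply: filterS2 (predD_ae n Lf Lg) (kerintD_ae limit_mixture Lf Lg) => w -> ->.
      by congr `|_|; ring.
  + exact: cvg_cst.
  + by rewrite -[X in _ --> X]addr0; exact: (cvgD hf hg).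
- rewrite (_ : (fun n => _) = fun n => `|a| * \int[P]_w `|pred n f w - kerint mu f w|).
    by rewrite -[X in _ --> X](mulr0 `|a|); exact: cvgMr.
  apply/funext => n; rewrite -RintegralZl//; last exact: LN.
  apply: Rintegral_ae_eq.
  + by apply: LN; exact: L1Z.
  + by apply: L1Z; exact: LN.
  + apply: filterS2 (predZ_ae n a Lf) (kerintZ_ae limit_mixture a Lf) => w -> ->.
    by rewrite -mulrBr normrM.
- apply/cvgrPdist_le => e e0.
  have e4 : 0 < e / 4 by rewrite divr_gt0.
  have [g [Lg hg fg]] := H _ e4.
  move/cvgrPdist_le : hg => /(_ _ e4); apply: filterS => n.
  rewrite (sub0r (\int[P]_w _)) normrN (sub0r (\int[P]_w _)) normrN => hg0.
  have hg := le_trans (ler_norm _) hg0.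
  rewrite ger0_norm; last exact: Rintegral_ge0.
  have b1 := le_trans (pred_dist_le n Lf Lg) fg.
  have b2 := le_trans (kerint_dist_le limit_mixture Lf Lg) fg.
  have Lp := L1_norm (L1B (L1_pred n Lf) (L1_pred n Lg)).
  have Lm := L1_norm (L1B (LM _ Lf) (LM _ Lg)).
  apply: (@le_trans _ _ (\int[P]_w (`|pred n f w - pred n g w| + `|kerint mu f w - kerint mu g w|
     + `|pred n g w - kerint mu g w|))).
    apply: le_Rintegral => //; first exact: LN.
    - by apply: L1D; [exact: L1D|exact: LN].
    - move=> w _; have tri (x y z t : R) : `|x - z| <= `|x - y| + `|z - t| + `|y - t|.
        rewrite (_ : x - z = (x - y) - (z - t) + (y - t)); last by ring.
        by rewrite (le_trans (ler_normD _ _))// lerD2r ler_normB.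
      exact: tri.
  rewrite RintegralD//; [|exact: L1D|exact: LN].
  by rewrite RintegralD//; lra.
Unshelve. all: by end_near. Qed.

End Predictive.

(** * The limit theorem in a fixed direction *)

Section DirectionalCLT.
Context {d : measure_display} {Omega : measurableType d} {R : realType} {p : nat}.
Variables (P : probability Omega R) (X : nat -> {mfun Omega >-> 'rV[R]_p})
  (nu : probability 'rV[R]_p R) (theta : R) (K : {mfun 'rV[R]_p >-> pprobability 'rV[R]_p R})
  (mu : {mfun Omega >-> pprobability 'rV[R]_p R}).
Hypothesis XL : in_classL P X nu theta K.
Hypothesis muX : is_limit_measure P X mu.
Hypothesis nu2 : (\int[nu]_x (euclidean_norm x ^+ 2)%:E < +oo)%E.
Hypothesis K0 : forall (x : 'rV[R]_p) (i : 'I_p), (\int[K x]_y (y 0%R i)%:E = 0)%E.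
Implicit Types (t : 'rV[R]_p) (i j : 'I_p).

Lemma L1_norm_sqr : L1 nu (fun x => \sum_i x 0 i ^+ 2).
Proof.
apply: L1_ge0.
- by apply: measurable_sum => i; apply: measurable_funX; exact: measurable_coord.
- by move=> x; apply: sumr_ge0 => i _; exact: sqr_ge0.
- rewrite (eq_integral (fun x => (euclidean_norm x ^+ 2)%:E))// => x _.
  by rewrite /euclidean_norm sqr_sqrtr//; apply: sumr_ge0 => i _; exact: sqr_ge0.
Qed.

Lemma L1_coordM i j : L1 nu (fun x => x 0 i * x 0 j).
Proof.
have mc := fun k => @measurable_coord R p k.
apply: (L1_dom _ (L1D L1_norm_sqr L1_norm_sqr)).
  by apply: measurable_funM; exact: mc.
have le k (x : 'rV[R]_p) : x 0 k ^+ 2 <= \sum_i x 0 i ^+ 2.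
  by rewrite (bigD1 k)//= lerDl sumr_ge0// => l _; exact: sqr_ge0.
move=> x; apply: le_trans (lerD (le i x) (le j x)).
by rewrite -[x 0 i ^+ 2]real_normK ?num_real// -[x 0 j ^+ 2]real_normK ?num_real// normrM; nra.
Qed.

Lemma L1_coord i : L1 nu (fun x => x 0 i).
Proof.
apply: (L1_dom _ (L1D (L1_cst nu 1) (L1_coordM i i))); first exact: measurable_coord.
by move=> x; rewrite -expr2 -[x 0 i ^+ 2]real_normK ?num_real//; nra.
Qed.

Lemma dot_sqrE t (x : 'rV[R]_p) : dot t x ^+ 2 = \sum_i \sum_j t 0 i * t 0 j * (x 0 i * x 0 j).
Proof.
rewrite expr2 /dot big_distrl/=; apply: eq_bigr => i _.
by rewrite big_distrr/=; apply: eq_bigr => j _; ring.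
Qed.

Lemma L1_dot_sqr t : L1 nu (fun x => dot t x ^+ 2).
Proof.
under eq_fun do rewrite dot_sqrE.
by apply: L1_sum => i; apply: L1_sum => j; apply: L1Z; exact: L1_coordM.
Qed.

Lemma L1_dot t : L1 nu (dot t).
Proof. by apply: L1_sum => i; apply: L1Z; exact: L1_coord. Qed.

(** An extended integral equal to 0 forces integrability: [+oo - +oo] is [-oo] by convention, so the
    positive and the negative part both have finite integrals. *)
Lemma L1_ker_coord x i : L1 (K x) (fun y => y 0 i).
Proof.
have mE : measurable_fun setT (EFin \o (fun y : 'rV[R]_p => y 0 i)).
  by apply/measurable_EFinP; exact: measurable_coord.
apply/integrableP; split => //.
set g := EFin \o _ in mE *.
have E : (\int[K x]_y g^\+ y - \int[K x]_y g^\- y = 0)%E by rewrite -integralE; exact: K0.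
have p0 : (0 <= \int[K x]_y g^\+ y)%E by exact: integral_ge0.
have n0 : (0 <= \int[K x]_y g^\- y)%E by exact: integral_ge0.
have -> : (\int[K x]_y `|g y| = \int[K x]_y g^\+ y + \int[K x]_y g^\- y)%E.
  rewrite -ge0_integralD//; [|exact: measurable_funepos|exact: measurable_funeneg].
  by apply: eq_integral => y _; rewrite -/((abse \o g) y) fune_abse.
move: E p0 n0; case: (\int[K x]_y g^\+ y)%E => [a||]//=; case: (\int[K x]_y g^\- y)%E => [b||]//=.
by move=> _ _ _; rewrite -EFinD ltry.
Qed.

Lemma kerint_dot0 t x : kerint K (dot t) x = 0.
Proof.
rewrite /kerint (Rintegral_sumL _ (F := fun i (y : 'rV[R]_p) => t 0 i * y 0 i)); last first.
  by move=> i; apply: L1Z; exact: L1_ker_coord.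
apply: big1 => i _; rewrite RintegralZl//; last exact: L1_ker_coord.
by rewrite /Rintegral K0 mulr0.
Qed.

Lemma nu_dot0 t : \int[nu]_x dot t x = 0.
Proof.
rewrite -(Rintegral_kerint (rcd_mixture XL) (L1_dot t)).
by under eq_Rintegral do rewrite kerint_dot0; rewrite Rintegral_prob_cst.
Qed.

Lemma pred_dot0 n t w : pred X nu theta K n (dot t) w = 0.
Proof.
rewrite /pred nu_dot0 mulr0 add0r big1 ?mulr0// => i _; exact: kerint_dot0.
Qed.

Let F := past X.
Let xi t n w := dot t (X n w).

Let xi_adapted t n : adapted F n.+1 (xi t n).
Proof. by apply: (@adapted_X _ _ _ _ _ X n.+1 n (dot t)) => //; exact: measurable_dot. Qed.

Let xi_L2 t n : L1 P (fun w => xi t n w ^+ 2).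
Proof. exact: (L1_X XL n (L1_dot_sqr t)). Qed.

Let xi_mean t n Z : adapted_bounded F n Z -> \int[P]_w (Z w * xi t n w) = 0.
Proof.
move=> BZ; rewrite (Rintegral_adapted_X XL BZ (L1_dot t)).
by under eq_Rintegral do rewrite pred_dot0 mulr0; rewrite Rintegral_prob_cst.
Qed.

Lemma cvg_cos_dot t (U : Omega -> R) (c : R) : measurable_fun setT U -> (forall w, `|U w| <= 1) ->
  \int[P]_w (U w * cos (dot t ((Num.sqrt n%:R)^-1 *: \sum_(i < n) (X i w : 'rV[R]_p)) + c)) @[n --> \oo] -->
  \int[P]_w (U w * (cos c * expR (- (kerint mu (fun x => dot t x ^+ 2) w / 2)))).
Proof.
move=> mU U1.
rewrite (_ : (fun n => _) = fun n => \int[P]_w (U w * cos (psum (xi t) n w / Num.sqrt n%:R + c))).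
  apply: (@cvg_cos_stable _ _ R P F _ _ (xi t) (fun n => pred X nu theta K n (fun x => dot t x ^+ 2))) => //.
  - exact: past_measurable.
  - exact: past_mono.
  - by move=> n; apply: measurable_pred_adapted => //; apply: measurable_funX; exact: measurable_dot.
  - move=> n w; rewrite mulr_ge0 ?invr_ge0 ?addr_ge0 ?mulr_ge0//.
    + by case: XL => /ltW.
    + by case: XL => /ltW.
    + by apply: Rintegral_ge0 => x _; exact: sqr_ge0.
    + by apply: sumr_ge0 => i _; apply: Rintegral_ge0 => x _; exact: sqr_ge0.
  - by move=> n; exact: (L1_pred XL n (L1_dot_sqr t)).
  - by move=> w; apply: Rintegral_ge0 => x _; exact: sqr_ge0.
  - exact: (L1_kerint (limit_mixture XL muX) (L1_dot_sqr t)).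
  - exact: xi_mean.
  - by move=> n Z BZ; exact: (Rintegral_adapted_X XL BZ (L1_dot_sqr t)).
  - move=> j n.
    have L : L1 nu (fun x => cubic_rem (dot t x / Num.sqrt n%:R)).
      apply: (@L1_dom _ _ _ _ _ (fun x => (Num.sqrt n%:R)^-1 ^+ 2 * dot t x ^+ 2)).
      + have m1 : measurable_fun setT (fun x => dot t x / Num.sqrt n%:R).
          by apply: measurable_funM => //; exact: measurable_dot.
        by apply: measurable_minr; apply: measurable_funX => //; exact: measurableT_comp.
      + by apply: L1Z; exact: L1_dot_sqr.
      + move=> x; rewrite ger0_norm ?cubic_rem_ge0// ge_min; apply/orP; left.
        by rewrite exprMn mulrC.
    by rewrite (Rintegral_X XL j L) (Rintegral_X XL 0 L).
  - exact: (cvg_pred XL muX (L1_dot_sqr t)).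
apply/funext => n; apply: eq_Rintegral => w _; congr (_ * cos (_ + _)).
by rewrite dotZ dot_sum mulrC.
Qed.

(** The partial sums are square integrable but unbounded, so [xi_mean] does not apply to them
    directly. Truncation of [Z] at level [k] is dominated by [Z^2 + xi^2]. *)
Let xi_mean_L2 t n Z : adapted F n Z -> L1 P (fun w => Z w ^+ 2) ->
  \int[P]_w (Z w * xi t n w) = 0.
Proof.
move=> aZ LZ.
have mZ : measurable_fun setT Z := adapted_measurable (@past_measurable _ _ _ _ X) aZ.
have mxi : measurable_fun setT (xi t n) by exact: (measurableT_comp (measurable_dot t)).
pose A (k : nat) := [set w | `|Z w| <= k%:R].
pose Zk (k : nat) w := Z w * \1_(A k) w.
have BZ k : adapted_bounded F n (Zk k).
  split.
    apply: measurable_funM => //; apply: measurable_indic.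
    rewrite -[X in measurable X]setTI; apply: measurable_fun_le => //.
    exact: measurableT_comp.
  exists k%:R => w; rewrite /Zk indicE; case: (boolP (w \in A k)) => [|_].
    by rewrite inE /A/= mulr1.
  by rewrite mulr0 normr0.
have cv : \int[P]_w (Zk k w * xi t n w) @[k --> \oo] --> \int[P]_w (Z w * xi t n w).
  apply: (@cvg_Rintegral_dom _ _ _ _ _ _ (fun w => Z w ^+ 2 + xi t n w ^+ 2)).
  - move=> k; apply: measurable_funM => //.
    exact: (adapted_measurable (@past_measurable _ _ _ _ X) (BZ k).1).
  - exact: measurable_funM.
  - by apply: L1D => //; exact: xi_L2.
  - move=> k w; rewrite /Zk !normrM indicE.
    have := normr_ge0 (Z w); have := normr_ge0 (xi t n w).
    rewrite -[Z w ^+ 2]real_normK ?num_real// -[xi t n w ^+ 2]real_normK ?num_real//.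
    by move: `|Z w| `|xi t n w| => a b b0 a0; case: (_ \in _); rewrite /= ?normr1 ?normr0; nra.
  - apply: aeW => w; apply: cvg_near_cst; near=> k.
    rewrite /Zk indicE mem_set ?mulr1// /A/=.
    by near: k; exact: nbhs_infty_ger.
rewrite (_ : (fun k => _) = fun=> 0) in cv; last by apply/funext => k; exact: xi_mean.
exact/esym/(cvg_unique _ (cvg_cst _) cv).
Unshelve. all: by end_near. Qed.

(** Orthogonality of martingale differences; integrability is carried through the induction because
    the cross term needs it. *)
Let psum_sqr t n : L1 P (fun w => psum (xi t) n w ^+ 2) /\
  \int[P]_w (psum (xi t) n w ^+ 2) = n%:R * \int[nu]_x (dot t x ^+ 2).
Proof.
elim: n => [|n [Ln En]].
  have E : (fun w => psum (xi t) 0 w ^+ 2) = cst 0.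
    by apply/funext => w; rewrite /psum big_ord0 expr0n.
  by rewrite E; split; [exact: L1_cst|rewrite Rintegral_prob_cst mul0r].
have ap : adapted F n (psum (xi t) n).
  by apply: psum_adapted => //; exact: past_mono.
have mp := adapted_measurable (@past_measurable _ _ _ _ X) ap.
have Lx := L1_measurable (xi_L2 t n).
have mxi : measurable_fun setT (xi t n) by exact: (measurableT_comp (measurable_dot t)).
have Lm : L1 P (fun w => psum (xi t) n w * xi t n w).
  apply: (L1_dom _ (L1D Ln (xi_L2 t n))); first exact: measurable_funM.
  move=> w; rewrite -[psum _ _ _ ^+ 2]real_normK ?num_real// -[xi t n w ^+ 2]real_normK ?num_real//.
  rewrite normrM; have := normr_ge0 (psum (xi t) n w); have := normr_ge0 (xi t n w).
  by move: `|psum _ _ _| `|xi t n w| => a b b0 a0; nra.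
have E : (fun w => psum (xi t) n.+1 w ^+ 2) =
  (fun w => psum (xi t) n w ^+ 2 + (2 * (psum (xi t) n w * xi t n w) + xi t n w ^+ 2)).
  by apply/funext => w; rewrite /psum big_ord_recr/=; ring.
have L2 := L1D (L1Z 2 Lm) (xi_L2 t n).
rewrite E; split; first exact: L1D.
rewrite (RintegralD measurableT Ln L2) En (RintegralD measurableT (L1Z 2 Lm) (xi_L2 t n)).
rewrite (RintegralZl _ measurableT Lm) xi_mean_L2// mulr0 add0r.
by rewrite (Rintegral_X XL n (L1_dot_sqr t)) -natr1 mulrDl mul1r.
Qed.

(** The bound that stands in for tightness. For [n > 0] it is an equality; at [n = 0] the left side
    is 0. *)
Lemma scaled_sum_sqr n i :
  L1 P (fun w => ((Num.sqrt n%:R)^-1 *: \sum_(i < n) (X i w : 'rV[R]_p)) 0 i ^+ 2) /\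
  \int[P]_w (((Num.sqrt n%:R)^-1 *: \sum_(i < n) (X i w : 'rV[R]_p)) 0 i ^+ 2) <=
  \int[nu]_x (x 0 i ^+ 2).
Proof.
pose t : 'rV[R]_p := delta_mx 0 i.
have E : (fun w => ((Num.sqrt n%:R)^-1 *: \sum_(i < n) (X i w : 'rV[R]_p)) 0 i ^+ 2) =
    (fun w => n%:R^-1 * psum (xi t) n w ^+ 2).
  apply/funext => w; rewrite -dot_delta dotZ dot_sum exprMn exprVn sqr_sqrtr//.
have [Lp Ep] := psum_sqr t n.
rewrite E; split; first exact: L1Z.
rewrite (RintegralZl _ measurableT Lp) Ep.
have -> : \int[nu]_x (x 0 i ^+ 2) = \int[nu]_x (dot t x ^+ 2).
  by apply: eq_Rintegral => x _; rewrite dot_delta.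
have [->|n0] := eqVneq n 0%N.
  by rewrite invr0 mul0r; apply: Rintegral_ge0 => x _; exact: sqr_ge0.
by rewrite mulrA mulVf ?mul1r ?pnatr_eq0.
Qed.

Lemma ae_L1_coordM : {ae P, forall w, forall i j, L1 (mu w) (fun x => x 0 i * x 0 j)}.
Proof.
apply: filter_forall => i; apply: filter_forall => j.
exact: (ae_ker_L1 (limit_mixture XL muX) (L1_coordM i j)).
Qed.

End DirectionalCLT.

(** * Gaussian laws *)

Section Density.
Context {d : measure_display} {T : measurableType d} {R : realType}.
Variables (lam nu : {measure set T -> \bar R}) (g : T -> R).
Hypothesis g0 : forall x, 0 <= g x.
Hypothesis mg : measurable_fun setT g.
Hypothesis density : forall A, measurable A -> (nu A = \int[lam]_(x in A) (g x)%:E)%E.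

Import HBNNSimple.

Lemma ge0_integral_density (h : T -> \bar R) : measurable_fun setT h ->
  (forall x, 0 <= h x)%E -> (\int[nu]_x h x = \int[lam]_x (h x * (g x)%:E))%E.
Proof.
move=> mh h0.
have mgE : measurable_fun setT (EFin \o g) by exact/measurable_EFinP.
pose s := nnsfun_approx measurableT mh.
pose sE := fun n => EFin \o s n.
have msE n : measurable_fun [set: T] (sE n) by exact/measurable_EFinP.
have sE_ge0 n x : (0 <= sE n x)%E by rewrite lee_fin.
have nd_sE x : {homo sE ^~ x : n m / (n <= m)%O >-> (n <= m)%E}.
  by move=> *; exact/lefP/nd_nnsfun_approx.
have simple n : (\int[nu]_x sE n x = \int[lam]_x (sE n x * (g x)%:E))%E.
  rewrite integralT_nnsfun sintegralE.
  transitivity (\int[lam]_x (\sum_(y \in range (s n)) (y%:E * (\1_(s n @^-1` [set y]) x * g x)%:E)))%E.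
    rewrite ge0_integral_fsum//; last 2 first.
    - move=> y; apply: measurable_funeM; apply/measurable_EFinP.
      by apply: measurable_funM => //; exact: measurable_indic.
    - move=> y x _; rewrite EFinM muleA; apply: mule_ge0; last by rewrite lee_fin.
      exact: nnfun_muleindic_ge0.
    apply: eq_fsbigr => y /set_mem[x _ yE].
    have y0 : 0 <= y by rewrite -yE.
    rewrite ge0_integralZl//; last 2 first.
    - by apply/measurable_EFinP; apply: measurable_funM => //; exact: measurable_indic.
    - by move=> z _; rewrite lee_fin mulr_ge0.
    have my : measurable (s n @^-1` [set y]) by exact: measurable_sfunP.
    have -> := congr1 (fun z => y%:E * z)%E (density my : _ = _).
    rewrite integral_mkcond; congr (_ * _)%E; apply: eq_integral => z _.
    by rewrite patchE indicE; case: (z \in _); rewrite ?mul1r ?mul0r.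
  apply: eq_integral => x _.
  rewrite /sE /= [in RHS](fimfunE (s n) x) -fsumEFin// ge0_mule_fsuml//.
  - by apply: eq_fsbigr => y _; rewrite !EFinM muleA.
  - by move=> y; rewrite EFinM; exact: nnfun_muleindic_ge0.
transitivity (limn (fun n => \int[nu]_x sE n x)%E).
  rewrite -monotone_convergence//; apply: eq_integral => t _.
  by apply/esym/cvg_lim => //; exact: cvg_nnsfun_approx.
transitivity (limn (fun n => \int[lam]_x (sE n x * (g x)%:E))%E).
  by apply: congr_lim; apply/funext.
rewrite -monotone_convergence//; last 3 first.
- by move=> n; exact: emeasurable_funM.
- by move=> n x _; rewrite mule_ge0// lee_fin.
- by move=> x _ m n mn; apply: lee_wpmul2r; [rewrite lee_fin|exact: nd_sE].
apply: eq_integral => x _; apply/cvg_lim => //.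
by apply: cvgeZr => //; exact: cvg_nnsfun_approx.
Qed.

End Density.

(** * Affine change of variables for Lebesgue measure *)

Section Affine.
Context {R : realType}.
Notation leb := (@lebesgue_measure R).
Notation RR := (measurableTypeR R).

Definition affine (s m x : R) : R := s * x + m.

Lemma measurable_affine s m : @measurable_fun _ _ RR RR setT (affine s m).
Proof. by apply: measurable_funD => //; exact: measurable_funM. Qed.

(** For [s < 0] the preimage is closed on the left and open on the right, hence the existential
    interval. *)
Lemma affine_preimage_itv (s m a b : R) : s != 0 ->
  exists i : interval R, affine s m @^-1` `]a, b] = [set` i] /\
   (leb [set` i] = (`|s|^-1)%:E * leb `]a, b]%classic)%E.
Proof.
move=> s0; have [s_gt0|s_lt0] := ltP 0 s.
  exists `](a - m) / s, (b - m) / s]; split.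
    apply/seteqP; split => x /=; rewrite !in_itv/= /affine.
      by rewrite ltr_pdivrMr// ler_pdivlMr// mulrC ltrBlDr lerBrDr.
    by rewrite ltr_pdivrMr// ler_pdivlMr// (mulrC x) ltrBlDr lerBrDr.
  rewrite (gtr0_norm s_gt0) !lebesgue_measure_itv/= !lte_fin ltr_pM2r ?invr_gt0// ltrD2r.
  case: ifPn => _; last by rewrite mule0.
  by rewrite -!EFinB -EFinM; congr EFin; field.
have {}s_lt0 : s < 0 by rewrite lt_neqAle s0.
exists `[(b - m) / s, (a - m) / s[; split.
  apply/seteqP; split => x /=; rewrite !in_itv/= /affine.
    by rewrite ler_ndivrMr// ltr_ndivlMr// mulrC ltrBlDr lerBrDr andbC.
  by rewrite ler_ndivrMr// ltr_ndivlMr// (mulrC x) ltrBlDr lerBrDr andbC.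
rewrite (ltr0_norm s_lt0) !lebesgue_measure_itv/= !lte_fin ltr_nM2r ?invr_lt0// ltrD2r.
case: ifPn => _; last by rewrite mule0.
by rewrite -!EFinB -EFinM; congr EFin; field.
Qed.

Definition affine_image (s m : R) : {measure set RR -> \bar R} :=
  measure_function_pushforward__canonical__measure_function_Measure leb (measurable_affine s m).

(** Both sides agree on half-open intervals, which determine Lebesgue measure. *)
Lemma lebesgue_measure_affine (s m : R) A : s != 0 -> measurable A ->
  leb A = mscale (NngNum (normr_ge0 s)) (affine_image s m) A.
Proof.
move=> s0; apply: lebesgue_measure_unique => _ [[a b] _ <-]/=.
have [i [iE iL]] := affine_preimage_itv m a b s0.
rewrite /mscale/= /pushforward iE iL muleA -EFinM mulfV ?mul1e//.
by rewrite normr_eq0.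
Qed.

Lemma ge0_integral_affine (s m : R) (f : R -> \bar R) : s != 0 -> measurable_fun setT f ->
  (forall x, 0 <= f x)%E ->
  (\int[leb]_x f x = `|s|%:E * \int[leb]_x f (s * x + m)%R)%E.
Proof.
move=> s0 mf f0.
rewrite (eq_measure_integral (mscale (NngNum (normr_ge0 s)) (affine_image s m))); last first.
  by move=> A mA _; exact: lebesgue_measure_affine.
rewrite ge0_integral_mscale//=; congr (_ * _)%E.
by rewrite ge0_integral_pushforward//; exact: measurable_affine.
Qed.

End Affine.

(** * The standard normal law: scaling and convolution *)

Section StandardNormal.
Context {R : realType}.
Notation leb := (@lebesgue_measure R).
Notation RR := (measurableTypeR R).

Lemma measurable_idRR : measurable_fun (setT : set RR) (fun x : RR => (x : R)).
Proof. by move=> _ A mA; rewrite setTI. Qed.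

(* The library's normal law lives on the type [measurableTypeR R]. *)
Definition std_normal : probability R R :=
  distribution (normal_prob 0 1 : probability RR R) (mfun_Sub (mem_set measurable_idRR)).

Definition std_pdf (x : R) : R := normal_peak 1 * expR (- (x ^+ 2 / 2)).

Lemma std_pdfE : normal_pdf 0 1 = std_pdf.
Proof.
apply/funext => x; rewrite normal_pdfE ?oner_eq0//; congr (_ * expR _).
by rewrite subr0 expr1n mulNr.
Qed.

Lemma std_pdf_ge0 x : 0 <= std_pdf x.
Proof. by rewrite -std_pdfE normal_pdf_ge0. Qed.

Lemma measurable_std_pdf : measurable_fun setT std_pdf.
Proof. by rewrite -std_pdfE; exact: measurable_normal_pdf. Qed.

Lemma integral_std_pdf : (\int[leb]_x (std_pdf x)%:E = 1)%E.
Proof. by rewrite -std_pdfE integral_normal_pdf. Qed.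

Lemma ge0_integral_std (h : R -> \bar R) : measurable_fun setT h -> (forall x, 0 <= h x)%E ->
  (\int[std_normal]_x h x = \int[leb]_x (h x * (std_pdf x)%:E))%E.
Proof.
move=> mh h0; rewrite /std_normal ge0_integral_distribution//.
apply: (@ge0_integral_density _ RR R leb (normal_prob 0 1) std_pdf std_pdf_ge0) => //.
  exact: measurable_std_pdf.
by move=> A mA; rewrite -std_pdfE.
Qed.

Lemma std_normalE (B : set R) : measurable B ->
  (std_normal B = \int[leb]_x (\1_B x * std_pdf x)%:E)%E.
Proof.
move=> mB; have := @ge0_integral_std (EFin \o \1_B).
rewrite integral_indic// setIT => ->//; last by move=> x; rewrite lee_fin.
by apply/measurable_EFinP; exact: measurable_indic.
Qed.

Lemma measurable_scale_preimage (s : R) (B : set R) : measurable B ->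
  measurable ((fun x : R => s * x) @^-1` B).
Proof.
by move=> mB; rewrite -[X in measurable X]setTI; apply: (measurable_funM (f := cst s)).
Qed.

Lemma std_normal_scale (s : R) (B : set R) : measurable B ->
  std_normal ((fun x : R => s * x) @^-1` B) = normal_law 0 s B.
Proof.
move=> mB; rewrite /normal_law; case: ifPn => [/eqP ->|s0].
  rewrite diracE; have [B0|B0] := boolP (0 \in B).
    rewrite (_ : _ @^-1` B = setT) ?probability_setT//; apply/seteqP; split => // x _ /=.
    by rewrite mul0r; exact: set_mem.
  rewrite (_ : _ @^-1` B = set0) ?measure0//; apply/seteqP; split => // x /=.
  by rewrite mul0r => H; rewrite mem_set in B0.
rewrite std_normalE; last exact: measurable_scale_preimage.
rewrite /normal_prob [RHS]integral_mkcond.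
have mpdf : measurable_fun setT ((fun x => (normal_pdf 0 s x)%:E) \_ B).
  apply/(measurable_restrictT _ _).1 => //.
  by apply/measurable_EFinP; apply: measurable_funTS; exact: measurable_normal_pdf.
rewrite [RHS](ge0_integral_affine 0 s0); last 2 first.
- exact: mpdf.
- by move=> x; rewrite patchE; case: ifP => // _; rewrite lee_fin normal_pdf_ge0.
rewrite -ge0_integralZl//; last 2 first.
- exact: (measurableT_comp mpdf (measurable_affine s 0)).
- by move=> x _; rewrite patchE; case: ifP => // _; rewrite lee_fin normal_pdf_ge0.
apply: eq_integral => x _; rewrite addr0 patchE indicE.
have -> : (x \in (fun x : R => s * x) @^-1` B) = (s * x \in B).
  by apply/idP/idP; rewrite !inE.
case: (s * x \in B); last by rewrite mul0r mule0.
rewrite mul1r -EFinM; congr EFin; rewrite normal_pdfE// mulrA /std_pdf; congr (_ * expR _).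
  rewrite /normal_peak expr1n mul1r -[in RHS]mulrnAr sqrtrM ?sqr_ge0// sqrtr_sqr.
  by rewrite invfM mulrA mulfV ?normr_eq0// mul1r.
by rewrite subr0; field.
Qed.

Lemma std_normal_sym (s : R) (B : set R) : measurable B ->
  std_normal ((fun x : R => s * x) @^-1` B) = std_normal ((fun x : R => `|s| * x) @^-1` B).
Proof.
have [->|s0] := eqVneq s 0; first by rewrite normr0.
move=> mB; rewrite (std_normal_scale s mB) (std_normal_scale `|s| mB) /normal_law.
rewrite normr_eq0 (negbTE s0).
apply: eq_integral => x _; rewrite /normal_pdf normr_eq0 (negbTE s0).
by rewrite /normal_peak /normal_fun real_normK ?num_real.
Qed.

(** Completion of the square in [x]. With [c = sqrt (a^2 + b^2)], the joint density of [x] and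
    [z = a x + b y] factors, up to constants, into the density of [z] with variance [c^2] and the
    conditional density of [x] given [z]. *)
Lemma std_pdf_conv (a b z x : R) : b != 0 ->
  std_pdf x * std_pdf (b^-1 * z + - (a * x / b)) =
  std_pdf ((Num.sqrt (a ^+ 2 + b ^+ 2))^-1 * z) *
  std_pdf (Num.sqrt (a ^+ 2 + b ^+ 2) / b * x + - (a * z / (b * Num.sqrt (a ^+ 2 + b ^+ 2)))).
Proof.
move=> b0; set c := Num.sqrt _.
have ab : 0 < a ^+ 2 + b ^+ 2 by rewrite ltr_wpDl ?sqr_ge0// exprn_even_gt0.
have c0 : c != 0 by rewrite gt_eqF// sqrtr_gt0.
have cc : a ^+ 2 = c ^+ 2 - b ^+ 2 by rewrite sqr_sqrtr ?(ltW ab)// addrK.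
rewrite /std_pdf mulrACA [RHS]mulrACA -!expRD; congr (_ * expR _).
have : a ^+ 2 - (c ^+ 2 - b ^+ 2) = 0 by rewrite cc subrr.
move=> E; apply/eqP; rewrite -subr_eq0; apply/eqP.
(* [field] cannot use [c^2 = a^2 + b^2], so the difference of the exponents is displayed as a
   multiple of an expression known to vanish. *)
transitivity ((a ^+ 2 - (c ^+ 2 - b ^+ 2)) * (z ^+ 2 / (2 * c ^+ 2 * b ^+ 2) - x ^+ 2 / (2 * b ^+ 2))).
  by field; rewrite b0 c0.
by rewrite E mul0r.
Qed.

Lemma integral_affine_pdf (s m : R) : s != 0 ->
  (\int[leb]_x (std_pdf (s * x + m))%:E = (`|s|^-1)%:E)%E.
Proof.
move=> s0; have := ge0_integral_affine m s0 (f := EFin \o std_pdf).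
rewrite integral_std_pdf => /(_ _ _)/esym H.
have mp : measurable_fun setT (EFin \o std_pdf) by apply/measurable_EFinP; exact: measurable_std_pdf.
have ge x : (0 <= (EFin \o std_pdf) x)%E by rewrite lee_fin std_pdf_ge0.
move: (H mp ge) => {}H.
have s1 : 0 < `|s| by rewrite normr_gt0.
have := congr1 (fun z => (`|s|^-1)%:E * z)%E H.
by rewrite mule1 muleA -EFinM mulVf ?gt_eqF// mul1e.
Qed.

(** For [b = 0] there is no density in [y] to substitute into. Otherwise substitute
    [y = (z - a x) / b], exchange the integrals and apply [std_pdf_conv]; integrating out [x] yields
    [|b| / c], which leaves the Jacobian [1 / c] of [z = c y]. *)
Lemma std_normal_conv (a b : R) (B : set R) : measurable B ->
  (\int[std_normal]_x std_normal ((fun y : R => a * x + b * y)%R @^-1` B) =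
   std_normal ((fun y : R => Num.sqrt (a ^+ 2 + b ^+ 2) * y)%R @^-1` B))%E.
Proof.
move=> mB; have [->|b0] := eqVneq b 0.
  rewrite expr0n/= addr0 sqrtr_sqr -(std_normal_sym a mB).
  have -> : std_normal ((fun x : R => a * x) @^-1` B) =
      (\int[std_normal]_x (\1_((fun x : R => a * x) @^-1` B) x)%:E)%E.
    by rewrite integral_indic ?setIT//; exact: measurable_scale_preimage.
  apply: eq_integral => x _; rewrite indicE.
  have [xB|xB] := boolP (x \in _).
    rewrite (_ : _ @^-1` B = setT) ?probability_setT//; apply/seteqP; split => // y _ /=.
    by rewrite mul0r addr0; exact: set_mem xB.
  rewrite (_ : _ @^-1` B = set0) ?measure0//; apply/seteqP; split => // y /=.
  by rewrite mul0r addr0 => H; rewrite mem_set in xB.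
set c := Num.sqrt _.
have ab : 0 < a ^+ 2 + b ^+ 2 by rewrite ltr_wpDl ?sqr_ge0// exprn_even_gt0.
have c_gt0 : 0 < c by rewrite sqrtr_gt0.
have c0 : c != 0 by rewrite gt_eqF.
have mind : measurable_fun setT (\1_B : R -> R) by exact: measurable_indic.
have mphi := @measurable_std_pdf.
have phi0 := std_pdf_ge0.
have ind0 (x : R) : 0 <= \1_B x :> R by [].
pose G (x z : R) : R := `|b^-1| * (\1_B z * (std_pdf x * std_pdf (b^-1 * z + - (a * x / b)))).
have G0 x z : 0 <= G x z.
  by apply: mulr_ge0 => //; apply: mulr_ge0 => //; exact: mulr_ge0.
have inner (x : R) : (std_normal ((fun y : R => a * x + b * y)%R @^-1` B) * (std_pdf x)%:E =
    \int[leb]_z (G x z)%:E)%E.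
  have mab : measurable_fun setT (fun y : R => a * x + b * y).
    by apply: measurable_funD => //; exact: measurable_funM.
  have mpre : measurable ((fun y : R => a * x + b * y) @^-1` B).
    by rewrite -[X in measurable X]setTI; exact: mab.
  rewrite (std_normalE mpre).
  have mf : measurable_fun setT (fun y : R => \1_((fun y : R => a * x + b * y)%R @^-1` B) y * std_pdf y).
    by apply: measurable_funM => //; exact: measurable_indic.
  rewrite (ge0_integral_affine (- (a * x / b)) (invr_neq0 b0)); last 2 first.
  - exact/measurable_EFinP.
  - by move=> y; rewrite lee_fin mulr_ge0.
  have mf' := measurableT_comp mf (measurable_affine b^-1 (- (a * x / b))).
  rewrite muleAC -EFinM -ge0_integralZl//;
    [|by apply/measurable_EFinP; exact: mf'|by move=> z _; rewrite lee_fin mulr_ge0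
     |by rewrite lee_fin mulr_ge0].
  apply: eq_integral => z _; rewrite -EFinM; congr EFin; rewrite /G !indicE.
  have -> : (b^-1 * z + - (a * x / b) \in (fun y : R => a * x + b * y) @^-1` B) = (z \in B).
    have E : a * x + b * (b^-1 * z + - (a * x / b)) = z by field.
    by apply/idP/idP; rewrite !inE /= E.
  by ring.
rewrite ge0_integral_std; last 2 first.
- have mA : measurable [set xy : RR * RR | B (a * xy.1 + b * xy.2)].
    rewrite -[X in measurable X]setTI.
    suff : measurable_fun setT (fun xy : RR * RR => a * xy.1 + b * xy.2) by apply.
    by apply: measurable_funD; apply: measurable_funM.
  rewrite (_ : (fun x => _) = std_normal \o xsection [set xy : RR * RR | B (a * xy.1 + b * xy.2)]).
    exact: measurable_fun_xsection.
  by apply/funext => x /=; congr (std_normal _); apply/seteqP; split => y; rewrite /xsection/= inE.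
- by move=> x; exact: measure_ge0.
under eq_integral do rewrite inner.
rewrite (@fubini_tonelli _ _ RR RR R leb leb (fun xz => (G xz.1 xz.2)%:E)); last 2 first.
- apply/measurable_EFinP; apply: measurable_funM => //; apply: measurable_funM.
    exact: (measurableT_comp mind).
  apply: measurable_funM; first exact: (measurableT_comp mphi).
  apply: (measurableT_comp mphi); apply: measurable_funD; first exact: measurable_funM.
  by apply: measurableT_comp => //; apply: measurable_funM => //; exact: measurable_funM.
- by move=> xz; rewrite lee_fin.
rewrite std_normalE; last exact: measurable_scale_preimage.
rewrite [RHS](ge0_integral_affine 0 (invr_neq0 c0)); last 2 first.
- apply/measurable_EFinP; apply: measurable_funM => //; apply: measurable_indic.
  exact: measurable_scale_preimage.
- by move=> y; rewrite lee_fin mulr_ge0.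
have mcs : measurable_fun setT (fun z : R => \1_((fun y : R => c * y) @^-1` B) z * std_pdf z).
  apply: measurable_funM => //; apply: measurable_indic; exact: measurable_scale_preimage.
rewrite -ge0_integralZl//; [|by apply/measurable_EFinP; exact: (measurableT_comp mcs (measurable_affine c^-1 0))
  |by move=> z _; rewrite lee_fin mulr_ge0].
apply: eq_integral => z _; rewrite addr0 !indicE.
have -> : (c^-1 * z \in (fun y : R => c * y) @^-1` B) = (z \in B).
  by apply/idP/idP; rewrite !inE /= mulVKf.
transitivity ((`|b^-1| * (\1_B z * std_pdf (c^-1 * z)))%:E *
   \int[leb]_x (std_pdf (c / b * x + - (a * z / (b * c))))%:E)%E.
  rewrite -ge0_integralZl//;
    [|apply/measurable_EFinP; exact: (measurableT_comp mphi (measurable_affine (c / b) (- (a * z / (b * c)))))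
     |by move=> x _; rewrite lee_fin|by rewrite lee_fin; apply: mulr_ge0 => //; exact: mulr_ge0].
  apply: eq_integral => x _; rewrite -EFinM /G std_pdf_conv//; congr EFin; ring.
rewrite integral_affine_pdf ?mulf_neq0 ?invr_neq0//.
rewrite -!EFinM indicE; congr EFin.
rewrite normrM !normfV (gtr0_norm c_gt0).
by field; rewrite c0 normr_eq0.
Qed.

End StandardNormal.

Section PProbabilityValued.
Context {d d' : measure_display} {T : measurableType d} {S : measurableType d'} {R : realType}.

Lemma measurable_pprobability (k : T -> pprobability S R) :
  (forall A, measurable A -> measurable_fun setT (fun w => k w A)) -> measurable_fun setT k.
Proof.
move=> mk; apply: (measurability (@pset _ _ _ : set (set (pprobability S R)))) => //.
move=> _ [_ [r r01] [A mA <-] <-]; rewrite setTI.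
have := mk A mA measurableT `]-oo, r%:E[%classic; rewrite setTI.
by move=> /(_ (emeasurable_itv _)); congr (measurable _).
Qed.

(** The sets are sections of one measurable subset of the product, and the measure of a section
    depends measurably on the base point. *)
Lemma section_image_measurable (d2 : measure_display) (U : measurableType d2)
    (Q : probability S R) (f : T * S -> U) A : measurable_fun setT f -> measurable A ->
  measurable_fun setT (fun w => Q ((fun x => f (w, x)) @^-1` A)).
Proof.
move=> mf mA.
have mB : measurable (f @^-1` A) by rewrite -[X in measurable X]setTI; exact: mf.
rewrite (_ : (fun w => _) = Q \o xsection (f @^-1` A)); first exact: measurable_fun_xsection.
by apply/funext => w /=; congr (Q _); apply/seteqP; split => x; rewrite /xsection/= inE.
Qed.

End PProbabilityValued.

(** * Moments and characteristic function of the standard normal law *)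

Section StandardNormalMoments.
Context {R : realType}.
Notation std := (@std_normal R).

(** The product with the density is the density at [sqrt (1 + a) * x]. A negative [a] gives square
    integrability, positive ones give the variance. *)
Lemma integral_std_exp_sqr (a : R) : -1 < a ->
  (\int[std]_x (expR (- (a * x ^+ 2 / 2)))%:E = ((Num.sqrt (1 + a))^-1)%:E)%E.
Proof.
move=> a1; have a0 : 0 < 1 + a by lra.
rewrite ge0_integral_std; last 2 first.
- apply/measurable_EFinP; apply: measurableT_comp => //; apply: measurableT_comp => //.
  by apply: measurable_funM => //; apply: measurable_funM => //; exact: measurable_funX.
- by move=> x; rewrite lee_fin expR_ge0.
have s0 : Num.sqrt (1 + a) != 0 by rewrite gt_eqF// sqrtr_gt0.
rewrite -[in RHS](ger0_norm (sqrtr_ge0 (1 + a))) -(integral_affine_pdf 0 s0).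
apply: eq_integral => x _; rewrite -EFinM; congr EFin.
rewrite /std_pdf addr0 mulrCA -expRD exprMn sqr_sqrtr ?(ltW a0)//; congr (_ * expR _).
by field.
Qed.

Let mexp (a : R) : measurable_fun setT (fun x : R => expR (- (a * x ^+ 2 / 2))).
Proof.
apply: measurableT_comp => //; apply: measurableT_comp => //.
by apply: measurable_funM => //; apply: measurable_funM => //; exact: measurable_funX.
Qed.

Lemma std_L2 : L1 std (fun x : R => x ^+ 2).
Proof.
(* At [a = - 1/2] the exponential is [expR (x^2 / 4)], still integrable, and
   [x^2 <= 4 expR (x^2 / 4)]. *)
apply: (@L1_dom _ _ _ _ _ (fun x : R => 4 * expR (- (- 2^-1 * x ^+ 2 / 2)))).
- exact: measurable_funX.
- apply: L1Z; apply: L1_ge0; first exact: mexp.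
    by move=> x; exact: expR_ge0.
  by rewrite integral_std_exp_sqr ?ltry//; lra.
- move=> x; rewrite ger0_norm ?sqr_ge0//.
  have := expR_ge1Dx (x ^+ 2 / 4); rewrite (_ : - (- 2^-1 * x ^+ 2 / 2) = x ^+ 2 / 4); last by field.
  by move: (expR _) => e; lra.
Qed.

Lemma std_L1 : L1 std (fun x : R => x).
Proof.
apply: (@L1_dom _ _ _ _ _ (fun x : R => 1 + x ^+ 2)) => //.
  by apply: L1D; [exact: L1_cst|exact: std_L2].
by move=> x; rewrite -(real_normK (num_real x)); nra.
Qed.

Lemma Rintegral_std_odd (f : R -> R) : measurable_fun setT f -> (forall x, f (- x) = - f x) ->
  L1 std f -> \int[std]_x f x = 0.
Proof.
move=> mf fN Lf.
have E : \int[std]_x f (-1 * x) = \int[std]_x f x.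
  have mN : measurable_fun setT (fun x : R => -1 * x) by exact: measurable_funM.
  congr fine; transitivity (\int[distribution std (mfun_Sub (mem_set mN))]_x (f x)%:E)%E.
    rewrite integral_distribution//; first exact/measurable_EFinP.
    have := L1Z (-1) Lf; rewrite /L1; congr (integrable _ _ _).
    by apply/funext => x /=; rewrite !mulN1r fN.
  apply: eq_measure_integral => B mB _; transitivity (std ((fun x : R => `|-1| * x) @^-1` B)).
    exact: (std_normal_sym (-1) mB).
  by congr (std _); apply/seteqP; split => x /=; rewrite normrN1 mul1r.
have : \int[std]_x f (-1 * x) = - \int[std]_x f x.
  rewrite -[RHS]mulN1r -(RintegralZl _ measurableT Lf); apply: eq_Rintegral => x _.
  by rewrite !mulN1r fN.
by rewrite E => /eqP; rewrite eq_sym -subr_eq0 -opprD oppr_eq0 -mulr2n mulrn_eq0 => /eqP.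
Qed.

Lemma std_mean : \int[std]_x x = 0.
Proof. by apply: Rintegral_std_odd => //; exact: std_L1. Qed.

(* Differentiates [E expR (- (a * x ^+ 2 / 2)) = (1 + a)^(-1/2)] at [a = 0]. *)
Lemma std_variance : \int[std]_x (x ^+ 2) = 1.
Proof.
pose a (n : nat) : R := n.+1%:R^-1.
have a0 n : 0 < a n by rewrite invr_gt0.
have a0' : a n @[n --> \oo] --> 0 by exact: cvg_harmonic.
pose f n (x : R) := (2 / a n) * (1 - expR (- (a n * x ^+ 2 / 2))).
have mf n : measurable_fun setT (f n).
  by apply: measurable_funM => //; apply: measurable_funB => //; exact: mexp.
have y0 n (x : R) : 0 <= a n * x ^+ 2 / 2 by rewrite divr_ge0// mulr_ge0 ?sqr_ge0// ltW.
have le1 n (x : R) : expR (- (a n * x ^+ 2 / 2)) <= 1.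
  by rewrite -[leRHS]expR0 ler_expR oppr_le0.
have cv1 : \int[std]_x f n x @[n --> \oo] --> \int[std]_x (x ^+ 2).
  apply: (@cvg_Rintegral_dom _ _ _ _ _ _ (fun x : R => x ^+ 2)) => //.
  - exact: std_L2.
  - move=> n x; rewrite ger0_norm; last first.
      by rewrite mulr_ge0 ?subr_ge0// divr_ge0// ltW.
    have := expR_ge1Dx (- (a n * x ^+ 2 / 2)) => h.
    rewrite (le_trans (y := (2 / a n) * (a n * x ^+ 2 / 2)))//.
      by rewrite ler_pM2l ?divr_gt0//; lra.
    by rewrite le_eqVlt; apply/orP; left; apply/eqP; field; rewrite gt_eqF.
  - apply: aeW => x; apply/cvgrPdist_le => e e0; near=> n.
    have -> : x ^+ 2 - f n x = (2 / a n) * (expR (- (a n * x ^+ 2 / 2)) - (1 - a n * x ^+ 2 / 2)).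
      by rewrite /f; field; rewrite gt_eqF.
    rewrite normrM (gtr0_norm (_ : 0 < 2 / a n)) ?divr_gt0//.
    apply: le_trans (_ : (2 / a n) * (a n * x ^+ 2 / 2) ^+ 2 <= _).
      rewrite ler_pM2l ?divr_gt0// (le_trans (expRN_taylor (y0 n x)))//.
      by rewrite /quad_rem ge_min lexx orbT.
    have -> : 2 / a n * (a n * x ^+ 2 / 2) ^+ 2 = a n * (x ^+ 4 / 2).
      by field; rewrite gt_eqF.
    near: n.
    have : a n * (x ^+ 4 / 2) @[n --> \oo] --> 0 * (x ^+ 4 / 2) by exact: cvgMl.
    rewrite mul0r => /cvgrPdist_le/(_ e e0); apply: filterS => n.
    by rewrite sub0r normrN; apply: le_trans; exact: ler_norm.
have cv2 : \int[std]_x f n x @[n --> \oo] --> (1 : R).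
  pose r n := Num.sqrt (1 + a n).
  have Le n : L1 std (fun x : R => expR (- (a n * x ^+ 2 / 2))).
    apply: (@L1_bounded _ _ _ _ _ 1); first exact: mexp.
    by move=> x; rewrite ger0_norm ?expR_ge0.
  (* Since [a n = r n ^ 2 - 1], the factor [r n - 1] cancels and the indeterminate quotient
     disappears. *)
  have E n : \int[std]_x f n x = 2 / (r n * (r n + 1)).
    have h1 : \int[std]_x expR (- (a n * x ^+ 2 / 2)) = (r n)^-1.
      by rewrite /Rintegral integral_std_exp_sqr//; have := a0 n; lra.
    rewrite /f RintegralZl//; last by apply: L1B => //; exact: L1_cst.
    rewrite (RintegralB measurableT (L1_cst std 1) (Le n)) Rintegral_prob_cst h1.
    have r1 : 1 < r n.
      by rewrite -[ltLHS]sqrtr1 ltr_sqrt ?ltrDl ?ltr01// ltr_wpDr// ltW.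
    have -> : a n = r n ^+ 2 - 1 by rewrite sqr_sqrtr ?addrK//; [lra|rewrite addr_ge0// ltW].
    have n1 : r n - 1 != 0 by rewrite gt_eqF//; lra.
    have n2 : r n + 1 != 0 by rewrite gt_eqF//; lra.
    have n3 : r n != 0 by rewrite gt_eqF//; lra.
    have -> : r n ^+ 2 - 1 = (r n - 1) * (r n + 1) by ring.
    by field; rewrite n1 n2 n3.
  have r1 : r n @[n --> \oo] --> (1 : R).
    have : 1 + a n @[n --> \oo] --> (1 + 0 : R) by apply: cvgD => //; exact: cvg_cst.
    rewrite addr0 => h; rewrite -[X in _ --> X]sqrtr1.
    exact: (cvg_comp _ _ h (@sqrt_continuous R 1)).
  have cv3 : 2 / (r n * (r n + 1)) @[n --> \oo] --> (2 / (1 * (1 + 1)) : R).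
    apply: cvgMr; apply: cvgV; first by rewrite mul1r.
    by apply: cvgM => //; apply: cvgD => //; exact: cvg_cst.
  have E1 : 2 / (1 * (1 + 1)) = 1 :> R by rewrite mul1r divff.
  rewrite E1 in cv3; rewrite (_ : (fun n : nat => _) = fun n : nat => 2 / (r n * (r n + 1)))//.
  exact/funext.
exact: (cvg_unique _ cv1 cv2).
Unshelve. all: by end_near. Qed.

Definition std_cf (s : R) := \int[std]_x cos (s * x).

Lemma measurable_cos_affine (s c : R) : measurable_fun setT (fun x : R => cos (s * x + c)).
Proof.
apply: measurableT_comp; first exact: (continuous_measurable_fun (@continuous_cos R)).
by apply: measurable_funD => //; exact: measurable_funM.
Qed.

Lemma measurable_sin_scale (s : R) : measurable_fun setT (fun x : R => sin (s * x)).
Proof.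
apply: measurableT_comp; first exact: (continuous_measurable_fun (@continuous_sin R)).
exact: measurable_funM.
Qed.

Lemma std_cf_affine (s c : R) : \int[std]_x cos (s * x + c) = cos c * std_cf s.
Proof.
have mc : measurable_fun setT (fun x : R => cos (s * x)).
  by have := measurable_cos_affine s 0; under eq_fun do rewrite addr0.
have Lc : L1 std (fun x : R => cos (s * x)).
  by apply: (L1_bounded _ mc) => x; exact: cos_max.
have Ls : L1 std (fun x : R => sin (s * x)).
  by apply: (L1_bounded _ (measurable_sin_scale s)) => x; exact: sin_max.
under eq_Rintegral do rewrite cosD (mulrC (cos _)) (mulrC (sin _)).
rewrite (RintegralB measurableT (L1Z (cos c) Lc) (L1Z (sin c) Ls)).
rewrite (RintegralZl _ measurableT Lc) (RintegralZl _ measurableT Ls).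
rewrite (@Rintegral_std_odd (fun x => sin (s * x))) ?mulr0 ?subr0//.
  exact: measurable_sin_scale.
by move=> x; rewrite mulrN sinN.
Qed.

(** [std_normal_conv] presents the law of [c y], with [c = sqrt (a^2 + b^2)], as the mixture over
    [x] of the laws of [a x + b y]; the integral of [cos] over each of these factors by
    [std_cf_affine]. *)
Lemma std_cfM (a b : R) : std_cf a * std_cf b = std_cf (Num.sqrt (a ^+ 2 + b ^+ 2)).
Proof.
have mab : measurable_fun setT (fun xy : R * R => a * xy.1 + b * xy.2).
  by apply: measurable_funD; apply: measurable_funM.
have mb x : measurable_fun setT (fun y : R => (a * x + b * y : R)).
  by apply: measurable_funD => //; exact: measurable_funM.
pose c := Num.sqrt (a ^+ 2 + b ^+ 2).
have mc : measurable_fun setT (fun y : R => (c * y : R)) by exact: measurable_funM.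
pose k0 (x : R) : pprobability R R :=
  (distribution std (mfun_Sub (mem_set (mb x))) : probability R R).
have mk : measurable_fun setT k0.
  by apply: measurable_pprobability => A mA; exact: (section_image_measurable _ mab mA).
pose k : {mfun R >-> pprobability R R} := mfun_Sub (mem_set mk).
pose Q : probability R R := distribution std (mfun_Sub (mem_set mc)).
have kQ A : measurable A -> (Q A = \int[std]_w k w A)%E.
  by move=> mA; rewrite (std_normal_conv a b mA).
have mcos : measurable_fun setT (@cos R) := continuous_measurable_fun (@continuous_cos R).
have LQ : L1 Q (@cos R) by apply: (L1_bounded _ mcos) => x; exact: cos_max.
have imE (f : R -> R) (mf : measurable_fun setT f) :
    \int[distribution std (mfun_Sub (mem_set mf))]_x cos x = \int[std]_x cos (f x).
  congr fine; rewrite (@integral_distribution _ _ _ _ _ std (mfun_Sub (mem_set mf)) (EFin \o cos))//.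
    exact/measurable_EFinP.
  apply: (L1_bounded _ (measurableT_comp mcos mf)) => x; exact: cos_max.
have := Rintegral_kerint kQ LQ.
rewrite (imE _ mc) -/(std_cf c) => <-.
under eq_Rintegral do rewrite /kerint /= imE.
under eq_Rintegral do under eq_Rintegral do rewrite addrC.
under eq_Rintegral do rewrite std_cf_affine mulrC.
rewrite RintegralZl//; first by rewrite mulrC.
have mca : measurable_fun setT (fun x : R => cos (a * x)).
  by have := measurable_cos_affine a 0; under eq_fun do rewrite addr0.
by apply: (L1_bounded _ mca) => x; exact: cos_max.
Qed.

(* The convolution rule gives [std_cf (sqrt n * h) = std_cf h ^+ n]; let [h = s / sqrt n]. *)
Lemma std_cfE (s : R) : std_cf s = expR (- (s ^+ 2 / 2)).
Proof.
wlog s0 : s / 0 <= s => [H|].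
  have [|s0] := leP 0 s; first exact: H.
  have -> : std_cf s = std_cf (- s) by apply: eq_Rintegral => x _; rewrite mulNr cosN.
  by rewrite H ?sqrrN// oppr_ge0 ltW.
have pow (h : R) n : 0 <= h -> std_cf (Num.sqrt n%:R * h) = std_cf h ^+ n.
  move=> h0; elim: n => [|n ih].
    by rewrite sqrtr0 mul0r expr0 /std_cf; under eq_Rintegral do rewrite mul0r cos0; rewrite Rintegral_prob_cst.
  rewrite exprSr -ih std_cfM; congr std_cf.
  rewrite exprMn sqr_sqrtr// -[X in _ + X]mul1r -mulrDl natr1 sqrtrM//.
  by rewrite sqrtr_sqr ger0_norm.
have mcub (a : R) : measurable_fun setT (fun x : R => cubic_rem (a * x)).
  have m1 : measurable_fun setT (fun x : R => a * x) by exact: measurable_funM.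
  by apply: measurable_minr; apply: measurable_funX => //; exact: measurableT_comp.
have Lcub (a : R) : L1 std (fun x : R => cubic_rem (a * x)).
  apply: (@L1_dom _ _ _ _ _ (fun x : R => a ^+ 2 * x ^+ 2)) => //.
    by apply: L1Z; exact: std_L2.
  by move=> x; rewrite ger0_norm ?cubic_rem_ge0// ge_min exprMn lexx.
have cf1 (h : R) : `|std_cf h - (1 - h ^+ 2 / 2)| <= \int[std]_x cubic_rem (h * x).
  have L2 : L1 std (fun x : R => h ^+ 2 / 2 * x ^+ 2) by apply: L1Z; exact: std_L2.
  have mc : measurable_fun setT (fun x : R => cos (h * x)).
    by have := measurable_cos_affine h 0; under eq_fun do rewrite addr0.
  have Lc : L1 std (fun x : R => cos (h * x)).
    by apply: (L1_bounded _ mc) => x; exact: cos_max.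
  have -> : 1 - h ^+ 2 / 2 = \int[std]_x (1 - h ^+ 2 / 2 * x ^+ 2).
    rewrite (RintegralB measurableT (L1_cst std 1) L2) Rintegral_prob_cst.
    by rewrite (RintegralZl _ measurableT std_L2) std_variance mulr1.
  have Lp := L1B (L1_cst std 1) L2.
  rewrite -(RintegralB measurableT Lc Lp); apply: Rintegral_norm_le => //.
    exact: L1_measurable (L1B Lc Lp).
  by move=> x; rewrite mulrAC -exprMn; exact: cos_sub_le.
have b1 (h : R) : `|std_cf h| <= 1.
  have mc : measurable_fun setT (fun x : R => cos (h * x)).
    by have := measurable_cos_affine h 0; under eq_fun do rewrite addr0.
  by apply: Rintegral_bounded => // x; exact: cos_max.
have b2 (h : R) : `|expR (- (h ^+ 2 / 2))| <= 1.
  by rewrite ger0_norm ?expR_ge0// -[leRHS]expR0 ler_expR oppr_le0 divr_ge0// sqr_ge0.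
(* Both [std_cf h] and [expR (- (h^2 / 2))] are compared with [1 - h^2 / 2]; passing to [n]-th
   powers costs the factor [n] of [exprB_le]. *)
have main n : (0 < n)%N -> `|std_cf s - expR (- (s ^+ 2 / 2))| <=
    n%:R * \int[std]_x cubic_rem (s * x / Num.sqrt n%:R) + n%:R * quad_rem (s ^+ 2 / (2 * n%:R)).
  move=> n0; have nR : 0 < n%:R :> R by rewrite ltr0n.
  have sn : 0 < Num.sqrt n%:R :> R by rewrite sqrtr_gt0.
  pose h := s / Num.sqrt n%:R.
  have h0 : 0 <= h by rewrite divr_ge0// ltW.
  have hs : Num.sqrt n%:R * h = s by rewrite mulrC divfK// gt_eqF.
  have h2 : h ^+ 2 = s ^+ 2 / n%:R by rewrite expr_div_n sqr_sqrtr// ltW.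
  have -> : expR (- (s ^+ 2 / 2)) = expR (- (h ^+ 2 / 2)) ^+ n.
    by rewrite -expRM_natl h2; congr expR; field; rewrite gt_eqF.
  rewrite -{1}hs pow// (le_trans (exprB_le _ (b1 h) (b2 h)))// -mulrDr ler_pM2l//.
  have -> : std_cf h - expR (- (h ^+ 2 / 2)) = (std_cf h - (1 - h ^+ 2 / 2)) -
    (expR (- (h ^+ 2 / 2)) - (1 - h ^+ 2 / 2)) by ring.
  rewrite (le_trans (ler_normB _ _))// lerD//.
    rewrite (le_trans (cf1 h))// le_eqVlt; apply/orP; left; apply/eqP.
    by apply: eq_Rintegral => x _; congr cubic_rem; rewrite /h mulrAC.
  have -> : s ^+ 2 / (2 * n%:R) = h ^+ 2 / 2 by rewrite h2; field; rewrite gt_eqF.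
  by apply: expRN_taylor; rewrite divr_ge0// sqr_ge0.
have c1 : n%:R * \int[std]_x cubic_rem (s * x / Num.sqrt n%:R) @[n --> \oo] --> 0.
  have E n : n%:R * \int[std]_x cubic_rem (s * x / Num.sqrt n%:R) =
      \int[std]_x (n%:R * cubic_rem (s * x / Num.sqrt n%:R)).
    rewrite RintegralZl//; have := Lcub (s / Num.sqrt n%:R).
    by under eq_fun do rewrite mulrAC.
  rewrite (_ : (fun n : nat => _) = fun n : nat =>
    \int[std]_x (n%:R * cubic_rem (s * x / Num.sqrt n%:R))); last exact/funext.
  rewrite -[X in _ --> X](Rintegral_prob_cst std 0).
  apply: (@cvg_Rintegral_dom _ _ _ _ _ _ (fun x : R => (s * x) ^+ 2)) => //.
  - move=> n; apply: measurable_funM => //.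
    by have := mcub (s / Num.sqrt n%:R); under eq_fun do rewrite mulrAC.
  - by under eq_fun do rewrite exprMn; apply: L1Z; exact: std_L2.
  - by move=> n x; rewrite ger0_norm ?mulr_ge0 ?cubic_rem_ge0//; exact: cubic_rem_scale_le.
  - by apply: aeW => x; exact: cubic_rem_scale_cvg0.
have c2 := @quad_rem_scale_cvg0 R (s ^+ 2) (sqr_ge0 s).
apply/eqP; rewrite -subr_eq0 -normr_le0; apply/ler_addgt0Pr => e e0; rewrite add0r.
have e2 : 0 < e / 2 by rewrite divr_gt0.
near \oo => n.
have n0 : (0 < n)%N by near: n; exact: nbhs_infty_gt.
apply: le_trans (main n n0) _; rewrite [leRHS]splitr lerD//.
  rewrite (le_trans (ler_norm _))// -normrN -sub0r.
  by near: n; move/cvgrPdist_le : c1; apply.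
rewrite (le_trans (ler_norm _))// -normrN -sub0r.
by near: n; move/cvgrPdist_le : c2; apply.
Unshelve. all: by end_near. Qed.

End StandardNormalMoments.

(** * Cholesky factorization of semidefinite matrices *)

Section Cholesky.
Context {R : realType} {p : nat}.
Implicit Types (S : 'M[R]_p) (t x : 'rV[R]_p) (k i j : 'I_p) (s : seq 'I_p).

Definition quad_form S t : R := \sum_i \sum_j t 0 i * t 0 j * S i j.

Definition psd S := (forall i j, S i j = S j i) /\ forall t, 0 <= quad_form S t.

(* If [S k k = 0] and [S] is positive semidefinite, then column [k] of [S] is zero, and [x / 0 = 0]
   makes elimination with pivot [k] do nothing. *)
Definition pivot_step k S : 'M[R]_p := \matrix_(i, j) (S i j - S i k * S j k / S k k).

(** A column of the Cholesky factor, written as a row; it is 0 when the pivot vanishes. *)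
Definition pivot_row k S : 'rV[R]_p := \row_i (S i k / Num.sqrt (S k k)).

Fixpoint chol_map s S x : 'rV[R]_p :=
  if s is k :: s' then x 0 k *: pivot_row k S + chol_map s' (pivot_step k S) x else 0.

(** The adjoint of [chol_map s S] for [dot]. The variance of a linear form [t] of the Gaussian
    vector is the squared length of this row. *)
Fixpoint chol_coef s S t : 'rV[R]_p :=
  if s is k :: s' then dot t (pivot_row k S) *: delta_mx 0 k + chol_coef s' (pivot_step k S) t
  else 0.

Lemma dotC t x : dot t x = dot x t.
Proof. by apply: eq_bigr => i _; rewrite mulrC. Qed.

Lemma dot_chol_map s S t x : dot t (chol_map s S x) = dot (chol_coef s S t) x.
Proof.
elim: s S => [|k s ih] S /=; first by rewrite dot0 dotC dot0.
by rewrite dotD dotDl dotZ ih (dotC (_ *: _)) dotZ [dot x _]dotC dot_delta mulrC.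
Qed.

Lemma chol_coef_notin s S t i : i \notin s -> chol_coef s S t 0 i = 0.
Proof.
elim: s S => [|k s ih] S /=; first by rewrite mxE.
rewrite inE negb_or => /andP[ik is_]; rewrite !mxE ih// (negbTE ik) andbF.
by rewrite mulr0 addr0.
Qed.

Lemma quad_formE S t : quad_form S t = dot t (t *m S).
Proof.
rewrite /quad_form exchange_big; apply: eq_bigr => j _; rewrite mxE big_distrr/=.
by apply: eq_bigr => i _; ring.
Qed.

Lemma quad_form_delta S (a : R) t k : (forall i j, S i j = S j i) ->
  quad_form S (t + a *: delta_mx 0 k) =
  quad_form S t + 2 * a * (\sum_i t 0 i * S i k) + a ^+ 2 * S k k.
Proof.
move=> sym; rewrite !quad_formE mulmxDl -scalemxAl -rowE dotD !dotDl !dotZ.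
rewrite ![dot (a *: _) _]dotC !dotZ ![dot _ (delta_mx 0 k)]dotC !dot_delta !mxE.
have -> : dot t (row k S) = \sum_i t 0 i * S i k.
  by apply: eq_bigr => i _; rewrite mxE sym.
by ring.
Qed.

Lemma quad_form_unit S k : quad_form S (delta_mx 0 k) = S k k.
Proof. by rewrite quad_formE dot_delta -rowE mxE. Qed.

Lemma psd_diag S k : psd S -> 0 <= S k k.
Proof. by move=> [sym S0]; rewrite -quad_form_unit. Qed.

Lemma quad_form_pair S i k (a : R) : (forall i j, S i j = S j i) ->
  quad_form S (delta_mx 0 i + a *: delta_mx 0 k) = S i i + 2 * a * S i k + a ^+ 2 * S k k.
Proof.
move=> sym; rewrite quad_form_delta// quad_form_unit; congr (_ + _ * _ + _).
have := dot_delta i (\row_j S j k); rewrite mxE => <-.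
by apply: eq_bigr => j _; rewrite [in RHS]mxE.
Qed.

(** The form at [e_i + a e_k] is affine in [a] when [S k k = 0], and nonnegative, so its slope
    [2 S i k] is 0: the [a] chosen below would give the value [- S i i - 2]. *)
Lemma psd_diag0 S k i : psd S -> S k k = 0 -> S i k = 0.
Proof.
move=> pS Sk; have [sym S0] := pS.
have H (a : R) : 0 <= S i i + 2 * a * S i k.
  by have := S0 (delta_mx 0 i + a *: delta_mx 0 k); rewrite quad_form_pair// Sk mulr0 addr0.
apply/eqP; apply: contraT => n0.
have := H (- (S i i + 1) / S i k); have d0 := psd_diag i pS.
rewrite -mulrA divfK//; lra.
Qed.

Lemma pivot_step_form k S t : quad_form (pivot_step k S) t =
  quad_form S t - (\sum_i t 0 i * S i k) ^+ 2 / S k k.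
Proof.
rewrite expr2 big_distrlr/= /quad_form mulr_suml -sumrB; apply: eq_bigr => i _.
rewrite mulr_suml -sumrB; apply: eq_bigr => j _; rewrite mxE; ring.
Qed.

Lemma pivot_step_quad k S t : psd S ->
  quad_form S t = dot t (pivot_row k S) ^+ 2 + quad_form (pivot_step k S) t.
Proof.
move=> pS; rewrite pivot_step_form.
have -> : dot t (pivot_row k S) = (\sum_i t 0 i * S i k) / Num.sqrt (S k k).
  by rewrite /dot mulr_suml; apply: eq_bigr => i _; rewrite mxE mulrA.
by rewrite expr_div_n sqr_sqrtr ?psd_diag// addrC subrK.
Qed.

(** For a nonzero pivot, the form of the Schur complement at [t] is the minimum over [a] of the form
    of [S] at [t + a e_k]; the minimizing [a] is inserted. *)
Lemma psd_pivot_step k S : psd S -> psd (pivot_step k S).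
Proof.
move=> pS; have [sym S0] := pS; split.
  by move=> i j; rewrite !mxE sym mulrAC [_ * S i k]mulrC mulrAC.
move=> t; rewrite pivot_step_form; have [k0|k0] := eqVneq (S k k) 0.
  by rewrite k0 invr0 mulr0 subr0.
have := S0 (t + (- (\sum_i t 0 i * S i k) / S k k) *: delta_mx 0 k).
rewrite quad_form_delta//; set b := \sum_i _; congr (_ <= _); by field.
Qed.

(** Each pivot splits off one square by [pivot_step_quad]. The invariant is that columns outside [s]
    vanish: elimination clears column [k] if the pivot is nonzero, and [psd_diag0] shows that it was
    already 0 otherwise. *)
Lemma sum_chol_coef_sqr s S t : uniq s -> psd S ->
  (forall j, j \notin s -> forall i, S i j = 0) ->
  \sum_(k <- s) chol_coef s S t 0 k ^+ 2 = quad_form S t.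
Proof.
elim: s S => [|k s ih] S /=.
  move=> _ _ S0; rewrite big_nil /quad_form big1// => i _; rewrite big1// => j _.
  by rewrite S0 ?mulr0.
move=> /andP[ks us] pS S0; rewrite big_cons (pivot_step_quad k)//; congr (_ + _).
  by rewrite !mxE !eqxx/= mulr1 chol_coef_notin// addr0.
rewrite -ih//.
- apply: eq_big_seq => i is_; rewrite !mxE.
  by rewrite (_ : (i == k) = false) ?andbF ?mulr0 ?add0r//; apply: contraNF ks => /eqP <-.
- exact: psd_pivot_step.
- move=> j js i; rewrite mxE; have [->|jk] := eqVneq j k.
    have [k0|k0] := eqVneq (S k k) 0; last by rewrite mulfK// subrr.
    by rewrite k0 invr0 mulr0 subr0; apply: psd_diag0.
  have Sj i' : S i' j = 0 by apply: S0; rewrite inE negb_or jk.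
  by rewrite (proj1 pS j k) !Sj mulr0 mul0r subr0.
Qed.

End Cholesky.

(** * Gaussian vectors with prescribed covariance *)

Section GaussianVector.
Context {R : realType} {p : nat}.
Implicit Types (S : 'M[R]_p) (t x : 'rV[R]_p) (k i j : 'I_p) (s : seq 'I_p).
Notation std := (@std_normal R).

Lemma measurable_invr : measurable_fun [set: R] (fun x : R => x^-1).
Proof.
have -> : [set: R] = [set 0] `|` ~` [set 0] by rewrite setUv.
apply/measurable_funU => //; first exact: measurableC.
split; first exact: measurable_fun_set1.
apply: open_continuous_measurable_fun; first by rewrite openC; exact: closed_eq.
by move=> x /set_mem x0; apply: inv_continuous; apply/eqP.
Qed.

Lemma measurable_chol_map d (T : measurableType d) s (S : T -> 'M[R]_p) (x : T -> 'rV[R]_p) :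
  (forall i j, measurable_fun setT (fun w => S w i j)) -> measurable_fun setT x ->
  measurable_fun setT (fun w => chol_map s (S w) (x w)).
Proof.
move=> mS mx; apply: measurable_fun_row; elim: s S mS => [|k s ih] S mS i /=.
  by rewrite (_ : (fun w => _) = fun=> 0)//; apply/funext => w; rewrite mxE.
have minv : measurable_fun setT (fun w => (S w k k)^-1).
  exact: (measurableT_comp measurable_invr).
rewrite (_ : (fun w => _) = fun w => x w 0 k * (S w i k * (Num.sqrt (S w k k))^-1) +
    chol_map s (pivot_step k (S w)) (x w) 0 i); last by apply/funext => w; rewrite !mxE.
apply: measurable_funD.
  apply: measurable_funM; first exact: measurable_row_coord.
  apply: measurable_funM => //; apply: (measurableT_comp measurable_invr).
  exact: (measurableT_comp (continuous_measurable_fun (@sqrt_continuous R))).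
apply: ih => i' j'.
rewrite (_ : (fun w => _) = fun w => S w i' j' - S w i' k * S w j' k * (S w k k)^-1); last first.
  by apply/funext => w; rewrite mxE.
by apply: measurable_funB => //; apply: measurable_funM => //; apply: measurable_funM.
Qed.

Section Projection.
Variables (Q : probability 'rV[R]_p R) (t : 'rV[R]_p) (sg : R).
Hypothesis law : forall B, measurable B ->
  Q (dot t @^-1` B) = std ((fun y : R => sg * y) @^-1` B).

Let msg : measurable_fun setT (fun y : R => sg * y).
Proof. exact: measurable_funM. Qed.

Let D1 := distribution Q (mfun_Sub (mem_set (measurable_dot t))).
Let D2 := distribution std (mfun_Sub (mem_set msg)).

Let eD (h : R -> \bar R) : (\int[D1]_y h y = \int[D2]_y h y)%E.
Proof. by apply: eq_measure_integral => A mA _; exact: law. Qed.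

Lemma ge0_integral_dot (h : R -> \bar R) : measurable_fun setT h -> (forall y, 0 <= h y)%E ->
  (\int[Q]_x h (dot t x) = \int[std]_y h (sg * y)%R)%E.
Proof.
move=> mh h0; transitivity (\int[D1]_y h y)%E; first by rewrite ge0_integral_distribution.
by rewrite eD ge0_integral_distribution.
Qed.

Lemma L1_dot_law (f : R -> R) : measurable_fun setT f -> L1 std (fun y => f (sg * y)) ->
  L1 Q (fun x => f (dot t x)).
Proof.
move=> mf /integrableP[_ fi]; apply/integrableP; split.
  by apply/measurable_EFinP; apply: measurableT_comp => //; exact: measurable_dot.
rewrite (ge0_integral_dot (h := fun y => `|(f y)%:E|%E))//.
by apply: measurableT_comp => //; exact/measurable_EFinP.
Qed.

Lemma Rintegral_dot_law (f : R -> R) : measurable_fun setT f -> L1 std (fun y => f (sg * y)) ->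
  \int[Q]_x f (dot t x) = \int[std]_y f (sg * y).
Proof.
move=> mf L; have L' := L1_dot_law mf L; congr fine.
have mE : measurable_fun setT (EFin \o f) by exact/measurable_EFinP.
transitivity (\int[D1]_y (EFin \o f) y)%E; first by rewrite integral_distribution.
by rewrite eD integral_distribution.
Qed.

End Projection.

Let shift_coord k (z : 'rV[R]_p * R) : 'rV[R]_p := z.1 + z.2 *: delta_mx 0 k.

Lemma measurable_shift_coord k : measurable_fun setT (shift_coord k).
Proof.
apply: measurable_fun_row => i.
rewrite (_ : (fun w => _) = fun z : 'rV[R]_p * R => z.1 0 i + z.2 * (i == k)%:R); last first.
  by apply/funext => z; rewrite !mxE.
apply: measurable_funD; first by apply: measurable_row_coord; exact: measurable_fst.
by apply: measurable_funM => //; exact: measurable_snd.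
Qed.

(** For duplicate-free [s]: independent standard normal coordinates at the indices in [s] and zeros
    elsewhere. Adding one coordinate at a time makes linear forms accessible to the one-dimensional
    convolution rule. *)
Fixpoint std_vector s : probability 'rV[R]_p R :=
  if s is k :: s' then
    distribution (std_vector s' \x std)%E (mfun_Sub (mem_set (measurable_shift_coord k)))
  else \d_(0 : 'rV[R]_p).

(** Given the other coordinates, the new one adds [t_k y] to the linear form, and [std_normal_conv]
    adds [t_k^2] to its variance. *)
Lemma std_vector_dot s t (B : set R) : measurable B ->
  std_vector s (dot t @^-1` B) =
  std ((fun y : R => Num.sqrt (\sum_(k <- s) t 0 k ^+ 2) * y) @^-1` B).
Proof.
elim: s B => [|k s ih] B mB.
  rewrite big_nil sqrtr0 std_normal_scale// /normal_law eqxx /= !diracE.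
  by congr ((_ %:R)%:E); congr nat_of_bool; apply/idP/idP; rewrite !inE /= dot0.
pose h (z : R) : \bar R := std ((fun y : R => z + t 0 k * y) @^-1` B).
have mz : measurable_fun setT (fun z : R * R => z.1 + t 0 k * z.2).
  by apply: measurable_funD => //; apply: measurable_funM.
have mh : measurable_fun setT h by exact: (section_image_measurable std mz mB).
have h0 z : (0 <= h z)%E by exact: measure_ge0.
transitivity (\int[std_vector s]_x h (dot t x))%E.
  rewrite /= /pushforward /product_measure1 /=; apply: eq_integral => x _.
  congr (std _); apply/seteqP; split => y; rewrite /xsection/= inE/= /shift_coord/=.
    by rewrite dotD dotZ [dot _ (delta_mx _ _)]dotC dot_delta mulrC.
  by rewrite dotD dotZ [dot _ (delta_mx _ _)]dotC dot_delta mulrC.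
rewrite (ge0_integral_dot ih mh h0).
by rewrite std_normal_conv// sqr_sqrtr ?big_cons 1?addrC// sumr_ge0// => i _; exact: sqr_ge0.
Qed.

Lemma measurable_chol_map_cst S : measurable_fun setT (fun x => chol_map (enum 'I_p) S x).
Proof. exact: (@measurable_chol_map _ _ _ (fun=> S) id). Qed.

(** The law N(0, S) when [S] is positive semidefinite. For other [S] it is still a probability
    measure, so a random matrix that is semidefinite only almost surely can be inserted. *)
Definition gaussian S : probability 'rV[R]_p R :=
  distribution (std_vector (enum 'I_p)) (mfun_Sub (mem_set (measurable_chol_map_cst S))).

Lemma measurable_gaussian d (T : measurableType d) (S : T -> 'M[R]_p) A :
  (forall i j, measurable_fun setT (fun w => S w i j)) -> measurable A ->
  measurable_fun setT (fun w => gaussian (S w) A).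
Proof.
move=> mS mA.
have mf : measurable_fun setT (fun z : T * 'rV[R]_p => chol_map (enum 'I_p) (S z.1) z.2).
  by apply: measurable_chol_map => // i j; exact: (measurableT_comp (mS i j)).
exact: (section_image_measurable (std_vector (enum 'I_p)) mf mA).
Qed.

Section GaussianMoments.
Variable S : 'M[R]_p.
Hypothesis pS : psd S.

Lemma gaussian_dot t (B : set R) : measurable B ->
  gaussian S (dot t @^-1` B) = std ((fun y : R => Num.sqrt (quad_form S t) * y) @^-1` B).
Proof.
move=> mB; transitivity (std_vector (enum 'I_p) (dot (chol_coef (enum 'I_p) S t) @^-1` B)).
  by congr (std_vector _ _); apply/seteqP; split => x /=; rewrite dot_chol_map.
rewrite std_vector_dot// sum_chol_coef_sqr ?enum_uniq// => j.
by rewrite mem_enum.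
Qed.

Lemma gaussian_cos t (c : R) :
  \int[gaussian S]_x cos (dot t x + c) = cos c * expR (- (quad_form S t / 2)).
Proof.
rewrite (Rintegral_dot_law (gaussian_dot t) (f := fun y => cos (y + c))).
- by rewrite std_cf_affine std_cfE sqr_sqrtr// (proj2 pS).
- by have := measurable_cos_affine 1 c; under [X in measurable_fun _ X]eq_fun do rewrite mul1r.
- apply: (@L1_bounded _ _ _ _ _ 1); first exact: measurable_cos_affine.
  by move=> x; rewrite ler_norml cos_geN1 cos_le1.
Qed.

Lemma L1_gaussian_sqr t : L1 (gaussian S) (fun x => dot t x ^+ 2).
Proof.
apply: (L1_dot_law (gaussian_dot t) (f := fun y : R => y ^+ 2)); first exact: measurable_funX.
have := L1Z (quad_form S t) (@std_L2 R); rewrite /L1; congr (integrable _ _ _).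
by apply/funext => x /=; rewrite exprMn sqr_sqrtr// (proj2 pS).
Qed.

Lemma gaussian_sqr t : \int[gaussian S]_x (dot t x ^+ 2) = quad_form S t.
Proof.
have E (x : R) : (Num.sqrt (quad_form S t) * x) ^+ 2 = quad_form S t * x ^+ 2.
  by rewrite exprMn sqr_sqrtr// (proj2 pS).
have L := L1Z (quad_form S t) (@std_L2 R).
rewrite (Rintegral_dot_law (gaussian_dot t) (f := fun y : R => y ^+ 2)).
- rewrite (_ : (fun y => _) = fun y => quad_form S t * y ^+ 2); last exact/funext.
  by rewrite (RintegralZl _ measurableT (@std_L2 R)) std_variance mulr1.
- exact: measurable_funX.
- by rewrite (_ : (fun y => _) = fun y => quad_form S t * y ^+ 2)//; exact/funext.
Qed.

Lemma gaussian_mean t : \int[gaussian S]_x dot t x = 0.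
Proof.
have L := L1Z (Num.sqrt (quad_form S t)) (@std_L1 R).
rewrite (Rintegral_dot_law (gaussian_dot t) (f := fun y : R => y))//.
by rewrite (RintegralZl _ measurableT (@std_L1 R)) std_mean mulr0.
Qed.

Lemma L1_gaussian_dot t : L1 (gaussian S) (dot t).
Proof.
exact: (L1_dot_law (gaussian_dot t) (f := fun y : R => y) _ (L1Z _ (@std_L1 R))).
Qed.

Lemma is_gaussian_law_gaussian : is_gaussian_law 0 S (gaussian S).
Proof.

have mean i : ('E_(gaussian S)[fun x : 'rV[R]_p => x 0%R i] = 0)%E.
  transitivity (\int[gaussian S]_x (dot (delta_mx 0 i) x)%:E)%E.
    by rewrite unlock; apply: eq_integral => x _; rewrite dot_delta.
  by rewrite (EFin_Rintegral (L1_gaussian_dot _)) gaussian_mean.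
split => [t|i|i j].
- exists 0, (Num.sqrt (quad_form S t)) => B mB.
  by rewrite -std_normal_scale//; exact: gaussian_dot.
- by rewrite mean mxE.
rewrite covariance.unlock !mean/= unlock.
pose e k : 'rV[R]_p := delta_mx 0 k.
(* Polarization reduces covariances to second moments of linear forms; [1 *:] matches the shape of
   [quad_form_pair]. *)
have E (x : 'rV[R]_p) : x 0 i * x 0 j =
    2^-1 * (dot (e i + 1 *: e j) x ^+ 2 - dot (e i) x ^+ 2 - dot (e j) x ^+ 2).
  by rewrite dotDl scale1r !dot_delta; field.
have L := L1Z 2^-1 (L1B (L1B (L1_gaussian_sqr (e i + 1 *: e j)) (L1_gaussian_sqr (e i)))
  (L1_gaussian_sqr (e j))).
rewrite (_ : (fun x => _) = fun x => (2^-1 * (dot (e i + 1 *: e j) x ^+ 2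
  - dot (e i) x ^+ 2 - dot (e j) x ^+ 2))%:E); last first.
  by apply/funext => x /=; congr EFin; rewrite -E -[x 0 i]subr0 -[x 0 j]subr0.
rewrite (EFin_Rintegral L); congr EFin.
rewrite (RintegralZl _ measurableT (L1B (L1B (L1_gaussian_sqr (e i + 1 *: e j))
  (L1_gaussian_sqr (e i))) (L1_gaussian_sqr (e j)))).
rewrite (RintegralB measurableT (L1B (L1_gaussian_sqr (e i + 1 *: e j))
  (L1_gaussian_sqr (e i))) (L1_gaussian_sqr (e j))).
rewrite (RintegralB measurableT (L1_gaussian_sqr (e i + 1 *: e j)) (L1_gaussian_sqr (e i))).
rewrite !gaussian_sqr /e (quad_form_pair i j 1 (proj1 pS)) !quad_form_unit.
by move: (S i i) (S j j) (S i j) => u v z; field.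
Qed.

End GaussianMoments.

End GaussianVector.

(** * From cosines to bounded continuous functions *)

Section Walk.
Context {R : realType}.
Implicit Types (g h : R -> R) (n : nat) (v y z : R).

(* The mean of [g] after [n] steps of size [dl], upwards with probability [(1 + v) / 2], from [y]. *)
Fixpoint walk n (dl v : R) g y : R :=
  if n is n'.+1 then (1 + v) / 2 * walk n' dl v g (y + dl) + (1 - v) / 2 * walk n' dl v g (y - dl)
  else g y.

Lemma walk_dist_le n dl v g h (c y : R) : `|v| <= 1 -> (forall z, `|g z - c| <= h z) ->
  `|walk n dl v g y - c| <= walk n dl v h y.
Proof.
move=> v1 gh; elim: n y => [|n ih] y //=.
have := ih (y + dl); have := ih (y - dl); move: v1.
move: (walk n dl v g _) (walk n dl v g _) (walk n dl v h _) (walk n dl v h _) => a b a' b'.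
by rewrite !ler_norml => /andP[v1 v2] /andP[h1 h2] /andP[h3 h4]; apply/andP; split; nra.
Qed.

(** Bias and variance: [n] independent steps have mean [n dl v] and variance [n dl^2 (1 - v^2)]. *)
Lemma walk_sqr n dl v (al be a y : R) :
  walk n dl v (fun z => al + be * (z - a) ^+ 2) y =
  al + be * ((y + n%:R * (dl * v) - a) ^+ 2 + n%:R * (dl ^+ 2 * (1 - v ^+ 2))).
Proof.
elim: n y => [|n ih] y /=; first by rewrite !mul0r !addr0.
by rewrite !ih -natr1; field.
Qed.

Lemma walk_bound n dl v g (M y : R) : `|v| <= 1 -> (forall z, `|g z| <= M) ->
  `|walk n dl v g y| <= M.
Proof.
move=> v1 gM; have := @walk_dist_le n dl v g (fun z => M + 0 * (z - 0) ^+ 2) 0 y v1.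
rewrite walk_sqr mul0r addr0 subr0; apply=> z.
by rewrite mul0r addr0 subr0.
Qed.

(** The walk has mean [L v], within [x^2 / L] of [x], and variance at most [(L / m.+1)^2]. The
    deviation [|z - x|] is not quadratic in [z]; it is dominated by a quadratic function, whose mean
    [walk_sqr] computes exactly. *)
Lemma walk_sin_dist (L : R) m g (k b c x : R) : 0 < L -> 0 <= k ->
  (forall z, `|g z - c| <= b + k * `|z - x|) ->
  `|walk (m.+1 ^ 2) (L / (m.+1 ^ 2)%:R) (sin (x / L)) g 0 - c| <=
  b + k * (x ^+ 2 / L + 2 * L / m.+1%:R).
Proof.
move=> L0 k0 gb; set v := sin _; have v1 : `|v| <= 1 by exact: sin_max.
have m0 : 0 < m.+1%:R :> R by rewrite ltr0n.
(* The inverse of the standard deviation bound: in [q <= 1/r + r q^2] both terms then contribute at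
   most [L / m.+1]. *)
pose r := m.+1%:R / L; have r0 : 0 < r by rewrite divr_gt0.
have xa : `|L * v - x| <= x ^+ 2 / L.
  have := sin_sub_le (x / L); rewrite -/v /cubic_rem le_min => h.
  have {h} /andP[h _] := h.
  rewrite (_ : L * v - x = L * (v - x / L)); last by field; rewrite gt_eqF.
  rewrite normrM (gtr0_norm L0) (_ : x ^+ 2 / L = L * (x / L) ^+ 2) ?ler_pM2l//.
  by field; rewrite gt_eqF.
have H z : `|g z - c| <= (b + k * (`|L * v - x| + r^-1)) + (k * r) * (z - L * v) ^+ 2.
  rewrite (le_trans (gb z))// -addrA lerD2l -mulrA -mulrDr ler_wpM2l//.
  have t1 : `|z - x| <= `|z - L * v| + `|L * v - x|.
    by rewrite (le_trans _ (ler_normD _ _))// addrA subrK.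
  have t2 : `|z - L * v| <= r^-1 + r * (z - L * v) ^+ 2.
    rewrite -(real_normK (num_real (z - L * v))); set q := `|_|.
    have rV : r * r^-1 = 1 by rewrite mulfV// gt_eqF.
    have ri0 : 0 < r^-1 by rewrite invr_gt0.
    have q0 : 0 <= q by exact: normr_ge0.
    move: (r) (r^-1) (q) r0 ri0 rV q0 => r1 s q1 r0' s0 rV q0'.
    have -> : s + r1 * q1 ^+ 2 = r1 * (q1 - s / 2) ^+ 2 + q1 + 3 / 4 * s.
      apply/eqP; rewrite -subr_eq0 (_ : _ - _ = (r1 * s - 1) * (q1 - s / 4)); last by field.
      by rewrite rV subrr mul0r.
    by have := sqr_ge0 (q1 - s / 2); nra.
  lra.
have := walk_dist_le (m.+1 ^ 2) (L / (m.+1 ^ 2)%:R) 0 v1 H; rewrite walk_sqr => h.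
apply: (le_trans h); rewrite natrX.
have v2 : v ^+ 2 >= 0 by exact: sqr_ge0.
have -> : b + k * (`|L * v - x| + r^-1) + k * r *
     ((0 + m.+1%:R ^+ 2 * (L / m.+1%:R ^+ 2 * v) - L * v) ^+ 2 +
      m.+1%:R ^+ 2 * ((L / m.+1%:R ^+ 2) ^+ 2 * (1 - v ^+ 2))) =
   b + k * (`|L * v - x| + (L / m.+1%:R) * (2 - v ^+ 2)).
  by rewrite /r; field; rewrite !gt_eqF.
rewrite lerD2l ler_wpM2l// lerD// -[X in _ <= X]mulrA [X in _ <= X]mulrC ler_wpM2l//.
  by rewrite divr_ge0// ltW.
by rewrite lerBlDr lerDl.
Qed.

End Walk.

(** * Approximation by trigonometric polynomials *)

Section TrigApproximation.
Context {R : realType} {p : nat}.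
Implicit Types (f g : 'rV[R]_p -> R) (t x y : 'rV[R]_p) (k i j : 'I_p) (s : seq 'I_p).

(** Linear combinations suffice as constructors: products reduce to them by [trigM], and sines are
    cosines with a phase. Convergence on the class thus follows from the cosines by linearity. *)
Inductive trig : ('rV[R]_p -> R) -> Prop :=
| trig_cos t (c : R) : trig (fun x => cos (dot t x + c))
| trigD f g : trig f -> trig g -> trig (fun x => f x + g x)
| trigZ (a : R) f : trig f -> trig (fun x => a * f x).

Lemma trigM f g : trig f -> trig g -> trig (fun x => f x * g x).
Proof.
elim=> {f} [t c|f f' _ ihf _ ihf'|a f _ ihf] tg; last 2 first.
- by under eq_fun do rewrite mulrDl; apply: trigD; [exact: ihf|exact: ihf'].
- by under eq_fun do rewrite -mulrA; apply: trigZ; exact: ihf.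
elim: tg => {g} [t' c'|g g' _ ihg _ ihg'|a g _ ihg]; last 2 first.
- by under eq_fun do rewrite mulrDr; exact: trigD.
- by under eq_fun do rewrite mulrCA; exact: trigZ.
rewrite (_ : (fun x => _) = fun x => 2^-1 * (cos (dot (t + t') x + (c + c')) +
    cos (dot (t + -1 *: t') x + (c - c')))); first by apply/trigZ/trigD; exact: trig_cos.
apply/funext => x; rewrite !dotDl ![dot (_ *: _) x]dotC dotZ [dot x t']dotC.
rewrite (_ : dot t x + dot t' x + _ = (dot t x + c) + (dot t' x + c')); last by ring.
rewrite (_ : dot t x + -1 * dot t' x + _ = (dot t x + c) - (dot t' x + c')); last by ring.
by rewrite [in RHS]cosD [in RHS]cosB; field.
Qed.

Lemma trig_cst (a : R) : trig (fun=> a).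
Proof.
rewrite (_ : (fun=> a) = fun x => a * cos (dot 0 x + 0)); first exact/trigZ/trig_cos.
by apply/funext => x; rewrite dotC dot0 addr0 cos0 mulr1.
Qed.

Lemma trig_sin_coord (L : R) i : trig (fun x => sin (x 0 i / L)).
Proof.
rewrite (_ : (fun x => _) = fun x => cos (dot (L^-1 *: delta_mx 0 i) x + - (pi / 2))).
  exact: trig_cos.
apply/funext => x; rewrite dotC dotZ dotC dot_delta [L^-1 * _]mulrC.
by rewrite -[in LHS](subrK (pi / 2) (x 0 i / L)) sinDpihalf.
Qed.

Lemma trig_measurable_bounded f : trig f ->
  measurable_fun setT f /\ exists M : R, forall x, `|f x| <= M.
Proof.
elim=> {f} [t c|f g _ [mf [M fM]] _ [mg [M' gM]]|a f _ [mf [M fM]]].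
- split; last by exists 1 => x; exact: cos_max.
  have mc := measurable_cos_affine 1 c; rewrite (_ : (fun x => _) = (fun z : R => cos (1 * z + c)) \o dot t).
    exact: (measurableT_comp mc (measurable_dot t)).
  by apply/funext => x /=; rewrite mul1r.
- split; first exact: measurable_funD.
  by exists (M + M') => x; rewrite (le_trans (ler_normD _ _))// lerD.
- split; first exact: measurable_funM.
  by exists (`|a| * M) => x; rewrite normrM ler_wpM2l.
Qed.

Definition set_coord k (z : R) x : 'rV[R]_p := \row_i (if i == k then z else x 0 i).

(* [sin (x 0 k / L)] as drift makes the result a trigonometric
   polynomial in [x], and [L * sin (x 0 k / L)], the mean of the walk, is close to [x 0 k]. *)
Fixpoint smoothing (L : R) m s f x : R :=
  if s is k :: s' then
    walk (m.+1 ^ 2) (L / (m.+1 ^ 2)%:R) (sin (x 0 k / L))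
      (fun z => smoothing L m s' (f \o set_coord k z) x) 0
  else f x.

Lemma trig_walk n (dl : R) L k (G : R -> 'rV[R]_p -> R) (y : R) : (forall z, trig (G z)) ->
  trig (fun x => walk n dl (sin (x 0 k / L)) (fun z => G z x) y).
Proof.
move=> tG; elim: n y => [|n ih] y //=.
rewrite (_ : (fun x => _) = fun x =>
  (2^-1 + 2^-1 * sin (x 0 k / L)) * walk n dl (sin (x 0 k / L)) (fun z => G z x) (y + dl) +
  (2^-1 + - 2^-1 * sin (x 0 k / L)) * walk n dl (sin (x 0 k / L)) (fun z => G z x) (y - dl)).
  by apply: trigD; apply: trigM => //; apply: trigD; [exact: trig_cst|
     exact/trigZ/trig_sin_coord|exact: trig_cst|exact/trigZ/trig_sin_coord].
by apply/funext => x; field.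
Qed.

(** Once every relevant coordinate is replaced by a walk position, [f] is evaluated at fixed points
    only; [x] enters through the step probabilities, which are affine in [sin (x_k / L)]. *)
Lemma trig_smoothing L m s f : (forall x y, (forall i, i \in s -> x 0 i = y 0 i) -> f x = f y) ->
  trig (smoothing L m s f).
Proof.
elim: s f => [|k s ih] f fs.
  by rewrite (_ : smoothing _ _ _ _ = fun=> f 0); [exact: trig_cst|apply/funext => x; exact: fs].
apply: trig_walk => z; apply: ih => x y xy /=; apply: fs => i; rewrite inE !mxE.
by case: eqP => //= _; exact: xy.
Qed.

Lemma smoothing_bound L m s f (M : R) x : (forall x, `|f x| <= M) -> `|smoothing L m s f x| <= M.
Proof.
elim: s f => [|k s ih] f fM; [exact: fM|apply: walk_bound; first exact: sin_max].
by move=> z; apply: ih => y; exact: fM.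
Qed.

(** Fixing a coordinate preserves the Lipschitz constant, so the errors of the coordinates add
    up. *)
Lemma smoothing_dist L m s f (kp : R) x : 0 < L -> 0 <= kp ->
  (forall x y, `|f x - f y| <= kp * \sum_i `|x 0 i - y 0 i|) ->
  `|smoothing L m s f x - f x| <= \sum_(i <- s) kp * (x 0 i ^+ 2 / L + 2 * L / m.+1%:R).
Proof.
move=> L0 kp0; elim: s f => [|k s ih] f fL; first by rewrite big_nil subrr normr0.
rewrite big_cons [X in _ <= X]addrC; apply: walk_sin_dist => // z.
have fz : forall x y, `|(f \o set_coord k z) x - (f \o set_coord k z) y| <=
    kp * \sum_i `|x 0 i - y 0 i|.
  move=> a b; rewrite (le_trans (fL _ _))// ler_wpM2l// ler_sum// => i _; rewrite !mxE.
  by case: eqP => // _; rewrite subrr normr0.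
have := ih _ fz; have := fL (set_coord k z x) x.
rewrite (bigD1 k)//= big1 => [|i /negbTE ik]; last by rewrite mxE ik subrr normr0.
rewrite mxE eqxx addr0 => h1 h2.
by rewrite -[X in `|X|](subrKA (f (set_coord k z x))) (le_trans (ler_normD _ _))// lerD.
Qed.

End TrigApproximation.

Section QuadraticError.
Context {d : measure_display} {T : measurableType d} {R : realType} {p : nat}.
Variable Q : probability T R.

Lemma Rintegral_ae_norm_le (F G : T -> R) : L1 Q F -> L1 Q G ->
  {ae Q, forall x, `|F x| <= G x} -> `|\int[Q]_x F x| <= \int[Q]_x G x.
Proof.
move=> LF LG FG; rewrite (le_trans (le_normr_Rintegral measurableT LF))//.
have Lmax : L1 Q (fun x => Num.max (G x) `|F x|).
  apply: (L1_dom _ (L1D (L1_norm LG) (L1_norm LF))).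
    by apply: measurable_maxr; [exact: L1_measurable LG|exact: (L1_measurable (L1_norm LF))].
  by move=> x; rewrite /Num.max; case: ifP => _; rewrite ?normr_id ?lerDl ?lerDr.
have <- : \int[Q]_x Num.max (G x) `|F x| = \int[Q]_x G x.
  by apply: Rintegral_ae_eq => //; apply: filterS FG => x; exact: max_l.
apply: le_Rintegral => //; first exact: L1_norm.
by move=> x _; rewrite le_max lexx orbT.
Qed.

(** Serves three times: under [P] with the squared coordinates of [Y n], under [N w] with those of
    the limit vector, and under [P] with their integrals against [N w]. *)
Lemma quadratic_error (Z : 'I_p -> T -> R) (V : 'I_p -> R) (F : T -> R) (kp L c : R) :
  L1 Q F -> (forall i, L1 Q (Z i)) -> (forall i, \int[Q]_x Z i x <= V i) -> 0 <= kp -> 0 < L ->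
  {ae Q, forall x, `|F x| <= \sum_i kp * (Z i x / L + c)} ->
  `|\int[Q]_x F x| <= \sum_i kp * (V i / L + c).
Proof.
move=> LF LZ ZV kp0 L0 FZ.
have LG i : L1 Q (fun x => kp / L * Z i x + kp * c) by apply: L1D; [exact: L1Z|exact: L1_cst].
apply: (@le_trans _ _ (\int[Q]_x \sum_i (kp / L * Z i x + kp * c))).
  apply: Rintegral_ae_norm_le => //; first exact: L1_sum.
  by apply: filterS FZ => x h; rewrite (le_trans h)// ler_sum// => i _; rewrite le_eqVlt; apply/orP; left; apply/eqP; ring.
rewrite (Rintegral_sumL _ LG) ler_sum// => i _.
rewrite (RintegralD measurableT (L1Z (kp / L) (LZ i)) (L1_cst Q (kp * c))).
rewrite (RintegralZl _ measurableT (LZ i)) Rintegral_prob_cst mulrDr lerD2r.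
by rewrite [V i / L]mulrC mulrA ler_wpM2l// divr_ge0// ltW.
Qed.

End QuadraticError.

(** * Lipschitz approximation from below *)

Section InfConvolution.
Context {R : realType} {p : nat}.
Implicit Types (f : 'rV[R]_p -> R) (x y z : 'rV[R]_p).

Definition dist1 x y : R := \sum_i `|x 0 i - y 0 i|.

Lemma dist1_triangle z x y : dist1 x y <= dist1 x z + dist1 z y.
Proof.
rewrite /dist1 -big_split/=; apply: ler_sum => i _.
by rewrite (le_trans _ (ler_normD _ _))// addrA subrK.
Qed.

Lemma dist1_ge0 x y : 0 <= dist1 x y.
Proof. exact: sumr_ge0. Qed.

Lemma dist1xx x : dist1 x x = 0.
Proof. by apply: big1 => i _; rewrite subrr normr0. Qed.

Lemma dist1C x y : dist1 x y = dist1 y x.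
Proof. by apply: eq_bigr => i _; rewrite distrC. Qed.

Lemma ball_dist1 x y (e : R) : ball x e y -> dist1 x y <= p%:R * e.
Proof.
move=> [_ xy]; rewrite /dist1 (le_trans (y := \sum_(i < p) e))//.
  by apply: ler_sum => i _; rewrite ltW//; exact: xy.
by rewrite sumr_const card_ord mulr_natl.
Qed.

Lemma dist1_ball x y (e : R) : 0 < e -> dist1 x y < e -> ball x e y.
Proof.
move=> e0 xy; split=> // i j; rewrite (ord1 i) /ball/= (le_lt_trans _ xy)//.
by rewrite /dist1 (bigD1 j)//= lerDl sumr_ge0.
Qed.

Lemma dist1_lipschitz_continuous f (kp : R) : 0 <= kp ->
  (forall x y, `|f x - f y| <= kp * dist1 x y) -> continuous f.
Proof.
move=> kp0 fL x; apply/(@cvgrPdist_lt _ _ _ (nbhs x)) => e e0.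
have d0 : 0 < kp * p%:R + 1 by rewrite ltr_wpDl// mulr_ge0.
have := @nbhsx_ballx _ _ x (e / (kp * p%:R + 1)); rewrite divr_gt0// => /(_ isT).
apply: filterS => y /ball_dist1 xy; rewrite (le_lt_trans (fL x y))//.
rewrite (le_lt_trans (ler_wpM2l kp0 xy))// mulrA mulrCA gtr_pMr// ltr_pdivrMr// mul1r.
by rewrite ltrDl.
Qed.

(** The Pasch-Hausdorff envelope: for bounded [f] and [k >= 0], the largest minorant of [f] that is
    [k]-Lipschitz for [dist1]. *)
Definition inf_conv f (k : R) x : R := inf [set f y + k * dist1 x y | y in [set: 'rV[R]_p]].

Variables (f : 'rV[R]_p -> R) (M : R).
Hypothesis fM : forall x, `|f x| <= M.

Let fl x : - M <= f x. Proof. by have := fM x; rewrite ler_norml => /andP[]. Qed.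
Let fu x : f x <= M. Proof. by have := fM x; rewrite ler_norml => /andP[]. Qed.
Let M0 : 0 <= M. Proof. exact: le_trans (normr_ge0 _) (fM 0). Qed.

Lemma inf_conv_le k x y : 0 <= k -> inf_conv f k x <= f y + k * dist1 x y.
Proof.
move=> k0; apply: ge_inf; last by exists y.
by exists (- M) => _ [z _ <-]; rewrite -[- M]addr0 lerD// mulr_ge0// dist1_ge0.
Qed.

Lemma le_inf_conv k x (a : R) : (forall y, a <= f y + k * dist1 x y) -> a <= inf_conv f k x.
Proof.
move=> H; apply: lb_le_inf; first by exists (f x + k * dist1 x x), x.
by move=> _ [y _ <-].
Qed.

Lemma inf_conv_le_self k x : 0 <= k -> inf_conv f k x <= f x.
Proof. by move=> k0; have := inf_conv_le x x k0; rewrite dist1xx mulr0 addr0. Qed.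

Lemma inf_conv_bound k x : 0 <= k -> `|inf_conv f k x| <= M.
Proof.
move=> k0; rewrite ler_norml (le_trans (inf_conv_le_self x k0))// andbT.
by apply: le_inf_conv => y; rewrite -[- M]addr0 lerD// mulr_ge0// dist1_ge0.
Qed.

Lemma inf_conv_lipschitz k x y : 0 <= k ->
  `|inf_conv f k x - inf_conv f k y| <= k * dist1 x y.
Proof.
move=> k0.
have H u v : inf_conv f k u - k * dist1 u v <= inf_conv f k v.
  apply: le_inf_conv => z; rewrite lerBlDr (le_trans (inf_conv_le u z k0))//.
  by rewrite -addrA lerD2l -mulrDr ler_wpM2l// addrC dist1_triangle.
have := H x y; have := H y x; rewrite (dist1C y x) ler_norml; lra.
Qed.

(** [f] varies by at most [2 M], so once [n dl >= 2 M] a point at distance at least [dl] cannot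
    undercut [f x]; closer points are handled by continuity at [x]. *)
Lemma inf_conv_cvg x : {for x, continuous f} -> inf_conv f n%:R x @[n --> \oo] --> f x.
Proof.
move=> /cvgrPdist_lt cf; apply/cvgrPdist_le => e e0; have := cf _ e0.
move=> /nbhs_ballP[dl /= dl0 Hdl].
exists (Num.bound (2 * M / dl)) => // n /= nb.
have nM : 2 * M <= n%:R * dl.
  have q0 : 0 <= 2 * M / dl by rewrite divr_ge0 ?mulr_ge0// ltW.
  by rewrite -ler_pdivrMr// (le_trans (ltW (archi_boundP q0)))// ler_nat.
have n0 : 0 <= n%:R :> R by [].
rewrite ger0_norm ?subr_ge0 ?inf_conv_le_self// lerBlDl -lerBlDr; apply: le_inf_conv => y.
have [xy|xy] := ltP (dist1 x y) dl.
  have := Hdl y (dist1_ball dl0 xy); rewrite /= ltr_norml => /andP[_ h].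
  by have := mulr_ge0 n0 (dist1_ge0 x y); lra.
have := ler_wpM2l n0 xy; have := fl y; have := fu x; lra.
Qed.

End InfConvolution.

(** * Convergence of integrals of test functions *)

Section TestFunctions.
Context {d : measure_display} {Omega : measurableType d} {R : realType} {p : nat}.
Variables (P : probability Omega R) (Y : nat -> Omega -> 'rV[R]_p)
  (N : {mfun Omega >-> pprobability 'rV[R]_p R}) (V : 'I_p -> R).
Hypothesis mY : forall n, measurable_fun setT (Y n).
Hypothesis LY : forall n i, L1 P (fun w => Y n w 0 i ^+ 2).
Hypothesis YV : forall n i, \int[P]_w (Y n w 0 i ^+ 2) <= V i.
Hypothesis N2 : {ae P, forall w, forall i, L1 (N w) (fun x => x 0 i ^+ 2)}.
Hypothesis LN : forall i, L1 P (kerint N (fun x => x 0 i ^+ 2)).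
Hypothesis NV : forall i, \int[P]_w kerint N (fun x => x 0 i ^+ 2) w <= V i.
Hypothesis cosYN : forall t (c : R) H, measurable H ->
  \int[P]_w (\1_H w * cos (dot t (Y n w) + c)) @[n --> \oo] -->
  \int[P]_w (\1_H w * kerint N (fun x => cos (dot t x + c)) w).
Implicit Types (f g : 'rV[R]_p -> R) (H : set Omega).

Let bm f (M : R) := measurable_fun setT f /\ forall x, `|f x| <= M.

Let L1bm f M (Q : probability 'rV[R]_p R) : bm f M -> L1 Q f.
Proof. by move=> [mf fM]; exact: (L1_bounded Q mf fM). Qed.

Let indic_le1 H w : `|\1_H w : R| <= 1.
Proof. by rewrite indicE; case: (_ \in _); rewrite ?normr1 ?normr0. Qed.

Let indicM_le H (u M : R) w : `|u| <= M -> `|\1_H w * u| <= M.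
Proof. by move=> uM; rewrite normrM (le_trans _ uM)// ler_piMl. Qed.

Let L1Y H f M n : measurable H -> bm f M -> L1 P (fun w => \1_H w * f (Y n w)).
Proof.
move=> mH [mf fM]; apply: (@L1_bounded _ _ _ _ _ M) => [|w]; last exact: indicM_le.
by apply: measurable_funM; [exact: measurable_indic|exact: measurableT_comp].
Qed.

Let kerint_le f M w : bm f M -> `|kerint N f w| <= M.
Proof. by move=> [mf fM]; exact: Rintegral_bounded. Qed.

Let L1N H f M : measurable H -> bm f M -> L1 P (fun w => \1_H w * kerint N f w).
Proof.
move=> mH bf; apply: (@L1_bounded _ _ _ _ _ M) => [|w]; last exact/indicM_le/kerint_le.
by apply: measurable_funM; [exact: measurable_indic|apply: measurable_kerint; exact: bf.1].
Qed.

Definition test_cvg f := forall H, measurable H ->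
  \int[P]_w (\1_H w * f (Y n w)) @[n --> \oo] --> \int[P]_w (\1_H w * kerint N f w).

Lemma test_cvg_trig f : trig f -> test_cvg f.
Proof.
elim=> {f} [t c|f g tf ihf tg ihg|a f tf ihf] H mH; first exact: cosYN.
- have [mf [M fM]] := trig_measurable_bounded tf; have bf : bm f M by [].
  have [mg [M' gM]] := trig_measurable_bounded tg; have bg : bm g M' by [].
  rewrite (_ : (fun n => _) = fun n => \int[P]_w (\1_H w * f (Y n w)) + \int[P]_w (\1_H w * g (Y n w))).
    rewrite (_ : \int[P]_w _ = \int[P]_w (\1_H w * kerint N f w) + \int[P]_w (\1_H w * kerint N g w)).
      by apply: cvgD; [exact: ihf|exact: ihg].
    rewrite -(RintegralD measurableT (L1N mH bf) (L1N mH bg)); apply: eq_Rintegral => w _.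
    by rewrite -mulrDr /kerint -(RintegralD measurableT (L1bm _ bf) (L1bm _ bg)).
  apply/funext => n; rewrite -(RintegralD measurableT (L1Y n mH bf) (L1Y n mH bg)).
  by apply: eq_Rintegral => w _; rewrite mulrDr.
- have [mf [M fM]] := trig_measurable_bounded tf; have bf : bm f M by [].
  rewrite (_ : (fun n => _) = fun n => a * \int[P]_w (\1_H w * f (Y n w))).
    rewrite (_ : \int[P]_w _ = a * \int[P]_w (\1_H w * kerint N f w)).
      by apply: cvgMr; exact: ihf.
    rewrite -(RintegralZl _ measurableT (L1N mH bf)); apply: eq_Rintegral => w _.
    by rewrite mulrCA /kerint -(RintegralZl _ measurableT (L1bm _ bf)).
  apply/funext => n; rewrite -(RintegralZl _ measurableT (L1Y n mH bf)).
  by apply: eq_Rintegral => w _; rewrite mulrCA.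
Qed.

Lemma test_cvg_lipschitz f (M kp : R) : measurable_fun setT f -> (forall x, `|f x| <= M) ->
  0 <= kp -> (forall x y, `|f x - f y| <= kp * \sum_i `|x 0 i - y 0 i|) -> test_cvg f.
Proof.
move=> mf fM kp0 fL H mH; have bf : bm f M by [].
(* With [L = j.+1] and [m.+1 = j.+1 ^ 2], both error terms of [smoothing_dist] are of order
   [1 / j.+1]. *)
pose T (j : nat) := smoothing j.+1%:R (j.+1 ^ 2).-1 (enum 'I_p) f.
have tT j : trig (T j).
  by apply: trig_smoothing => x y xy; congr f; apply/rowP => i; apply: xy; rewrite mem_enum.
have bT j : bm (T j) M.
  split; first exact: (trig_measurable_bounded (tT j)).1.
  by move=> x; exact: smoothing_bound.
pose D := \sum_i kp * (V i + 2).
have fT j x : `|T j x - f x| <= \sum_i kp * (x 0 i ^+ 2 / j.+1%:R + 2 / j.+1%:R).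
  have := @smoothing_dist R p j.+1%:R (j.+1 ^ 2).-1 (enum 'I_p) f kp x (ltr0Sn _ _) kp0 fL.
  rewrite big_enum [(j.+1 ^ 2).-1.+1]prednK ?expn_gt0// natrX.
  rewrite (_ : 2 * j.+1%:R / j.+1%:R ^+ 2 = 2 / j.+1%:R)//; field.
  by rewrite nat1r pnatr_eq0.
have DE (j : nat) : \sum_i kp * (V i / j.+1%:R + 2 / j.+1%:R) = D / j.+1%:R.
  by rewrite /D mulr_suml; apply: eq_bigr => i _; rewrite -mulrDl mulrA.
have eY j n : `|\int[P]_w (\1_H w * T j (Y n w)) - \int[P]_w (\1_H w * f (Y n w))| <= D / j.+1%:R.
  rewrite -DE -(RintegralB measurableT (L1Y n mH (bT j)) (L1Y n mH bf)).
  apply: (quadratic_error (Z := fun i w => Y n w 0 i ^+ 2)) => //.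
    exact: L1B (L1Y n mH (bT j)) (L1Y n mH bf).
  by apply: aeW => w; rewrite -mulrBr; exact: indicM_le.
have eN j : `|\int[P]_w (\1_H w * kerint N (T j) w) - \int[P]_w (\1_H w * kerint N f w)| <= D / j.+1%:R.
  rewrite -DE -(RintegralB measurableT (L1N mH (bT j)) (L1N mH bf)).
  apply: (quadratic_error (Z := fun i => kerint N (fun x => x 0 i ^+ 2))) => //.
    exact: L1B (L1N mH (bT j)) (L1N mH bf).
  apply: filterS N2 => w Lw; rewrite -mulrBr; apply: indicM_le.
  rewrite /kerint -(RintegralB measurableT (L1bm (N w) (bT j)) (L1bm (N w) bf)).
  apply: (quadratic_error (Z := fun i (x : 'rV[R]_p) => x 0 i ^+ 2)) => //.
    exact: L1B (L1bm (N w) (bT j)) (L1bm (N w) bf).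
  exact: aeW.
apply/cvgrPdist_lt => e e0.
have [j je] : exists j : nat, D / j.+1%:R < e / 4.
  have : (fun j : nat => D * j.+1%:R^-1) @ \oo --> D * 0 by apply: cvgMr; exact: cvg_harmonic.
  rewrite mulr0 => /cvgrPdist_lt /(_ (e / 4)); rewrite divr_gt0// => /(_ isT)[k _ /(_ k (leqnn k))].
  by rewrite sub0r normrN => h; exists k; rewrite (le_lt_trans (ler_norm _)).
have /cvgrPdist_lt /(_ (e / 4)) := test_cvg_trig (tT j) mH; rewrite divr_gt0// => /(_ isT).
apply: filterS => n; have := eY j n; have := eN j; move: je.
move: (\int[P]_w _) (\int[P]_w _) (\int[P]_w _) (\int[P]_w _) => a b c c'.
by move: (D / _) => q; rewrite !ler_norml !ltr_norml; lra.
Qed.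

Lemma cvg_inf_conv_test f (M : R) H : continuous f -> (forall x, `|f x| <= M) -> measurable H ->
  \int[P]_w (\1_H w * kerint N (inf_conv f j%:R) w) @[j --> \oo] -->
  \int[P]_w (\1_H w * kerint N f w).
Proof.
move=> cf fM mH; have mf := continuous_measurable_row cf; have bf : bm f M by [].
have n0 (j : nat) : 0 <= j%:R :> R by [].
have bj j : bm (inf_conv f j%:R) M.
  split; last by move=> x; exact: inf_conv_bound.
  apply: continuous_measurable_row; apply: (@dist1_lipschitz_continuous _ _ _ j%:R) => // x y.
  exact: inf_conv_lipschitz fM _ _ _ _.
apply: (@cvg_Rintegral_dom _ _ _ _ _ _ (fun=> M)).
- by move=> j; exact: L1_measurable (L1N mH (bj j)).
- exact: L1_measurable (L1N mH bf).
- exact: L1_cst.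
- by move=> j w; exact/indicM_le/kerint_le.
apply: aeW => w; apply: cvgMr.
apply: (@cvg_Rintegral_dom _ _ _ _ _ _ (fun=> M)) => //.
- by move=> j; exact: (bj j).1.
- exact: L1_cst.
- by move=> j; exact: (bj j).2.
by apply: aeW => x; exact: (inf_conv_cvg fM (cf x)).
Qed.

(** Envelopes from below give only the lower bound, since their integrals lie below those of [f];
    the upper bound comes from applying this to [- f]. *)
Lemma test_cvg_lower f (M e : R) H : continuous f -> (forall x, `|f x| <= M) -> measurable H ->
  0 < e -> \forall n \near \oo,
    \int[P]_w (\1_H w * kerint N f w) - e < \int[P]_w (\1_H w * f (Y n w)).
Proof.
move=> cf fM mH e0; have mf := continuous_measurable_row cf; have bf : bm f M by [].
have n0 (j : nat) : 0 <= j%:R :> R by [].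
have /cvgrPdist_lt /(_ (e / 2)) := cvg_inf_conv_test cf fM mH.
rewrite divr_gt0// => /(_ isT)[j _ /(_ j (leqnn j))] /= hj.
have Lj x y : `|inf_conv f j%:R x - inf_conv f j%:R y| <= j%:R * \sum_i `|x 0 i - y 0 i|.
  exact: inf_conv_lipschitz fM _ _ _ _.
have mj : measurable_fun setT (inf_conv f j%:R).
  by apply: continuous_measurable_row; exact: dist1_lipschitz_continuous (n0 j) Lj.
have bj : bm (inf_conv f j%:R) M by split=> // x; exact: inf_conv_bound.
have /cvgrPdist_lt /(_ (e / 2)) := test_cvg_lipschitz mj bj.2 (n0 j) Lj mH.
rewrite divr_gt0// => /(_ isT); apply: filterS => n hn.
have le : \int[P]_w (\1_H w * inf_conv f j%:R (Y n w)) <= \int[P]_w (\1_H w * f (Y n w)).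
  apply: le_Rintegral => //; [exact: L1Y mH bj|exact: L1Y mH bf|].
  by move=> w _; rewrite ler_wpM2l ?indicE//; exact: inf_conv_le_self fM _ _ _.
move: hj hn le; move: (\int[P]_w _) (\int[P]_w _) (\int[P]_w _) (\int[P]_w _) => a b c c'.
by rewrite !ltr_norml; lra.
Qed.

Lemma test_cvg_continuous f (M : R) : continuous f -> (forall x, `|f x| <= M) -> test_cvg f.
Proof.
move=> cf fM H mH; have mf := continuous_measurable_row cf; have bf : bm f M by [].
have cN : continuous (fun x => - f x) by move=> x; exact: cvgN (cf x).
have NM x : `|- f x| <= M by rewrite normrN.
apply/cvgrPdist_lt => e e0.
apply: filterS2 (test_cvg_lower cf fM mH e0) (test_cvg_lower cN NM mH e0) => n h1.
have E1 : \int[P]_w (\1_H w * - f (Y n w)) = - \int[P]_w (\1_H w * f (Y n w)).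
  rewrite -mulN1r -(RintegralZl _ measurableT (L1Y n mH bf)).
  by apply: eq_Rintegral => w _; rewrite mulN1r mulrN.
have E2 : \int[P]_w (\1_H w * kerint N (fun x => - f x) w) = - \int[P]_w (\1_H w * kerint N f w).
  rewrite -mulN1r -(RintegralZl _ measurableT (L1N mH bf)).
  apply: eq_Rintegral => w _; rewrite mulN1r -mulrN; congr (_ * _).
  rewrite -mulN1r /kerint -(RintegralZl _ measurableT (L1bm _ bf)).
  by apply: eq_Rintegral => x _; rewrite mulN1r.
rewrite E1 E2; move: h1; move: (\int[P]_w _) (\int[P]_w _) => a b.
by rewrite ltr_norml; lra.
Qed.

End TestFunctions.

(** * The random covariance matrix and the stable limit *)

Lemma second_moment_mx_quad_form (R : realType) (p : nat) (Q : probability 'rV[R]_p R) t :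
  (forall i j, L1 Q (fun x => x 0 i * x 0 j)) ->
  quad_form (second_moment_mx Q) t = \int[Q]_x (dot t x ^+ 2).
Proof.
move=> LQ; have L i j : L1 Q (fun x => t 0 i * t 0 j * (x 0 i * x 0 j)) by exact: L1Z.
under [RHS]eq_Rintegral do rewrite dot_sqrE.
rewrite (Rintegral_sumL _ (fun i => L1_sum _ (L i))); apply: eq_bigr => i _.
rewrite (Rintegral_sumL _ (L i)); apply: eq_bigr => j _.
by rewrite mxE (RintegralZl _ measurableT (LQ i j)).
Qed.

Lemma psd_second_moment_mx (R : realType) (p : nat) (Q : probability 'rV[R]_p R) :
  (forall i j, L1 Q (fun x => x 0 i * x 0 j)) -> psd (second_moment_mx Q).
Proof.
move=> LQ; split=> [i j|t].
  by rewrite !mxE; apply: eq_Rintegral => x _; rewrite mulrC.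
by rewrite second_moment_mx_quad_form//; apply: Rintegral_ge0 => x _; exact: sqr_ge0.
Qed.

Theorem theorem11 (R : realType) (d : measure_display)
    (Omega : measurableType d) (P : probability Omega R) (p : nat)
    (X : nat -> {mfun Omega >-> 'rV[R]_p})
    (nu : probability 'rV[R]_p R) (theta : R)
    (K : {mfun 'rV[R]_p >-> pprobability 'rV[R]_p R})
    (mu : {mfun Omega >-> pprobability 'rV[R]_p R})
    (XL : in_classL P X nu theta K)
    (muX : is_limit_measure P X mu)
    (nu2 : (\int[nu]_x (euclidean_norm x ^+ 2)%:E < +oo)%E)
    (K0 : forall (x : 'rV[R]_p) (i : 'I_p),
        (\int[K x]_y (y 0%R i)%:E = 0)%E) :
  exists N : {mfun Omega >-> pprobability 'rV[R]_p R},
    {ae P, forall w, is_gaussian_law 0 (second_moment_mx (mu w)) (N w)} /\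
    stable_cvg P
      (fun n w => (Num.sqrt n%:R)^-1 *: \sum_(i < n) (X i w : 'rV[R]_p)) N.
Proof.
pose S w := second_moment_mx (mu w).
have mc i : measurable_fun setT (fun x : 'rV[R]_p => x 0 i) by exact: measurable_coord.
have mS i j : measurable_fun setT (fun w => S w i j).
  rewrite (_ : (fun w => _) = kerint mu (fun x => x 0 i * x 0 j)).
    by apply: measurable_kerint; exact: measurable_funM.
  by apply/funext => w; rewrite mxE.
have mN : measurable_fun setT (fun w => gaussian (S w) : pprobability 'rV[R]_p R).
  by apply: measurable_pprobability => A mA; exact: measurable_gaussian.
pose N : {mfun Omega >-> pprobability 'rV[R]_p R} := mfun_Sub (mem_set mN).
have aeL := ae_L1_coordM XL muX nu2.
(* Only almost every [mu w] has finite second moments; elsewhere the entries of [S w] are junk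
   values. *)
have aeS : {ae P, forall w, psd (S w)} by apply: filterS aeL => w; exact: psd_second_moment_mx.
exists N; split; first by apply: filterS aeS => w; exact: is_gaussian_law_gaussian.
have Nsq i : {ae P, forall w, kerint N (fun x => x 0 i ^+ 2) w = kerint mu (fun x => x 0 i * x 0 i) w}.
  apply: filterS aeS => w pS.
  transitivity (\int[gaussian (S w)]_x (dot (delta_mx 0 i) x ^+ 2)).
    by apply: eq_Rintegral => x _; rewrite dot_delta.
  by rewrite gaussian_sqr// quad_form_unit mxE.
have Lmu i := L1_kerint (limit_mixture XL muX) (L1_coordM nu2 i i).
have LN i : L1 P (kerint N (fun x => x 0 i ^+ 2)).
  (* With a constant sequence, [L1_ae_lim] transfers integrability along an almost everywhere
     equality. *)
  apply: (L1_ae_lim (F := fun=> kerint mu (fun x => x 0 i * x 0 i)) _ _ (L1_norm (Lmu i))) => //.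
  - by move=> _; exact: L1_measurable (Lmu i).
  - by apply: measurable_kerint; exact: measurable_funX.
  - by apply: filterS (Nsq i) => w ->; exact: cvg_cst.
(* [bounded_fun] supplies the bound for every number above [M], hence [M + 1]. *)
move=> f cf [M [_ fM]] H mH H0; have bf x : `|f x| <= M + 1 by apply: fM => //; rewrite ltrDl.
have mY n : measurable_fun setT
    (fun w => (Num.sqrt n%:R)^-1 *: \sum_(i < n) (X i w : 'rV[R]_p)).
  apply: measurable_fun_row => i.
  rewrite (_ : (fun w => _) = fun w => (Num.sqrt n%:R)^-1 * \sum_(j < n) X j w 0 i).
    apply: measurable_funM => //; apply: measurable_sum => j.
    exact: (measurable_row_coord i (measurable_funPT (X j))).
  by apply/funext => w; rewrite mxE summxE.
(* One [V] bounds both sides: [N w] has the second moments of [mu w], and the [mu w] average to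
   [nu]. *)
have := test_cvg_continuous mY (V := fun i => \int[nu]_x (x 0 i ^+ 2))
  (fun n i => (scaled_sum_sqr XL nu2 K0 n i).1) (fun n i => (scaled_sum_sqr XL nu2 K0 n i).2)
  _ LN _ _ cf bf mH.
move=> cv; rewrite /expectation_given (_ : (fun n => _) = (fun n => \int[P]_w (\1_H w *
   f ((Num.sqrt n%:R)^-1 *: \sum_(i < n) (X i w : 'rV[R]_p))) / fine (P H))); last first.
  by apply/funext => n; rewrite Rintegral_setE.
rewrite Rintegral_setE//; apply: cvgMl; apply: cv.
- apply: filterS aeS => w pS i; have := L1_gaussian_sqr pS (delta_mx 0 i).
  by under eq_fun do rewrite dot_delta.
- move=> i; rewrite (Rintegral_ae_eq (LN i) (Lmu i) (Nsq i)).
  by rewrite (Rintegral_kerint (limit_mixture XL muX) (L1_coordM nu2 i i)).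
move=> t c H' mH'.
have i1 w : `|\1_H' w : R| <= 1 by rewrite indicE; case: (_ \in _); rewrite ?normr1 ?normr0.
have i1M w (u : R) : `|u| <= 1 -> `|\1_H' w * u| <= 1.
  by move=> u1; rewrite normrM (le_trans _ u1)// ler_piMl.
rewrite [X in _ --> X](_ : _ =
  \int[P]_w (\1_H' w * (cos c * expR (- (kerint mu (fun x => dot t x ^+ 2) w / 2))))).
  by apply: (cvg_cos_dot XL muX nu2 K0 _ i1); exact: measurable_indic.
have mcos : measurable_fun setT (fun x : 'rV[R]_p => cos (dot t x + c)).
  exact: (trig_measurable_bounded (trig_cos t c)).1.
have mdot : measurable_fun setT (kerint mu (fun x => dot t x ^+ 2)).
  by apply: measurable_kerint; apply: measurable_funX; exact: measurable_dot.
apply: Rintegral_ae_eq.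
- apply: (@L1_bounded _ _ _ _ _ 1) => [|w].
    by apply: measurable_funM; [exact: measurable_indic|exact: measurable_kerint].
  by apply: i1M; apply: Rintegral_bounded => // x; exact: cos_max.
- apply: (@L1_bounded _ _ _ _ _ 1) => [|w].
    apply: measurable_funM; first exact: measurable_indic.
    apply: measurable_funM => //; apply: measurableT_comp => //; apply: measurableT_comp => //.
    exact: measurable_funM.
  apply: i1M; rewrite normrM (ger0_norm (expR_ge0 _)) (le_trans (y := expR 0)) ?expR0//.
  rewrite -[X in _ <= X]mul1r ler_pM ?cos_max// ?expR_ge0//.
  rewrite -expR0 ler_expR oppr_le0 divr_ge0//.
  by apply: Rintegral_ge0 => x _; exact: sqr_ge0.
(* The exponent in [cvg_cos_dot] is the quadratic form of [S w] at [t], so the limit is the cosine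
   integral of the Gaussian law [N w]. *)
apply: filterS2 aeS aeL => w pS Lw; congr (_ * _).
by rewrite /kerint gaussian_cos// second_moment_mx_quad_form.
Qed.
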